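(* Let $1<p<\infty$ and $1\le q<\infty$, and let $\{A_n\}_{n=1}^\infty$ be a sequence of atoms with finite (positive) measures. Then $L_{p,q}(0,1)$ embeds isomorphically into $\ell_{p,q}(\{A_n\})$ if and only if $p=q=2$.
   Context: For a $\sigma$-finite measure space $(\Omega,\Sigma,\mu)$, $1<p<\infty$ and $1\le q<\infty$, $L_{p,q}(\Omega)$ is the space of (classes of) real measurable functions $f$ with $\|f\|_{p,q}=\left(\int_0^\infty f^*(t)^q\,d(t^{q/p})\right)^{1/q}<\infty$, where $f^*(t)=\inf\{s>0:\mu(\{|f|>s\})\le t\}$. If $q\le p$ this is a norm; if $q>p$ it is a complete quasi-norm equivalent to a complete norm. $L_{p,q}(0,1)$ uses Lebesgue measure. $\ell_{p,q}(\{A_n\})$ denotes $L_{p,q}(\Omega)$ where $\Omega$ is a purely atomic measure space whose atoms are exactly the $A_n$, $n\ge1$. ''$X$ embeds isomorphically into $Y$'' means $X$ is linearly isomorphic to a closed linear subspace of $Y$. *)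

(* Defs.v *)
From HB Require Import structures.
From mathcomp Require Import all_boot all_order all_algebra generic_quotient.
From mathcomp Require Import all_classical all_reals all_analysis.
Set Implicit Arguments.
Unset Strict Implicit.
Unset Printing Implicit Defensive.
Import Order.TTheory GRing.Theory Num.Theory.
Import numFieldNormedType.Exports.
Import measurable_realfun hoelder.
Local Open Scope classical_set_scope.
Local Open Scope ring_scope.

(* The real vector space [{mfun_ mu, T >-> R}] of mu-a.e. classes of real
   measurable functions; the library only provides its choiceType structure. *)
Section mfun_ae_lmodule.
Context d (T : measurableType d) (R : realType).
Variable mu : {measure set T -> \bar R}.
Local Open Scope quotient_scope.
Local Notation M := {mfun T >-> R}.
Local Notation V := {mfun_ mu, T >-> R}.
Implicit Types (f g h : M) (u v w : V) (a b : R).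

Lemma mfun_ae_eqP f g : \pi_V f = \pi_V g <-> f = g %[ae mu].
Proof.
split=> [/eqP|fg]; first by rewrite eqmodE => /asboolP.
by apply/eqP; rewrite eqmodE; apply/asboolP.
Qed.

Lemma mfun_ae_reprK f : repr (\pi_V f) = f %[ae mu].
Proof. by apply/mfun_ae_eqP; rewrite reprK. Qed.

Definition mfun_ae_zero : V := \pi_V (0 : M).
Definition mfun_ae_opp u : V := \pi_V (- (repr u : M)).
Definition mfun_ae_add u v : V := \pi_V ((repr u : M) + (repr v : M)).
Definition mfun_ae_scale a u : V := \pi_V (a *: (repr u : M)).

Lemma mfun_ae_oppE f : mfun_ae_opp (\pi_V f) = \pi_V (- f).
Proof.
apply/mfun_ae_eqP; have := mfun_ae_reprK f; apply: filterS => x fx xT.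
exact: (congr1 (fun y : R => - y) (fx xT)).
Qed.

Lemma mfun_ae_addE f g : mfun_ae_add (\pi_V f) (\pi_V g) = \pi_V (f + g).
Proof.
apply/mfun_ae_eqP.
have := mfun_ae_reprK f; have := mfun_ae_reprK g.
apply: filterS2 => x gx fx xT.
exact: (congr2 (fun y z : R => y + z) (fx xT) (gx xT)).
Qed.

Lemma mfun_ae_scaleE a f : mfun_ae_scale a (\pi_V f) = \pi_V (a *: f).
Proof.
apply/mfun_ae_eqP; have := mfun_ae_reprK f; apply: filterS => x fx xT.
exact: (congr1 (fun y : R => a * y) (fx xT)).
Qed.

Lemma mfun_ae_addA : associative mfun_ae_add.
Proof.
move=> u v w; rewrite -[u]reprK -[v]reprK -[w]reprK.
move: (repr u) (repr v) (repr w) => f g h.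
by rewrite (mfun_ae_addE g h) (mfun_ae_addE f g) (mfun_ae_addE f) (mfun_ae_addE (f + g)) addrA.
Qed.

Lemma mfun_ae_addC : commutative mfun_ae_add.
Proof.
move=> u v; rewrite -[u]reprK -[v]reprK.
by move: (repr u) (repr v) => f g; rewrite (mfun_ae_addE f g) (mfun_ae_addE g f) addrC.
Qed.

Lemma mfun_ae_add0 : left_id mfun_ae_zero mfun_ae_add.
Proof.
move=> u; rewrite -[u]reprK.
by move: (repr u) => f; rewrite (mfun_ae_addE 0 f) add0r.
Qed.

Lemma mfun_ae_addN : left_inverse mfun_ae_zero mfun_ae_opp mfun_ae_add.
Proof.
move=> u; rewrite -[u]reprK.
by move: (repr u) => f; rewrite (mfun_ae_oppE f) (mfun_ae_addE (- f) f) addNr.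
Qed.

HB.instance Definition _ := GRing.isZmodule.Build (aeEqMfun R mu)
  mfun_ae_addA mfun_ae_addC mfun_ae_add0 mfun_ae_addN.

Lemma mfun_ae_piD f g : \pi_V (f + g) = \pi_V f + \pi_V g.
Proof. exact/esym/(mfun_ae_addE f g). Qed.

Lemma mfun_ae_scaleA a b u :
  mfun_ae_scale a (mfun_ae_scale b u) = mfun_ae_scale (a * b) u.
Proof.
rewrite -[u]reprK.
by move: (repr u) => f; rewrite (mfun_ae_scaleE b f) (mfun_ae_scaleE a (b *: f)) (mfun_ae_scaleE (a * b) f) scalerA.
Qed.

Lemma mfun_ae_scale1 : left_id 1 mfun_ae_scale.
Proof.
move=> u; rewrite -[u]reprK.
by move: (repr u) => f; rewrite (mfun_ae_scaleE 1 f) scale1r.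
Qed.

Lemma mfun_ae_scaleDr : right_distributive mfun_ae_scale +%R.
Proof.
move=> a u v; rewrite -[u]reprK -[v]reprK.
move: (repr u) (repr v) => f g.
rewrite -(mfun_ae_piD f g) (mfun_ae_scaleE a f) (mfun_ae_scaleE a g).
by rewrite (mfun_ae_scaleE a (f + g)) -(mfun_ae_piD (a *: f)) scalerDr.
Qed.

Lemma mfun_ae_scaleDl u : {morph mfun_ae_scale^~ u : a b / a + b}.
Proof.
move=> a b; rewrite -[u]reprK; move: (repr u) => f.
rewrite (mfun_ae_scaleE a f) (mfun_ae_scaleE b f) (mfun_ae_scaleE (a + b) f).
by rewrite -(mfun_ae_piD (a *: f)) scalerDl.
Qed.

HB.instance Definition _ := GRing.Zmodule_isLmodule.Build R
  (aeEqMfun R mu)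
  mfun_ae_scaleA mfun_ae_scale1 mfun_ae_scaleDr mfun_ae_scaleDl.

Lemma mfun_ae_piZ a f : \pi_V (a *: f) = a *: \pi_V f.
Proof. exact/esym/(mfun_ae_scaleE a f). Qed.

End mfun_ae_lmodule.

(* The function t |-> t ^ r on [0, +oo[, extended by its value at 0 to the
   negative reals. It is only meant for r > 0; the absolute value makes it
   nondecreasing and right-continuous for every r. *)
Section power_cumulative.
Variables (R : realType) (r : R).

Definition power_cdf (t : R) : R := Num.max t 0 `^ `|r|.

Let power_cdf_nd : nondecreasing power_cdf.
Proof.
move=> s t st; rewrite /power_cdf.
by apply: ge0_ler_powR; rewrite ?nnegrE ?ge_max ?le_max ?st ?lexx ?orbT.
Qed.

Let power_cdf_rc (x : R) : power_cdf t @[t --> x^'+] --> power_cdf x.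
Proof.
have [r0|r0] := eqVneq r 0.
  have -> : power_cdf = cst 1.
    by apply/funext => t; rewrite /power_cdf r0 normr0 powRr0.
  exact: cvg_cst.
have {}r0 : 0 < `|r| by rewrite normr_gt0.
have [x0|x0] := ltP x 0.
  apply: cvg_near_cst; near=> t.
  rewrite /power_cdf (max_r (ltW x0)) max_r//.
  near: t; exact: nbhs_right_le.
rewrite {2}/power_cdf max_l//.
have E : \forall t \near x^'+, t `^ `|r| = power_cdf t.
  near=> t; rewrite /power_cdf max_l// (le_trans x0)//.
apply: (cvg_trans (near_eq_cvg E)).
move: x0; rewrite le_eqVlt => /predU1P[<-|x0].
  by rewrite powR0 ?gt_eqF//; exact: powR_cvg0.
apply: cvg_at_right_filter.
have F : \forall t \near x, expR (`|r| * ln t) = t `^ `|r|.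
  near=> t; rewrite /powR gt_eqF//; near: t; exact: lt_nbhsr.
rewrite {2}/powR gt_eqF//.
apply: (cvg_trans (near_eq_cvg F)).
apply: (@cvg_comp _ _ _ (fun t => `|r| * ln t) expR); last exact: continuous_expR.
by apply: cvgMr; exact: continuous_ln.
Unshelve. all: end_near. Qed.

HB.instance Definition _ :=
  isCumulative.Build R _ R power_cdf power_cdf_nd power_cdf_rc.

End power_cumulative.

Section lorentz.
Context d (T : measurableType d) (R : realType).
Variable mu : {measure set T -> \bar R}.
Local Open Scope ereal_scope.

Definition rearrangement (f : T -> R) (t : R) : \bar R :=
  ereal_inf [set s%:E | s in
    [set s : R | (0 < s)%R /\ mu [set x | (s < `|f x|)%R] <= t%:E]].

Definition lorentz_norm (p q : R) (u : {mfun_ mu, T >-> R}) : \bar R :=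
  (\int[lebesgue_stieltjes_measure (power_cdf (q / p))]_(t in `]0%R, +oo[)
     rearrangement u t `^ q) `^ q^-1.

Lemma eq_rearrangement (f g : {mfun T >-> R}) :
  f = g %[ae mu] -> rearrangement f = rearrangement g.
Proof.
move=> fg; apply/funext => t; rewrite /rearrangement.
have m (h : {mfun T >-> R}) s : measurable [set x | (s < `|h x|)%R].
  have mh : measurable_fun setT (fun x => `|h x|)%R.
    exact: measurableT_comp.
  have := mh measurableT _ (measurable_itv `]s, +oo[).
  rewrite setTI; congr measurable; apply/seteqP.
  by split=> x /=; rewrite in_itv/= andbT.
have le (h k : {mfun T >-> R}) s : h = k %[ae mu] ->
    mu [set x | (s < `|h x|)%R] <= mu [set x | (s < `|k x|)%R].
  move=> -[N [mN N0 hkN]].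
  rewrite -[leRHS](measureU0 (m k s) mN N0).
  apply: le_measure; rewrite ?inE//; first exact: measurableU.
  move=> x /= shx; have [xN|xN] := pselect (N x); first by right.
  left; have <- // : h x = k x.
  by apply: contrapT => hk; apply/xN/hkN => /= /(_ I).
suff E s : mu [set x | (s < `|f x|)%R] = mu [set x | (s < `|g x|)%R].
  by congr (ereal_inf (_ @` _)); apply/funext => s; rewrite /= E.
by apply/eqP; rewrite eq_le !le//; exact: ae_eq_sym.
Qed.

Lemma lorentz_norm_pi (p q : R) (f : {mfun T >-> R}) :
  lorentz_norm p q (\pi_({mfun_ mu, T >-> R})%qT f) =
  (\int[lebesgue_stieltjes_measure (power_cdf (q / p))]_(t in `]0%R, +oo[)
     rearrangement f t `^ q) `^ q^-1.
Proof. by rewrite /lorentz_norm (eq_rearrangement (mfun_ae_reprK mu f)). Qed.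

End lorentz.
Arguments lorentz_norm {d T R} mu p q u.

(* The interval (0, 1) is modelled on the whole line: the complement of (0, 1) is
   a null set of the restricted measure, hence is invisible to the classes. *)
Definition lebesgue01 (R : realType) :
    {measure set (measurableTypeR R) -> \bar R} :=
  mrestr lebesgue_measure (measurable_itv `]0%R, 1%R[).

Section atoms.
Context d (T : measurableType d) (R : realType).
Variable mu : {measure set T -> \bar R}.
Local Open Scope ereal_scope.

Definition is_atom (A : set T) :=
  [/\ measurable A, 0 < mu A &
    forall B, measurable B -> B `<=` A -> mu B = 0 \/ mu (A `\` B) = 0].

Definition purely_atomic :=
  forall B, measurable B -> 0 < mu B -> exists2 A, is_atom A & A `<=` B.

(* As usual, atoms are identified when they differ by a null set. *)
Definition atoms_are (A : nat -> set T) :=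
  [/\ forall n, is_atom (A n),
      forall m n, m <> n -> mu (A m `&` A n) = 0 &
      forall B, is_atom B -> exists n, mu (B `+` A n) = 0].

End atoms.

(* A quasi-normed space is given by a vector space E and N : E -> \bar R, as the
   subspace [set x | N x < +oo] of E quasi-normed by N. *)
Section embedding.
Context (R : realType) (E F : lmodType R).
Variables (NE : E -> \bar R) (NF : F -> \bar R).
Local Open Scope ereal_scope.

Definition finite_part (G : Type) (N : G -> \bar R) := [set x | N x < +oo].

Definition closed_subspace (Z : set F) :=
  [/\ Z `<=` finite_part NF,
      Z 0%R,
      forall (a : R) y z, Z y -> Z z -> Z (a *: y + z)%R &
      forall y, finite_part NF y ->
        (forall e : R, (0 < e)%R -> exists2 z, Z z & NF (y - z)%R < e%:E) ->
        Z y].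

(* For a linear bijection J, boundedness of J and of its inverse amounts to J
   being a homeomorphism. *)
Definition linear_isomorphism (Z : set F) (J : E -> F) :=
  [/\ forall (a : R) x y, finite_part NE x -> finite_part NE y ->
        J (a *: x + y)%R = (a *: J x + J y)%R,
      set_bij (finite_part NE) Z J,
      exists C : R, forall x, finite_part NE x -> NF (J x) <= C%:E * NE x &
      exists C : R, forall x, finite_part NE x -> NE x <= C%:E * NF (J x)].

Definition embeds_isomorphically :=
  exists Z : set F, closed_subspace Z /\ exists J, linear_isomorphism Z J.

End embedding.

(* Main.v *)
(* With r = q / p, the q-th power of the Lorentz quasi-norm is equivalent to
   N f = sum over k in Z of 2^(q k) mu{|f| > 2^k}^r. On a purely atomic space a
   function is a sequence of reals. If all normalised l_2-combinations of y_0, y_1,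
   ... are bounded, then the y_n tend to 0 coordinatewise and some normalised
   combinations of them are arbitrarily small in measure. Such vectors are almost
   disjoint from any finitely supported vector, so N is almost additive on sums of
   K of them, each combination being taken from a different family.
   Inside L_{p,q}(0,1), take for the families Rademacher functions supported on K
   equal pieces of the interval: single combinations have N of order K^(-r), full
   sums have N of order 1, hence K^(1-r) stays bounded above and below and p = q.
   With K disjoint subsequences of the Rademacher functions, single combinations
   have N of order 1 and full sums have N of order K^(q/2), hence q = 2.
   For p = q = 2 the Haar coefficients, divided by the square roots of the masses of
   the atoms, give an isometry for the L_2 norms: Parseval's identity follows from
   the Lebesgue differentiation theorem and Fatou's lemma, and its range is closed
   because L_2(0,1) is complete. *)
Require Import Defs.
From HB Require Import structures.
From mathcomp Require Import all_boot all_order all_algebra generic_quotient.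
From mathcomp Require Import all_classical all_reals all_analysis.
From mathcomp Require Import zify ring lra.
Set Implicit Arguments.
Unset Strict Implicit.
Unset Printing Implicit Defensive.
Import Order.TTheory GRing.Theory Num.Theory.
Import numFieldNormedType.Exports.
Import measurable_realfun hoelder.
Local Open Scope classical_set_scope.
Local Open Scope ring_scope.

(** * Powers of two and sums over the integers *)

(** [N] satisfies only [N (f + g) <= kap * (N f + N g)]. Summing [K] vectors with this inequality
    would cost a power of [kap] and hide the growth in [K] that decides the exponents. What avoids
    the loss is that distribution functions of disjointly supported vectors add exactly: a vector
    [z], disjoint from a fixed [F] and small enough in measure, raises [N F] by at most [2^r * N z]
    plus an arbitrarily small term, so the coefficient of [N F] stays 1 and the step can be
    iterated. The quasi-triangle inequality is spent on error terms only, whose budgets are divided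
    in advance. Smallness in measure cannot be read off from convergence of coordinates. A sum of
    [4^J] almost disjoint vectors that are not small in measure, scaled by [2^(-J)], has [N] at
    least of order [2^((2r - q) J)]. For [p < 2] this contradicts boundedness, so some single vector
    is small already. For [p >= 2] there is no contradiction, and the coefficients have to be spread
    over many scales. *)

Section e2.
Context {R : realType}.
Implicit Types s t : R.

Definition e2 s : R := 2 `^ s.

Lemma e2E s : e2 s = expR (s * ln 2).
Proof. by rewrite /e2 /powR pnatr_eq0. Qed.

Lemma ln2_gt0 : 0 < ln 2 :> R.
Proof. by rewrite ln_gt0// ltr1n. Qed.

Lemma e2_gt0 s : 0 < e2 s.
Proof. by rewrite e2E expR_gt0. Qed.

Lemma e2_ge0 s : 0 <= e2 s.
Proof. exact/ltW/e2_gt0. Qed.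

Lemma e20 : e2 0 = 1.
Proof. exact: powRr0. Qed.

Lemma e21 : e2 1 = 2.
Proof. exact: powRr1. Qed.

Lemma ltr_e2 s t : (e2 s < e2 t) = (s < t).
Proof. by rewrite !e2E ltr_expR ltr_pM2r// ln2_gt0. Qed.

Lemma ler_e2 s t : (e2 s <= e2 t) = (s <= t).
Proof. by rewrite !leNgt ltr_e2. Qed.

Lemma e2D s t : e2 (s + t) = e2 s * e2 t.
Proof. by rewrite !e2E mulrDl expRD. Qed.

Lemma e2N s : e2 (- s) = (e2 s)^-1.
Proof. by rewrite !e2E mulNr expRN. Qed.

Lemma e2M s t : e2 (s * t) = e2 s `^ t.
Proof. exact: powRrM. Qed.

Lemma e2X s n : e2 (s * n%:R) = e2 s ^+ n.
Proof. by rewrite e2M powR_mulrn// e2_ge0. Qed.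

Lemma e2_nat n : e2 n%:R = 2 ^+ n.
Proof. by rewrite -[n%:R]mul1r e2X e21. Qed.

(** The half-open shell matches the strict inequality in distribution functions: for [x] in shell
    [k], the levels [2^j] strictly below [x] are exactly those with [j <= k]. *)
Lemma e2_shell (x : R) : 0 < x -> exists k : int, e2 k%:~R < x <= e2 (k + 1)%:~R.
Proof.
move=> x0; pose l := ln x / ln 2.
have xE : x = e2 l by rewrite e2E divfK ?lnK ?posrE// gt_eqF// ln2_gt0.
exists (Num.ceil l - 1); rewrite subrK xE ltr_e2 ler_e2.
by rewrite ceilB1_lt ceil_ge.
Qed.

Lemma e2_small (x : R) : 0 < x -> exists n : nat, e2 (- n%:R) <= x.
Proof.
move=> /e2_shell[k /andP[kx _]]; exists `|k|%N.
rewrite (le_trans _ (ltW kx))// ler_e2 -[X in _ <= X]opprK lerN2.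
by rewrite natr_absz intr_norm -normrN ler_norm.
Qed.

End e2.

Section dyadic_series.
Context {R : realType}.
Local Open Scope ereal_scope.
Implicit Types (a b : int -> \bar R).

Lemma esum_int a : (forall k, 0 <= a k) ->
  \esum_(k in [set: int]) a k = \sum_(n <oo) a (Posz n) + \sum_(n <oo) a (Negz n).
Proof.
move=> a0; rewrite (esumID (range Posz))//; congr (_ + _).
  rewrite setTI esum_image; last by move=> m n _ _ [].
  by rewrite nneseries_esumT.
rewrite setTI (_ : ~` _ = range Negz).
  rewrite esum_image; last by move=> m n _ _ [].
  by rewrite nneseries_esumT.
apply/seteqP; split=> [[n|n] /= H|_ /= [n _ <-] [m _]//]; last by exists n.
by exfalso; apply: H; exists n.
Qed.

Lemma esumZl_int (c : R) a : (forall k, 0 <= a k) -> (0 <= c)%R ->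
  \esum_(k in [set: int]) (c%:E * a k) = c%:E * \esum_(k in [set: int]) a k.
Proof.
move=> a0 c0; rewrite !esum_int//; last by move=> k; rewrite mule_ge0.
rewrite !nneseriesZl// ge0_muleDr//; exact: nneseries_ge0.
Qed.

Lemma esum_int_shift (j : int) a :
  \esum_(k in [set: int]) a (k + j)%R = \esum_(k in [set: int]) a k.
Proof.
apply/esym/reindex_esum; split=> //.
  by move=> x y _ _ /addIr.
by move=> y _; exists (y - j)%R => //; rewrite subrK.
Qed.

Lemma esum_int_ge a (k : int) : (forall k, 0 <= a k) ->
  a k <= \esum_(k in [set: int]) a k.
Proof.
move=> a0; apply: esum_ge; exists [set k]; first by split => //; exact: finite_set1.
by rewrite fsbig_set1.
Qed.

Lemma esum_int_ge_nat a (N : nat) (e : nat -> int) :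
  injective e -> (forall k, 0 <= a k) ->
  \sum_(i < N) a (e i) <= \esum_(k in [set: int]) a k.
Proof.
move=> ei a0.
apply: (@le_trans _ _ (\esum_(k in range e) a k)).
  rewrite esum_image; last by move=> x y _ _; exact: ei.
  rewrite -nneseries_esumT//.
  rewrite -(big_mkord xpredT (a \o e)).
  by apply: nneseries_lim_ge => n _ _; exact: a0.
rewrite (esumID (range e) setT)// setTI leeDl//; exact: esum_ge0.
Qed.

Lemma nneseries_geometric (x : R) : (0 <= x < 1)%R ->
  \sum_(n <oo) (x ^+ n)%:E = ((1 - x)^-1)%:E.
Proof.
move=> /andP[x0 x1].
have := @cvg_geometric_series R 1 x; rewrite ger0_norm// => /(_ x1); rewrite div1r => h.
apply/cvg_lim => //.
have -> : (fun n => \sum_(0 <= i < n) (x ^+ i)%:E) = EFin \o series (geometric 1%R x).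
  apply/funext => n /=; rewrite sumEFin /series/=; congr EFin.
  by apply: eq_bigr => i _; rewrite mul1r.
by apply: cvg_EFin => //; exact: nearW.
Qed.

(** A two-sided geometric sequence, the summable majorant against which dyadic series over the
    integers are compared. *)
Definition geom2 (s : R) (k : int) : R := e2 (- (s * `|k|%:~R)).

Lemma geom2_gt0 (s : R) k : (0 < geom2 s k)%R.
Proof. exact: e2_gt0. Qed.

Lemma esum_geom2_lty (s : R) : (0 < s)%R ->
  \esum_(k in [set: int]) (geom2 s k)%:E < +oo.
Proof.
move=> s0; rewrite esum_int; last by move=> k; rewrite lee_fin ltW// geom2_gt0.
have x01 : (0 <= (e2 (- s) : R) < 1)%R by rewrite ltW ?e2_gt0//= -e20 ltr_e2; lra.
have e n : geom2 s (Posz n) = (e2 (- s) ^+ n)%R.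
  by rewrite /geom2 -e2X mulNr.
have e' n : geom2 s (Negz n) = (e2 (- s) * e2 (- s) ^+ n)%R.
  by rewrite -exprS -e.
apply: lte_add_pinfty.
  rewrite (eq_eseriesr (g := fun n => (e2 (- s) ^+ n)%:E)); last by move=> n _; rewrite e.
  by rewrite nneseries_geometric ?ltry.
rewrite (eq_eseriesr (g := fun n => (e2 (- s))%:E * (e2 (- s) ^+ n)%:E)); last first.
  by move=> n _; rewrite e' EFinM.
rewrite nneseriesZl//; last first.
  by move=> n _; rewrite lee_fin exprn_ge0//; case/andP: x01.
by rewrite nneseries_geometric ?ltry.
Qed.

End dyadic_series.

(** * The dyadic quasi-norm *)

Section esum_dominated.
Context {R : realType}.
Local Open Scope ereal_scope.

Lemma esum_tail (b : int -> \bar R) (t : R) : (forall k, 0 <= b k) ->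
  \esum_(k in [set: int]) b k < +oo -> (0 < t)%R ->
  exists X : set int, finite_set X /\ \esum_(k in ~` X) b k <= t%:E.
Proof.
move=> b0 boo t0; set S := \esum_(k in _) _ in boo.
have S0 : 0 <= S by apply: esum_ge0.
have Sf : S \is a fin_num by rewrite ge0_fin_numE.
have : S - t%:E < S by rewrite lteBlDr// lteDl.
move=> /ereal_sup_gt[_ [X [finX _] <-] SX]; exists X; split=> //.
have e : S = \esum_(k in X) b k + \esum_(k in ~` X) b k.
  by rewrite /S (esumID X)// !setTI.
have eX : \esum_(k in X) b k = \sum_(k \in X) b k.
  by rewrite esum_fset.
rewrite -eX e in SX.
have f1 : \esum_(k in X) b k \is a fin_num.
  rewrite ge0_fin_numE ?esum_ge0//; apply: le_lt_trans boo.
  by rewrite e leeDl// esum_ge0.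
rewrite lteBlDr// lteD2lE// in SX; exact: ltW.
Qed.

(** Tannery's theorem with limit 0: outside a finite set [X] the majorant leaves at most half of
    [t], and on [X] finitely many terms are made small one by one. It reduces limits in [N] to a
    single dyadic level at a time. *)
Lemma esum_dominated (a : nat -> int -> R) (b : int -> R) :
  (forall n k, 0 <= a n k <= b k)%R ->
  \esum_(k in [set: int]) (b k)%:E < +oo ->
  (forall k (e : R), (0 < e)%R -> exists N, forall n, (N <= n)%N -> (a n k <= e)%R) ->
  forall t : R, (0 < t)%R -> exists N, forall n, (N <= n)%N ->
    \esum_(k in [set: int]) (a n k)%:E <= t%:E.
Proof.
move=> ab boo a0 t t0.
have b0 k : 0 <= (b k)%:E.
  by have /andP[x y] := ab 0%N k; rewrite lee_fin (le_trans x).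
have t20 : (0 < t / 2)%R by rewrite divr_gt0.
have [X [finX Xt]] := esum_tail b0 boo t20.
have [N HN] : exists N, forall n, (N <= n)%N ->
    \esum_(k in X) (a n k)%:E <= (t / 2)%:E.
  pose s : seq int := finmap.enum_fset (fset_set X); pose m := ((size s).+1%:R : R)%R.
  have m0 : (0 < t / 2 / m)%R by rewrite divr_gt0.
  have /choice[N HN] : forall k, exists N, forall n, (N <= n)%N -> (a n k <= t / 2 / m)%R.
    by move=> k; exact: a0.
  exists (\max_(k <- s) N k)%N => n Nn.
  rewrite esum_fset//; last first.
    by move=> k _; rewrite lee_fin; case/andP: (ab n k).
  rewrite fsbig_finite//= ; rewrite -/s.
  apply: (@le_trans _ _ (\sum_(k <- s) (t / 2 / m)%:E)).
    rewrite big_seq [leRHS]big_seq; apply: lee_sum => k ks.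
    by rewrite lee_fin HN// (leq_trans _ Nn)// leq_bigmax_seq.
  rewrite sumEFin lee_fin big_const_seq count_predT iter_addr addr0.
  rewrite -[leLHS]mulr_natr [leLHS]mulrAC ler_pdivrMr ?ltr0n//.
  by apply: ler_wpM2l; [exact: ltW|rewrite ler_nat leqnSn].
exists N => n Nn.
rewrite (esumID X); last by move=> k _; rewrite lee_fin; case/andP: (ab n k).
rewrite !setTI [t in leRHS]splitr EFinD leeD ?HN//.
apply: le_trans Xt; apply: le_esum => k _; rewrite lee_fin.
by case/andP: (ab n k).
Qed.

End esum_dominated.

Section powR_extra.
Context {R : realType}.
Implicit Types a b r : R.

Lemma powR_le a b r : 0 <= r -> 0 <= a -> a <= b -> a `^ r <= b `^ r.
Proof. by move=> r0 a0 ab; rewrite ge0_ler_powR ?nnegrE// (le_trans a0). Qed.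

(** Comparison with twice the larger term treats [r <= 1] and [r > 1] alike, at the price of the
    factor [2^r]. *)
Lemma powRD_le a b r : 0 <= r -> 0 <= a -> 0 <= b ->
  (a + b) `^ r <= e2 r * (a `^ r + b `^ r).
Proof.
move=> r0; wlog ab : a b / a <= b => [H a0 b0|a0 b0].
  have [/H->//|/ltW ba] := leP a b.
  by rewrite addrC [X in _ * X]addrC; exact: H.
apply: (@le_trans _ _ ((2 * b) `^ r)).
  by apply: powR_le => //; [rewrite addr_ge0|lra].
by rewrite powRM// ler_wpM2l ?powR_ge0// lerDr powR_ge0.
Qed.

Lemma powR_right_cont a r (e : R) : 0 < r -> 0 <= a -> 0 < e ->
  exists2 d, 0 < d & forall b, 0 <= b <= d -> (a + b) `^ r <= a `^ r + e.
Proof.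
move=> r0 a0 e0.
have [d /=] := @nondecreasing_right_continuousP R a e (power_cdf r) e0.
rewrite /power_cdf (gtr0_norm r0) => ad; exists d%:num => // b /andP[b0 bd].
rewrite !max_l ?addr_ge0// in ad; apply: le_trans ad.
by apply: powR_le; [exact: ltW|exact: addr_ge0|by rewrite lerD2l].
Qed.

End powR_extra.

Section dyadic_norm.
Context d (T : measurableType d) {R : realType}.
Implicit Types (mu : set T -> \bar R) (f g : T -> R) (s : R).
Local Open Scope ereal_scope.

Definition dist mu f s : \bar R := mu [set x | (s < `|f x|)%R].

(* The [q]-th power of a functional equivalent to the Lorentz quasi-norm; [r]
   stands for [q / p]. *)
Definition dterm mu (q r : R) f (k : int) : \bar R :=
  (e2 (q * k%:~R))%:E * dist mu f (e2 k%:~R) `^ r.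

Definition dnorm mu (q r : R) f : \bar R :=
  \esum_(k in [set: int]) dterm mu q r f k.

Variables (q r : R).

Lemma dterm_ge0 mu f k : 0 <= dterm mu q r f k.
Proof. by rewrite mule_ge0 ?poweR_ge0// lee_fin e2_ge0. Qed.

Lemma dnorm_ge0 mu f : 0 <= dnorm mu q r f.
Proof. by apply: esum_ge0 => k _; exact: dterm_ge0. Qed.

Lemma dterm_le_dnorm mu f k : dterm mu q r f k <= dnorm mu q r f.
Proof. by apply: esum_int_ge => ?; exact: dterm_ge0. Qed.

Lemma dist_scale mu f (a s : R) : (0 < a)%R ->
  dist mu (fun x => a * f x)%R s = dist mu f (s / a)%R.
Proof.
move=> a0; congr (mu _); apply/seteqP; split => x /=;
  by rewrite normrM (gtr0_norm a0) ltr_pdivrMr// mulrC.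
Qed.

(** A factor [2^j] only shifts the dyadic levels, so homogeneity is exact for powers of two. For
    this reason full sums are later normalised with [4^J] summands, where the factor is [2^(-J)]. *)
Lemma dnorm_scale mu f (j : int) :
  dnorm mu q r (fun x => e2 j%:~R * f x)%R = (e2 (q * j%:~R))%:E * dnorm mu q r f.
Proof.
rewrite /dnorm -esumZl_int; [|exact: dterm_ge0|exact: e2_ge0].
rewrite -[RHS](esum_int_shift (- j)); apply: eq_esum => k _.
rewrite /dterm dist_scale ?e2_gt0// -e2N -e2D -intrN -intrD muleA -EFinM -e2D.
by congr ((e2 _)%:E * _); rewrite rmorphB/=; ring.
Qed.

Lemma le_dnorm mu f g : (0 < r)%R ->
  (forall k : int, 0 <= dist mu f (e2 k%:~R) <= dist mu g (e2 k%:~R)) ->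
  dnorm mu q r f <= dnorm mu q r g.
Proof.
move=> r0 fg; apply: le_esum => k _.
have /andP[f0 fgk] := fg k.
rewrite lee_wpmul2l ?lee_fin ?e2_ge0// gt0_ler_poweR// ?in_itv/= ?leey ?andbT//; first exact: ltW.
exact: le_trans fgk.
Qed.

End dyadic_norm.

Section discrete.
Context {R : realType}.
Variables (nu : {measure set nat -> \bar R}) (q r : R).
Hypotheses (q0 : 0 < q) (r0 : 0 < r).
Hypothesis nu_gt0 : forall k : nat, (0 < nu [set k])%E.
Hypothesis nu_lty : forall k : nat, (nu [set k] < +oo)%E.
Implicit Types (f g : nat -> R) (s t : R).
Local Open Scope ereal_scope.
Local Notation D := (dist nu).
Local Notation N := (dnorm nu q r).

Lemma measN (A : set nat) : measurable A.
Proof. by []. Qed.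

Lemma dist_ge0 f s : 0 <= D f s.
Proof. exact: measure_ge0. Qed.

Lemma dist_le f g s t : (forall k, s < `|f k| -> t < `|g k|)%R -> D f s <= D g t.
Proof.
by move=> fg; apply: le_measure; rewrite ?inE; [exact: measN|exact: measN|exact: fg].
Qed.

Lemma distD f g s t : D (fun k => f k + g k)%R (s + t)%R <= D f s + D g t.
Proof.
apply: (@le_trans _ _ (nu ([set k | (s < `|f k|)%R] `|` [set k | (t < `|g k|)%R]))).
  apply: le_measure; rewrite ?inE; [exact: measN|exact: measN|].
  move=> k /= fgk; have [|fs] := (ltP s `|f k|)%R; first by left.
  by right; have := ler_normD (f k) (g k); lra.
by apply: measureU2; exact: measN.
Qed.

Lemma nu_head_lty h : nu `I_h < +oo.
Proof.
elim: h => [|h ih]; first by rewrite II0 measure0.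
rewrite IIS; apply: (@le_lt_trans _ _ (nu `I_h + nu [set h])); last exact: lte_add_pinfty.
by apply: measureU2; exact: measN.
Qed.

Lemma dnorm_lty_dist f s : N f < +oo -> (0 < s)%R -> D f s < +oo.
Proof.
move=> Nf /e2_shell[k /andP[ks _]].
apply: (@le_lt_trans _ _ (D f (e2 k%:~R))).
  by apply: dist_le => j; exact: lt_trans.
have := le_lt_trans (dterm_le_dnorm q r nu f k) Nf; rewrite /dterm.
have := dist_ge0 f (e2 k%:~R); case: (D f _) => [x _ _|_|//]; first by rewrite ltry.
by rewrite poweRyr ?gt_eqF// gt0_muley ?lte_fin ?e2_gt0.
Qed.

Definition Dr f (k : int) : R := fine (D f (e2 k%:~R)).

Lemma Dr_ge0 f k : (0 <= Dr f k)%R.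
Proof. exact/fine_ge0/dist_ge0. Qed.

Lemma DrE f k : N f < +oo -> D f (e2 k%:~R) = (Dr f k)%:E.
Proof.
move=> Nf; rewrite /Dr fineK// ge0_fin_numE ?dist_ge0//.
by rewrite dnorm_lty_dist// e2_gt0.
Qed.

Lemma dtermE f k : N f < +oo ->
  dterm nu q r f k = (e2 (q * k%:~R) * Dr f k `^ r)%:E.
Proof. by move=> Nf; rewrite /dterm DrE. Qed.

Definition kap : R := e2 (q + r).

Lemma kap_ge1 : (1 <= kap)%R.
Proof. by rewrite /kap -e20 ler_e2 addr_ge0 ?ltW. Qed.

Lemma poweRD_le (x y : \bar R) : 0 <= x -> 0 <= y ->
  (x + y) `^ r <= (e2 r)%:E * (x `^ r + y `^ r).
Proof.
case: x => [x| |]// x0; case: y => [y| |]// y0.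
- by rewrite !poweR_EFin lee_fin powRD_le// ltW.
- by rewrite addey// poweRyr ?gt_eqF// addey// gt0_muley ?lte_fin ?e2_gt0.
- by rewrite addye// poweRyr ?gt_eqF// addye// gt0_muley ?lte_fin ?e2_gt0.
- by rewrite addye// poweRyr ?gt_eqF// addye// gt0_muley ?lte_fin ?e2_gt0.
Qed.

(** Halving the level [2^k] between the two summands shifts the index by one and costs [2^q];
    [poweRD_le] costs [2^r]. The product is [kap]. *)
Lemma dnormD f g : N (fun k => f k + g k)%R <= kap%:E * (N f + N g).
Proof.
rewrite /dnorm -esumD; [|by move=> *; exact: dterm_ge0|by move=> *; exact: dterm_ge0].
rewrite -esumZl_int; [|by move=> k; rewrite adde_ge0 ?dterm_ge0|exact: e2_ge0].
rewrite -[leRHS](esum_int_shift (-1)); apply: le_esum => k _.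
rewrite /dterm -ge0_muleDr ?poweR_ge0// muleA -EFinM -e2D.
have -> : (q + r + q * (k - 1)%:~R = q * k%:~R + r)%R by rewrite rmorphB/=; ring.
rewrite e2D EFinM -muleA lee_wpmul2l ?lee_fin ?e2_ge0//.
apply: le_trans (poweRD_le _ _); [|exact: dist_ge0|exact: dist_ge0].
rewrite gt0_ler_poweR ?(ltW r0)// ?in_itv/= ?leey ?andbT ?adde_ge0 ?dist_ge0//.
pose s : R := e2 (k - 1)%:~R.
apply: (@le_trans _ _ (D (fun i => f i + g i)%R (s + s)%R)); last exact: distD.
apply: dist_le => j; suff -> : e2 k%:~R = (s + s)%R :> R by [].
have -> : k%:~R = ((k - 1)%:~R + 1)%R :> R by rewrite rmorphB/= subrK.
by rewrite e2D e21 -/s; ring.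
Qed.

Lemma le_dnorm_nat f g : (forall k, `|f k| <= `|g k|)%R -> N f <= N g.
Proof.
move=> fg; apply: le_dnorm => // k; rewrite dist_ge0/=; apply: dist_le => j h.
exact: lt_le_trans (fg _).
Qed.

Lemma dnorm_fin_supp f h : (forall k, (h <= k)%N -> f k = 0%R) -> N f < +oo.
Proof.
move=> fh.
have [j0 Hj] : exists j0 : nat, forall k, (`|f k| <= e2 j0%:R)%R.
  pose S := (\sum_(i < h) `|f i|)%R.
  have [n Sn] : exists n : nat, (S <= e2 n%:R)%R.
    exists (Num.bound S); rewrite e2_nat.
    have S0 : (0 <= S)%R by exact: sumr_ge0.
    rewrite (le_trans (ltW (archi_boundP S0)))// -natrX ler_nat ltnW//.
    exact: ltn_expl.
  exists n => k; apply: le_trans Sn; have [kh|hk] := ltnP k h.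
    by rewrite /S (bigD1 (Ordinal kh))//= lerDl sumr_ge0.
  by rewrite fh// normr0 sumr_ge0.
pose M : R := fine (nu `I_h); have ME : nu `I_h = M%:E.
  by rewrite fineK// ge0_fin_numE// nu_head_lty.
have M0 : (0 <= M)%R by apply: fine_ge0.
(* Only levels [k <= j0] contribute, and there [k <= 2 * j0 - |k|]; the factor [2^(2 q j0)] turns
   [2^(q k)] into the symmetric majorant. *)
pose C := (M `^ r * e2 (q * (2 * j0%:R)))%R.
apply: (@le_lt_trans _ _ (\esum_(k in [set: int]) (C%:E * (geom2 q k)%:E))); last first.
  rewrite esumZl_int; last 2 first.
  - by move=> k; rewrite lee_fin ltW ?geom2_gt0.
  - by rewrite mulr_ge0 ?powR_ge0 ?e2_ge0.
  by rewrite lte_mul_pinfty ?lee_fin ?mulr_ge0 ?powR_ge0 ?e2_ge0 ?esum_geom2_lty.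
apply: le_esum => k _; rewrite /dterm.
have [kj|jk] := leP k (Posz j0); last first.
  suff -> : D f (e2 k%:~R) = 0.
    rewrite poweR0r ?gt_eqF// mule0 mule_ge0// lee_fin ?mulr_ge0 ?powR_ge0 ?e2_ge0//.
  rewrite -(measure0 nu); congr (nu _); apply/seteqP; split => i //=.
  apply/negP; rewrite -leNgt (le_trans (Hj _))// ler_e2.
  by rewrite -[j0%:R]/((Posz j0)%:~R) ler_int ltW.
apply: (@le_trans _ _ ((e2 (q * k%:~R))%:E * (M `^ r)%:E)).
  rewrite lee_wpmul2l ?lee_fin ?e2_ge0// -poweR_EFin -ME.
  rewrite gt0_ler_poweR ?(ltW r0)// ?in_itv/= ?leey ?andbT ?dist_ge0//.
  apply: le_measure; rewrite ?inE; [exact: measN|exact: measN|].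
  move=> i /=; apply: contraTT; rewrite -leqNgt => hi.
  by rewrite fh// normr0 -leNgt e2_ge0.
rewrite -!EFinM lee_fin mulrC /C -[leRHS]mulrA ler_wpM2l ?powR_ge0//.
rewrite /geom2 -e2D ler_e2 -mulrN -mulrDr ler_pM2l//.
have : (k <= 2 * (Posz j0) - `|k|)%R by lia.
rewrite -(ler_int R) rmorphB/= rmorphM/=; lra.
Qed.

End discrete.

(** * Almost disjoint vectors *)

Section powR_small.
Context {R : realType}.

Lemma powR_small (r e : R) : 0 < r -> 0 < e ->
  exists2 d : R, 0 < d & forall b, 0 <= b <= d -> b `^ r <= e.
Proof.
move=> r0 e0; have [d d0 H] := powR_right_cont r0 (lexx 0) e0.
by exists d => // b /H; rewrite !add0r powR0 ?gt_eqF// add0r.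
Qed.

End powR_small.

Section almost_lq.
Context {R : realType}.
Variables (nu : {measure set nat -> \bar R}) (q r : R).
Hypotheses (q0 : 0 < q) (r0 : 0 < r).
Hypothesis nu_gt0 : forall k : nat, (0 < nu [set k])%E.
Hypothesis nu_lty : forall k : nat, (nu [set k] < +oo)%E.
Implicit Types (f g : nat -> R) (z : nat -> nat -> R) (s t : R).
Local Open Scope ereal_scope.
Local Notation D := (dist nu).
Local Notation N := (dnorm nu q r).
Local Notation Dr := (Dr nu).
Local Notation kap := (kap q r).
Local Notation w := (fun k : int => e2 (q * k%:~R) : R).

Definition Nr f : R := fine (N f).

Lemma NrE f : N f < +oo -> N f = (Nr f)%:E.
Proof. by move=> Nf; rewrite /Nr fineK// ge0_fin_numE ?dnorm_ge0. Qed.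

Lemma dnormD_lty f g : N f < +oo -> N g < +oo -> N (fun k => f k + g k)%R < +oo.
Proof.
move=> Nf Ng; apply: (le_lt_trans (dnormD nu q r0 f g)).
by rewrite lte_mul_pinfty ?lee_fin ?e2_ge0 ?lte_add_pinfty.
Qed.

Lemma NrD f g : N f < +oo -> N g < +oo ->
  (Nr (fun k => f k + g k) <= kap * (Nr f + Nr g))%R.
Proof.
move=> Nf Ng; have := dnormD nu q r0 f g.
by rewrite (NrE Nf) (NrE Ng) (NrE (dnormD_lty Nf Ng)) -EFinD -EFinM lee_fin.
Qed.

Lemma esum_dterm f : N f < +oo ->
  \esum_(k in [set: int]) (w k * Dr f k `^ r)%:E = (Nr f)%:E.
Proof.
by move=> Nf; rewrite -NrE// /dnorm; apply: eq_esum => k _; rewrite dtermE.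
Qed.

(** Convergence to 0 in measure at a prescribed rate, with one bound for both the height and the
    measure of the exceptional set. *)
Definition small z := forall n, D (z n) (e2 (- n%:R)) <= (e2 (- n%:R))%:E.

Lemma small_le z z' : small z -> (forall n k, `|z' n k| <= `|z n k|)%R -> small z'.
Proof.
move=> sz zz' n; apply: le_trans (sz n).
by apply: dist_le => k h; exact: lt_le_trans (zz' _ _).
Qed.

Lemma small_Dr z k (e : R) : small z -> (0 < e)%R ->
  exists M, forall n, (M <= n)%N -> (Dr (z n) k <= e)%R.
Proof.
move=> sz e0; have [n1 n1e] := e2_small e0.
exists (maxn n1 `|k|%N) => n; rewrite geq_max => /andP[n1n kn].
rewrite -lee_fin.
have nk : (- n%:R <= k%:~R :> R)%R.
  have : (- (Posz n) <= k)%R by lia.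
  by rewrite -(ler_int R) rmorphN.
have h : D (z n) (e2 k%:~R) <= (e2 (- n%:R))%:E.
  apply: le_trans (sz n); apply: dist_le => j; apply: le_lt_trans.
  by rewrite ler_e2.
rewrite /Dr fineK; last by rewrite ge0_fin_numE ?dist_ge0// (le_lt_trans h)// ltry.
apply: le_trans h _; rewrite lee_fin; apply: le_trans n1e.
by rewrite ler_e2 lerN2 ler_nat.
Qed.

(** An atom of positive mass cannot belong to the exceptional set once the measure of that set has
    dropped below its mass. *)
Lemma small_coord z k (e : R) : small z -> (0 < e)%R ->
  exists M, forall n, (M <= n)%N -> (`|z n k| <= e)%R.
Proof.
move=> sz e0; have [n1 n1e] := e2_small e0.
have fnu : (0 < fine (nu [set k]))%R by rewrite fine_gt0// nu_gt0 nu_lty.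
have [n2 n2e] : exists n2 : nat, (e2 (- n2%:R) < fine (nu [set k]))%R.
  have [n2 n2e] := e2_small fnu; exists n2.+1; apply: lt_le_trans n2e.
  by rewrite ltr_e2 ltrN2 ltr_nat.
exists (maxn n1 n2) => n; rewrite geq_max => /andP[n1n n2n].
rewrite leNgt; apply/negP => ez.
have : nu [set k] <= (e2 (- n%:R))%:E.
  apply: le_trans (sz n); apply: le_measure; rewrite ?inE; [exact: measN|exact: measN|].
  move=> _ /= ->; apply: le_lt_trans ez; apply: le_trans n1e.
  by rewrite ler_e2 lerN2 ler_nat.
apply/negP; rewrite -ltNge -(@fineK _ (nu [set k])) ?ge0_fin_numE//.
rewrite lte_fin; apply: le_lt_trans n2e.
by rewrite ler_e2 lerN2 ler_nat.
Qed.

Definition restr (P : pred nat) f : nat -> R := fun k => if P k then f k else 0%R.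

Lemma restr_le P f k : (`|restr P f k| <= `|f k|)%R.
Proof. by rewrite /restr; case: ifP; rewrite ?normr0. Qed.

Lemma dnorm_restr_lty P f : N f < +oo -> N (restr P f) < +oo.
Proof. by apply: le_lt_trans; apply: le_dnorm_nat => // k; exact: restr_le. Qed.

Lemma Nr_le f g : N g < +oo -> (forall k, `|f k| <= `|g k|)%R -> (Nr f <= Nr g)%R.
Proof.
move=> Ng fg; have := le_dnorm_nat nu q r0 fg => le.
by rewrite -lee_fin -!NrE// (le_lt_trans le).
Qed.

Lemma Dr_le f g k : N g < +oo -> (forall k, `|f k| <= `|g k|)%R -> (Dr f k <= Dr g k)%R.
Proof.
move=> Ng fg; have Nf := le_lt_trans (le_dnorm_nat nu q r0 fg) Ng.
rewrite -lee_fin -(DrE r0 _ Ng) -(DrE r0 _ Nf).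
by apply: dist_le => j h; exact: lt_le_trans (fg _).
Qed.

Lemma nu_tail (A : set nat) (e : R) : nu A < +oo -> (0 < e)%R ->
  exists M, forall h, (M <= h)%N -> nu (A `&` [set j | (h <= j)%N]) <= e%:E.
Proof.
move=> nA e0; pose B h := A `&` [set j | (h <= j)%N].
have Bfin h : nu (B h) \is a fin_num.
  rewrite ge0_fin_numE//; apply: le_lt_trans nA.
  by apply: le_measure; rewrite ?inE; [exact: measN|exact: measN|exact: subIsetl].
have : nu \o B @ \oo --> nu (\bigcap_h B h).
  apply: nonincreasing_cvg_mu.
  - by rewrite -ge0_fin_numE.
  - by move=> h; exact: measN.
  - exact: measN.
  - apply/nonincreasing_seqP => h; apply/subsetPset => j [/= fj hj]; split=> //=.
    exact: ltnW.
have -> : \bigcap_h B h = set0.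
  apply/seteqP; split=> // j /(_ j.+1 I) [_] /=.
  by rewrite ltnn.
rewrite measure0 => /fine_cvgP[_ /cvgrPdist_le/(_ e e0)] [M _ HM].
exists M => h /HM; rewrite /= sub0r normrN ger0_norm ?fine_ge0//.
by rewrite -lee_fin fineK.
Qed.

Lemma Dr_restr_tail f (k : int) (e : R) : N f < +oo -> (0 < e)%R ->
  exists M, forall h, (M <= h)%N -> (Dr (restr (leq h) f) k <= e)%R.
Proof.
move=> Nf e0.
have [M HM] := nu_tail (dnorm_lty_dist r0 Nf (e2_gt0 k%:~R)) e0.
exists M => h /HM; rewrite -lee_fin -(DrE r0 _ (dnorm_restr_lty _ Nf)).
apply: le_trans; apply: le_measure; rewrite ?inE; [exact: measN|exact: measN|].
move=> j /=; rewrite /restr; case: ifP => //.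
by rewrite normr0 ltNge e2_ge0.
Qed.

Lemma dnorm_tail f (t : R) : N f < +oo -> (0 < t)%R ->
  exists M, forall h, (M <= h)%N -> (Nr (restr (leq h) f) <= t)%R.
Proof.
move=> Nf t0.
have [||k|M HM] := @esum_dominated R (fun h k => w k * Dr (restr (leq h) f) k `^ r)%R
  (fun k => w k * Dr f k `^ r)%R _ _ _ t t0.
- move=> h k; rewrite mulr_ge0 ?powR_ge0 ?e2_ge0//=.
  rewrite ler_wpM2l ?e2_ge0// powR_le ?(ltW r0) ?Dr_ge0//.
  by apply: Dr_le => // j; exact: restr_le.
- by rewrite esum_dterm// ltry.
- move=> e e0; have we0 : (0 < e / w k)%R by rewrite divr_gt0 ?e2_gt0.
  have [d d0 Hd] := powR_small r0 we0.
  have [M HM] := Dr_restr_tail k Nf d0; exists M => h Mh.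
  by rewrite mulrC -ler_pdivlMr ?e2_gt0// Hd// Dr_ge0 HM.
exists M => h Mh; rewrite -lee_fin -esum_dterm ?HM//.
exact: dnorm_restr_lty.
Qed.

Lemma dnorm_head z h (t : R) : small z -> (forall n, N (z n) < +oo) -> (0 < t)%R ->
  exists M, forall n, (M <= n)%N -> (Nr (restr (fun k => (k < h)%N) (z n)) <= t)%R.
Proof.
move=> sz Nz t0; pose P k := (k < h)%N.
have [M1 HM1] : exists M, forall n, (M <= n)%N -> forall k, (k < h)%N -> (`|z n k| <= 1)%R.
  have /choice[M HM] := fun k => small_coord k sz ltr01.
  exists (\max_(k < h) M k)%N => n Mn k kh; apply: HM; apply: leq_trans Mn.
  by rewrite (leq_bigmax (Ordinal kh)).
pose o := restr P (fun=> 1%R).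
have No : N o < +oo.
  by apply: (@dnorm_fin_supp _ _ _ _ q0 r0 nu_lty _ h) => k hk; rewrite /o /restr /P ltnNge hk.
(* The shift by [M1] starts the sequence where its entries before [h] are at most 1 in modulus, so
   that the indicator of the first [h] atoms supplies the majorant. *)
have [||k|M HM] := @esum_dominated R (fun n k => w k * Dr (restr P (z (n + M1)%N)) k `^ r)%R
  (fun k => w k * Dr o k `^ r)%R _ _ _ t t0.
- move=> n k; rewrite mulr_ge0 ?powR_ge0 ?e2_ge0//=.
  rewrite ler_wpM2l ?e2_ge0// powR_le ?(ltW r0) ?Dr_ge0//.
  apply: Dr_le => // j; rewrite /o /restr.
  by case: ifP => // jh; rewrite normr1 HM1// leq_addl.
- by rewrite esum_dterm// ltry.
- move=> e e0; have we0 : (0 < e / w k)%R by rewrite divr_gt0 ?e2_gt0.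
  have [d d0 Hd] := powR_small r0 we0.
  have [M HM] := small_Dr k sz d0; exists M => n Mn.
  rewrite mulrC -ler_pdivlMr ?e2_gt0// Hd// Dr_ge0/=.
  apply: le_trans (HM (n + M1)%N (leq_trans Mn (leq_addr _ _))).
  by apply: Dr_le => // j; exact: restr_le.
exists (M + M1)%N => n Mn; rewrite -lee_fin -esum_dterm; last exact: dnorm_restr_lty.
have := HM (n - M1)%N; rewrite subnK; last by apply: leq_trans Mn; rewrite leq_addl.
by apply; clear -Mn; lia.
Qed.

Lemma dist_disjoint f g s : (0 <= s)%R -> (forall k, f k = 0 \/ g k = 0)%R ->
  D (fun k => f k + g k)%R s = D f s + D g s.
Proof.
move=> s0 fg; rewrite /dist -measureU; [|exact: measN|exact: measN|].
  congr (nu _); apply/seteqP; split => k /=; case: (fg k) => ->; rewrite ?add0r ?addr0 ?normr0;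
    try tauto.
  - by case=> //; rewrite ltNge s0.
  - by case=> //; rewrite ltNge s0.
apply/seteqP; split=> // k /= []; case: (fg k) => ->; rewrite normr0.
  by rewrite ltNge s0.
by move=> _; rewrite ltNge s0.
Qed.

(** At each level put [a = Dr f k] and [b = Dr (z n) k]; the sum has the value [a + b]. The excess
    of [(a + b)^r] over [a^r] vanishes as [b] tends to 0, and after subtracting [2^r * b^r] it is
    dominated by [2^r * a^r], which does not depend on [n]. *)
Lemma dnorm_disjoint f z (t : R) : N f < +oo -> small z -> (forall n, N (z n) < +oo) ->
  (forall n k, f k = 0 \/ z n k = 0)%R -> (0 < t)%R ->
  exists M, forall n, (M <= n)%N ->
    (Nr (fun k => f k + z n k) <= Nr f + e2 r * Nr (z n) + t /\
     Nr f + Nr (z n) <= Nr (fun k => f k + z n k) + t)%R.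
Proof.
move=> Nf sz Nz fz t0.
have Nfz n : N (fun k => f k + z n k)%R < +oo by exact: dnormD_lty.
have DD n k : Dr (fun i => f i + z n i)%R k = (Dr f k + Dr (z n) k)%R.
  apply: EFin_inj; rewrite EFinD -(DrE r0 _ Nf) -(DrE r0 _ (Nz n)) -(DrE r0 _ (Nfz n)).
  by rewrite dist_disjoint// e2_ge0.
have f0 := Dr_ge0 nu f; have z0 n := Dr_ge0 nu (z n).
have [||k|M1 HM1] := @esum_dominated R (fun n k => w k * Num.max 0
    ((Dr f k + Dr (z n) k) `^ r - Dr f k `^ r - e2 r * Dr (z n) k `^ r))%R
  (fun k => e2 r * (w k * Dr f k `^ r))%R _ _ _ t t0.
- move=> n k; rewrite mulr_ge0 ?e2_ge0 ?le_max ?lexx//= (mulrCA (e2 r)) ler_wpM2l ?e2_ge0//.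
  rewrite ge_max mulr_ge0 ?e2_ge0 ?powR_ge0//=.
  have := powRD_le (ltW r0) (f0 k) (z0 n k); have := powR_ge0 (Dr f k) r; lra.
- under eq_esum do rewrite EFinM.
  rewrite esumZl_int ?e2_ge0//; last by move=> k; rewrite lee_fin mulr_ge0 ?e2_ge0 ?powR_ge0.
  by rewrite esum_dterm// -EFinM ltry.
- move=> e e0; have we0 : (0 < e / w k)%R by rewrite divr_gt0 ?e2_gt0.
  have [d d0 Hd] := powR_right_cont r0 (f0 k) we0.
  have [M HM] := small_Dr k sz d0; exists M => n Mn.
  rewrite mulrC -ler_pdivlMr ?e2_gt0// ge_max ltW//=.
  have := Hd (Dr (z n) k); rewrite z0 HM// => /(_ isT).
  have : (0 <= e2 r * Dr (z n) k `^ r)%R by rewrite mulr_ge0 ?e2_ge0 ?powR_ge0.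
  lra.
(* As [(a + b)^r] is at least the larger of [a^r] and [b^r], the deficit in the lower bound is at
   most the smaller one, again dominated by [a^r]. *)
have [||k|M2 HM2] := @esum_dominated R (fun n k => w k * Num.min
    (Dr f k `^ r) (Dr (z n) k `^ r))%R
  (fun k => w k * Dr f k `^ r)%R _ _ _ t t0.
- move=> n k; rewrite mulr_ge0 ?e2_ge0 ?le_min ?powR_ge0//= ler_wpM2l ?e2_ge0//.
  by rewrite ge_min lexx.
- by rewrite esum_dterm// ltry.
- move=> e e0; have we0 : (0 < e / w k)%R by rewrite divr_gt0 ?e2_gt0.
  have [d d0 Hd] := powR_small r0 we0.
  have [M HM] := small_Dr k sz d0; exists M => n Mn.
  rewrite mulrC -ler_pdivlMr ?e2_gt0// ge_min; apply/orP; right.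
  by apply: Hd; rewrite z0 HM.
exists (maxn M1 M2) => n; rewrite geq_max => /andP[/HM1 h1 /HM2 h2].
have p0 (g : nat -> R) k : 0 <= (w k * Dr g k `^ r)%:E by rewrite lee_fin mulr_ge0 ?e2_ge0 ?powR_ge0.
have r20 (g : nat -> R) k : 0 <= (e2 r * (w k * Dr g k `^ r))%:E.
  by rewrite lee_fin mulr_ge0 ?e2_ge0// -lee_fin p0.
have e2p : (0 <= e2 r :> R)%R by exact: e2_ge0.
split; rewrite -lee_fin !EFinD ?EFinM -!esum_dterm//.
  apply: le_trans (leeD2l _ h1); rewrite -esumZl_int// -esumD//; last by move=> k _; rewrite -EFinM.
  under [X in _ <= X + _]eq_esum do rewrite -EFinM -EFinD.
  rewrite -esumD//; last 2 first.
  - by move=> k _; rewrite EFinD adde_ge0.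
  - by move=> k _; rewrite lee_fin mulr_ge0 ?e2_ge0 ?le_max ?lexx.
  apply: le_esum => k _; rewrite -EFinD lee_fin DD.
  rewrite (mulrCA (e2 r)) -!mulrDr ler_wpM2l ?e2_ge0//.
  set x := (_ `^ r)%R; set y := (_ `^ r)%R; set v := (_ `^ r)%R.
  have : (x - y - e2 r * v <= Num.max 0 (x - y - e2 r * v))%R by rewrite le_max lexx orbT.
  lra.
apply: le_trans (leeD2l _ h2); rewrite -!esumD//; last first.
  by move=> k _; rewrite lee_fin mulr_ge0 ?e2_ge0 ?le_min ?powR_ge0.
apply: le_esum => k _; rewrite -!EFinD lee_fin DD -!mulrDr ler_wpM2l ?e2_ge0//.
have : (Dr f k `^ r <= (Dr f k + Dr (z n) k) `^ r)%R.
  by apply: powR_le; [exact: ltW|exact: f0|rewrite lerDl].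
have : (Dr (z n) k `^ r <= (Dr f k + Dr (z n) k) `^ r)%R.
  by apply: powR_le; [exact: ltW|exact: z0|rewrite lerDr].
by rewrite /Num.min; case: ifP => _; lra.
Qed.

(* A vector small enough in measure is almost disjoint from a given finitely
   supported one, so that successive choices add up as in ell_q. *)
Lemma almost_lq (z : nat -> nat -> nat -> R) :
  (forall i, small (z i)) -> (forall i n, N (z i n) < +oo) ->
  forall K (t : R), (0 < t)%R -> exists (n : nat -> nat) F E h,
    [/\ forall k, (\sum_(i < K) z i (n i) k = F k + E k)%R,
        N E < +oo /\ (Nr E <= t)%R,
        forall k, (h <= k)%N -> F k = 0%R,
        (Nr F <= e2 r * (\sum_(i < K) Nr (z i (n i))) + t)%R &
        (\sum_(i < K) Nr (z i (n i)) <= kap * Nr F + t)%R].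
Proof.
move=> sz Nz; have k1 : (1 <= kap)%R by exact: kap_ge1.
have k0 : (0 < kap)%R by exact: lt_le_trans k1.
elim=> [|K ih] t t0.
  have N0 : N (fun=> 0%R) < +oo by exact: (@dnorm_fin_supp _ _ _ _ q0 r0 nu_lty _ 0%N).
  have Nr0 : Nr (fun=> 0%R) = 0%R.
    rewrite /Nr /dnorm esum1// => k _; rewrite /dterm.
    suff -> : D (fun=> 0%R) (e2 k%:~R) = 0 by rewrite poweR0r ?gt_eqF// mule0.
    rewrite -(measure0 nu); congr (nu _); apply/seteqP; split => j //=.
    by rewrite normr0 ltNge e2_ge0.
  exists id, (fun=> 0%R), (fun=> 0%R), 0%N; split => //.
  - by move=> k; rewrite big_ord0 addr0.
  - by rewrite Nr0 ltW.
  - by rewrite Nr0 big_ord0 mulr0 add0r ltW.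
  - by rewrite Nr0 big_ord0 mulr0 add0r ltW.
(* The induction hypothesis gets the budget [t / (4 * kap)], so that one quasi-triangle inequality
   applied to the old and the new error stays within [t]. *)
have t1 : (0 < t / (4 * kap))%R by rewrite divr_gt0// mulr_gt0.
have [n [F [E [h [FE [NE Et] Fh Fle leF]]]]] := ih _ t1.
have NF : N F < +oo by exact: (@dnorm_fin_supp _ _ _ _ q0 r0 nu_lty _ h).
have t2 : (0 < t / (8 * kap ^+ 2))%R by rewrite divr_gt0// mulr_gt0// exprn_gt0.
have /choice[h' Hh'] := fun m => dnorm_tail (Nz K m) t2.
pose H m := maxn h (h' m).
(* Gliding hump: only the part of [z K m] between the support of [F] and a far index joins [F]; the
   head and the tail go to the error. *)
pose d m := restr (fun k => (h <= k < H m)%N) (z K m).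
pose e m k := (restr (fun k => (k < h)%N) (z K m) k + restr (leq (H m)) (z K m) k)%R.
have zde m k : z K m k = (d m k + e m k)%R.
  rewrite /d /e /restr; have [kh|hk] := ltnP k h; have [kH|Hk] := ltnP k (H m) => /=;
    rewrite ?add0r ?addr0//.
  by exfalso; move: Hk; rewrite leqNgt (leq_trans kh)// leq_maxl.
have sd : small d by apply: small_le (sz K) _ => m k; exact: restr_le.
have Nd m : N (d m) < +oo by exact: dnorm_restr_lty.
have [M1 HM1] := dnorm_head h (sz K) (Nz K) t2.
have [M2 HM2] : exists M, forall n, (M <= n)%N ->
    (Nr (fun k => F k + d n k) <= Nr F + e2 r * Nr (d n) + t / (4 * kap) /\
     Nr F + Nr (d n) <= Nr (fun k => F k + d n k) + t / (4 * kap))%R.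
  apply: dnorm_disjoint => // m k; have [kh|hk] := ltnP k h; last by left; exact: Fh.
  by right; rewrite /d /restr leqNgt kh.
pose m := maxn M1 M2.
have [up lo] := HM2 m (leq_maxr _ _).
have Ne : N (e m) < +oo by apply: dnormD_lty; exact: dnorm_restr_lty.
have et : (Nr (e m) <= t / (4 * kap))%R.
  have := NrD (dnorm_restr_lty (fun k => (k < h)%N) (Nz K m)) (dnorm_restr_lty (leq (H m)) (Nz K m)).
  have := HM1 m (leq_maxl _ _); have := Hh' m (H m) (leq_maxr _ _).
  set x := Nr _; set y := Nr _ => xt yt; rewrite -/(e m) => le; apply: le_trans le _.
  apply: (@le_trans _ _ (kap * (t / (8 * kap ^+ 2) + t / (8 * kap ^+ 2)))%R).
    by rewrite ler_wpM2l ?(ltW k0)// lerD.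
  by rewrite le_eqVlt; apply/orP; left; apply/eqP; field; rewrite gt_eqF.
have kt : (kap * (t / (4 * kap)) = t / 4)%R by field; rewrite gt_eqF.
have t4 : (t / (4 * kap) <= t / 4)%R.
  by rewrite -kt ler_peMl// ltW.
pose n' i := if (i < K)%N then n i else m.
have nK (G : nat -> nat -> R) : (\sum_(i < K.+1) G i (n' i) = \sum_(i < K) G i (n i) + G K m)%R.
  rewrite big_ord_recr/= {2}/n' ltnn; congr (_ + _)%R.
  by apply: eq_bigr => i _; rewrite /n' ltn_ord.
exists n', (fun k => F k + d m k)%R, (fun k => E k + e m k)%R, (maxn h (H m)).
have NdN : (Nr (d m) <= Nr (z K m))%R by apply: Nr_le => // k; exact: restr_le.
have zk : (Nr (z K m) <= kap * (Nr (d m) + Nr (e m)))%R.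
  apply: le_trans (NrD (Nd m) Ne); rewrite le_eqVlt; apply/orP; left; apply/eqP.
  by congr Nr; apply/funext => k; rewrite zde.
split.
- by move=> k; rewrite (nK (fun i j => z i j k)) FE zde addrACA.
- split; first exact: dnormD_lty.
  apply: le_trans (NrD NE Ne) _.
  apply: (@le_trans _ _ (kap * (t / (4 * kap) + t / (4 * kap)))%R).
    by rewrite ler_wpM2l ?(ltW k0)// lerD.
  by rewrite mulrDr kt; lra.
- move=> k; rewrite geq_max => /andP[hk Hk].
  by rewrite Fh// /d /restr hk/= ltnNge Hk/= addr0.
- rewrite (nK (fun i j => Nr (z i j))) mulrDr; apply: le_trans up _.
  have : (e2 r * Nr (d m) <= e2 r * Nr (z K m))%R by rewrite ler_wpM2l ?e2_ge0.
  lra.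
- rewrite (nK (fun i j => Nr (z i j))).
  have : (kap * (Nr F + Nr (d m)) <= kap * (Nr (fun k => F k + d m k) + t / (4 * kap)))%R.
    by rewrite ler_wpM2l ?(ltW k0).
  have : (kap * Nr (e m) <= kap * (t / (4 * kap)))%R by rewrite ler_wpM2l ?(ltW k0).
  rewrite !mulrDr kt in zk *; lra.
Qed.

End almost_lq.

Section sums.
Context {R : realType}.

(** There are [3 * 4^k] positive integers with base-4 logarithm [k], and 0 is sent to level 0,
    whence the separate [F 0]. Coefficients [2^(-k)] at these positions put the square sum 3 on
    every level. *)
Lemma sum_trunc_log (F : nat -> R) K :
  \sum_(m < 4 ^ K) F (trunc_log 4 m) = F 0%N + 3 * \sum_(k < K) 4 ^+ k * F k.
Proof.
elim: K => [|K ih]; first by rewrite expn0 big_ord1 big_ord0 mulr0 addr0 trunc_log0.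
have KK : (4 ^ K <= 4 ^ K.+1)%N by rewrite leq_exp2l.
rewrite -(big_mkord xpredT (fun m => F (trunc_log 4 m))) (@big_cat_nat _ _ _ (4 ^ K))//=.
rewrite big_mkord ih big_ord_recr/= mulrDr addrA; congr (_ + _).
rewrite (eq_big_nat _ _ (F2 := fun=> F K)); last first.
  by move=> m /andP[Km mK]; rewrite (@trunc_log_eq 4 K)// Km.
rewrite sumr_const_nat -[LHS]mulr_natr (_ : 4 ^ K.+1 - 4 ^ K = 3 * 4 ^ K)%N; last first.
  by rewrite expnS; lia.
by rewrite natrM natrX; ring.
Qed.

(** Values up to [d] contribute at most [K * d]; a value [v] above [d] satisfies
    [v <= V <= V / d^r * v^r]. The average over [K] terms is thus small for large [K], even when
    [r > 1]. *)
Lemma sum_le_powR (r V d B : R) : 0 < r -> 0 < d -> 0 <= V -> exists2 W, 0 <= W &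
  forall K (v : nat -> R), (forall k, 0 <= v k <= V) -> \sum_(k < K) v k `^ r <= B ->
    \sum_(k < K) v k <= K%:R * d + W * B.
Proof.
move=> r0 d0 V0; pose W := V / d `^ r.
have W0 : 0 <= W by rewrite divr_ge0// powR_ge0.
exists W => // K v vV vB.
apply: (@le_trans _ _ (\sum_(k < K) (d + W * v k `^ r))).
  apply: ler_sum => k _; have /andP[v0 vk] := vV k.
  have [vd|dv] := leP (v k) d; first by rewrite (le_trans vd)// lerDl mulr_ge0// powR_ge0.
  rewrite (le_trans vk)// -[V]add0r lerD//; first exact: ltW.
  rewrite /W -mulrA ler_peMr// mulrC ler_pdivlMr ?powR_gt0// mul1r.
  by apply: powR_le; exact: ltW.
rewrite big_split/= sumr_const card_ord -[X in X + _]mulr_natl lerD2l -mulr_sumr.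
by rewrite ler_wpM2l.
Qed.

Lemma e2_unbounded (s x : R) : 0 < s -> exists j : nat, x < e2 (s * j%:R).
Proof.
move=> s0; have l0 := @ln2_gt0 R.
have sl : 0 < s * ln 2 by rewrite mulr_gt0.
exists (Num.bound (`|x| / (s * ln 2))).
rewrite (le_lt_trans (ler_norm x))// e2E; apply: lt_le_trans (expR_ge1Dx _).
rewrite mulrAC; have := @archi_boundP R (`|x| / (s * ln 2)).
by rewrite divr_ge0 ?(ltW sl)// => /(_ isT); rewrite ltr_pdivrMr// => h;
  rewrite (lt_trans h)// mulrC ltrDr.
Qed.

End sums.

(** * Distribution functions of sums along almost disjoint subsequences *)

Section almost_disjoint.
Context {R : realType}.
Variables (nu : {measure set nat -> \bar R}) (q r : R).
Hypotheses (q0 : 0 < q) (r0 : 0 < r).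
Hypothesis nu_gt0 : forall k : nat, (0 < nu [set k])%E.
Hypothesis nu_lty : forall k : nat, (nu [set k] < +oo)%E.
Implicit Types (f g : nat -> R) (y z : nat -> nat -> R) (s t : R).
Local Open Scope ereal_scope.
Local Notation D := (dist nu).
Local Notation N := (dnorm nu q r).
Local Notation Dr := (Dr nu).
Local Notation Nr := (Nr nu q r).

Definition coord_null y := forall k (e : R), (0 < e)%R ->
  exists M, forall n, (M <= n)%N -> (`|y n k| <= e)%R.

(** Beyond a suitable [h] the envelope [F] exceeds [eta] only on a set of measure at most [eta],
    while [y n] is at most [eta] on the first [h] atoms once [n] is large. Up to [eta], each atom
    sees one summand only. The threshold [M] is uniform in all [f] under the envelope and in [a]. *)
Lemma dist_almost_disjoint y (F : nat -> R) (eta : R) : (0 < eta)%R ->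
  coord_null y -> D F eta < +oo ->
  exists M, forall n f (a : R), (M <= n)%N -> (forall k, `|f k| <= F k)%R -> (`|a| <= 1)%R ->
    forall s, (0 <= s)%R ->
    D (fun k => f k + a * y n k)%R (s + eta)%R <= D f s + D (fun k => a * y n k)%R s + eta%:E /\
    D f (s + eta)%R + D (fun k => a * y n k)%R (s + eta)%R <=
      D (fun k => f k + a * y n k)%R s + (2 * eta)%:E.
Proof.
move=> eta0 y0 DF; have [h /(_ h (leqnn _))] := nu_tail DF eta0.
set S := _ `&` _ => nS.
have /choice[M HM] := fun k => y0 k _ eta0.
exists (\max_(k < h) M k)%N => n f a Mn fF a1 s s0.
have yh k : (k < h)%N -> (`|a * y n k| <= eta)%R.
  move=> kh; rewrite normrM; apply: (@le_trans _ _ (1 * `|y n k|)%R); first by rewrite ler_wpM2r.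
  rewrite mul1r HM// (leq_trans _ Mn)//.
  exact: (leq_bigmax (Ordinal kh)).
have fh k : (h <= k)%N -> ~ S k -> (`|f k| <= eta)%R.
  move=> hk Sk; rewrite leNgt; apply/negP => ef; apply: Sk; split => //=.
  by apply: lt_le_trans ef (le_trans (fF k) _); rewrite ler_norm.
set A := [set k | (s < `|f k|)%R]; set B := [set k | (s < `|a * y n k|)%R].
split.
  apply: (@le_trans _ _ (nu (A `|` B `|` S))).
    apply: le_measure; rewrite ?inE; [exact: measN|exact: measN|].
    move=> k /= h1; have [Sk|Sk] := pselect (S k); first by right.
    left; have := ler_normD (f k) (a * y n k)%R; have [kh|hk] := ltnP k h.
      by have := yh k kh; left; rewrite /A/=; lra.
    by have := fh k hk Sk; right; rewrite /B/=; lra.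
  apply: le_trans (measureU2 _ _ _) _; [exact: measN|exact: measN|].
  by apply: leeD => //; apply: measureU2; exact: measN.
set A' := [set k | (s + eta < `|f k|)%R]; set B' := [set k | (s + eta < `|a * y n k|)%R].
set G := [set k | (s < `|f k + a * y n k|)%R]; pose H := [set k | (k < h)%N].
have tri k : (`|f k| <= `|f k + a * y n k| + `|a * y n k|)%R.
  by have := ler_normB (f k + a * y n k)%R (a * y n k)%R; rewrite addrK.
have tri' k : (`|a * y n k| <= `|f k + a * y n k| + `|f k|)%R.
  by have := ler_normB (f k + a * y n k)%R (f k); rewrite addrC addKr addrC.
have hA : nu A' <= nu (G `&` H) + eta%:E.
  apply: (@le_trans _ _ (nu (G `&` H `|` S))).
    apply: le_measure; rewrite ?inE; [exact: measN|exact: measN|].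
    move=> k; rewrite /A'/= => Ak; have [kh|hk] := ltnP k h.
      by left; split => //; rewrite /G/=; have := yh k kh; have := tri k; lra.
    by right; split => //=; have := fF k; have := ler_norm (F k); lra.
  apply: le_trans (measureU2 _ _ _) _; [exact: measN|exact: measN|].
  exact: leeD.
have hB : nu B' <= nu (G `&` ~` H) + eta%:E.
  apply: (@le_trans _ _ (nu (G `&` ~` H `|` S))).
    apply: le_measure; rewrite ?inE; [exact: measN|exact: measN|].
    move=> k; rewrite /B'/= => Bk; have [Sk|Sk] := pselect (S k); first by right.
    have [kh|hk] := ltnP k h; first by have := yh k kh; lra.
    left; split; last by rewrite /H/=; apply/negP; rewrite -leqNgt.
    by rewrite /G/=; have := fh k hk Sk; have := tri' k; lra.
  apply: le_trans (measureU2 _ _ _) _; [exact: measN|exact: measN|].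
  exact: leeD.
have -> : D (fun k => (f k + a * y n k)%R) s = nu (G `&` H) + nu (G `&` ~` H).
  by rewrite addeC -setDE -measureDI; [|exact: measN|exact: measN].
have -> : (2 * eta)%:E = eta%:E + eta%:E by rewrite -EFinD; congr _%:E; ring.
by rewrite addeACA; exact: leeD.
Qed.

Lemma dnorm_sum_lty (g : nat -> nat -> R) M : (forall i, N (g i) < +oo) ->
  N (fun k => \sum_(i < M) g i k)%R < +oo.
Proof.
move=> Ng; elim: M => [|m im].
  by apply: (@dnorm_fin_supp _ _ _ _ q0 r0 nu_lty _ 0%N) => k _; rewrite big_ord0.
have -> : (fun k => \sum_(i < m.+1) g i k)%R = (fun k => \sum_(i < m) g i k + g m k)%R.
  by apply/funext => k; rewrite big_ord_recr.
exact: dnormD_lty.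
Qed.

(** The indices are fixed before the coefficients and serve all coefficients of modulus at most 1,
    because coefficients are later found by averaging over this very subsequence. *)
Lemma dist_almost_disjoint_seq y (M : nat) (eta : R) : (0 < eta)%R ->
  coord_null y -> (forall n, N (y n) < +oo) ->
  exists (n : nat -> nat) (L : nat),
   (forall i, (i < M)%N -> (n i < L)%N) /\
   (forall i j, (i < M)%N -> (j < M)%N -> n i = n j -> i = j) /\
   forall a : nat -> R, (forall i, `|a i| <= 1)%R -> forall s, (0 <= s)%R ->
    let f k := (\sum_(i < M) a i * y (n i) k)%R in
    D f (s + M%:R * eta)%R <= \sum_(i < M) D (fun k => a i * y (n i) k)%R s + (M%:R * eta)%:E /\
    \sum_(i < M) D (fun k => a i * y (n i) k)%R (s + M%:R * eta)%R <=
       D f s + (2 * M%:R * eta)%:E.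
Proof.
move=> eta0 y0 Ny; elim: M => [|M [n [L [nL [ninj ih]]]]].
  exists id, 0%N; split=> //; split=> // a _ s s0 f.
  rewrite !big_ord0 mul0r mulr0 mul0r adde0 adde0 addr0; split; last exact: dist_ge0.
  rewrite -(measure0 nu); apply: le_measure; rewrite ?inE; [exact: measN|exact: measN|].
  by move=> k /=; rewrite /f big_ord0 normr0 ltNge s0.
(* An envelope of all admissible combinations of the vectors chosen so far. *)
pose F k := (\sum_(i < M) `|y (n i) k|)%R.
have NF : N F < +oo.
  apply: (@dnorm_sum_lty (fun i k => `|y (n i) k|)%R) => i; apply: le_lt_trans (Ny (n i)).
  by apply: le_dnorm_nat => // k; rewrite normr_id.
have [M1 HM1] := dist_almost_disjoint eta0 y0 (dnorm_lty_dist r0 NF eta0).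
pose m := maxn L M1; pose n' i := if (i < M)%N then n i else m.
have nM : n' M = m by rewrite /n' ltnn.
have niM (i : 'I_M) : n' i = n i by rewrite /n' ltn_ord.
exists n', m.+1; split; [|split].
- move=> i iM; rewrite /n'; case: ifP => // h; rewrite ltnS (leq_trans (ltnW (nL _ h)))//.
  exact: leq_maxl.
- move=> i j; rewrite !ltnS /n'; case: ifP => iM; case: ifP => jM; move=> iM' jM' e.
  + exact: ninj.
  + by have := nL _ iM; rewrite e ltnNge leq_maxl.
  + by have := nL _ jM; rewrite -e ltnNge leq_maxl.
  + by apply/eqP; rewrite eqn_leq; apply/andP; split;
       [apply: leq_trans iM' _|apply: leq_trans jM' _]; rewrite leqNgt ?iM ?jM.
- move=> a a1 s s0 f.
  have [ih1 _] := ih a a1 s s0.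
  have se0 : (0 <= s + M%:R * eta)%R by rewrite addr_ge0// mulr_ge0// ltW.
  have fE : f = (fun k => \sum_(i < M) a i * y (n i) k + a M * y m k)%R.
    apply/funext => k; rewrite /f big_ord_recr/= nM; congr (_ + _)%R.
    by apply: eq_bigr => i _; rewrite niM.
  have fF k : (`|\sum_(i < M) a i * y (n i) k| <= F k)%R.
    apply: le_trans (ler_norm_sum _ _ _) _; apply: ler_sum => i _.
    by rewrite normrM ler_piMl.
  have [h1 _] := HM1 m _ (a M) (leq_maxr _ _) fF (a1 M) _ se0.
  have [_ h2] := HM1 m _ (a M) (leq_maxr _ _) fF (a1 M) _ s0.
  have e1 : (M.+1%:R * eta = M%:R * eta + eta)%R by rewrite -addn1 natrD mulrDl mul1r.
  have e2 : (2 * M.+1%:R * eta = 2 * M%:R * eta + 2 * eta)%R by rewrite -!mulrA e1 mulrDr.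
  have mon t k' : (s <= t)%R -> D (fun k => a k' * y (n' k') k)%R t <= D (fun k => a k' * y
    (n' k') k)%R s.
    by move=> st; apply: dist_le => k; exact: le_lt_trans.
  split.
    rewrite e1 addrA fE; apply: le_trans h1 _.
    rewrite big_ord_recr/= nM EFinD addeA leeD2r// [leRHS]addeAC leeD//.
      by under eq_bigr do rewrite niM.
    by have := mon (s + M%:R * eta)%R M; rewrite nM; apply; rewrite lerDl mulr_ge0// ltW.
  have [_ ih2] := ih a a1 (s + eta)%R (addr_ge0 s0 (ltW eta0)).
  rewrite e1 e2 big_ord_recr/= nM.
  have -> : (s + (M%:R * eta + eta) = s + eta + M%:R * eta)%R by ring.
  under eq_bigr do rewrite niM.
  apply: (@le_trans _ _ (D (fun k => \sum_(i < M) a i * y (n i) k)%R (s + eta)%R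
     + (2 * M%:R * eta)%:E + D (fun k => a M * y m k)%R (s + eta)%R)).
    apply: leeD; first exact: ih2.
    apply: dist_le => k; apply: le_lt_trans.
    by rewrite lerDl mulr_ge0// ltW.
  by rewrite addeAC EFinD fE addeCA [leRHS]addeC; apply: leeD2r.
Qed.

End almost_disjoint.

Lemma e2_pow4 {R : realType} J : e2 (2 * J%:R) = 4 ^+ J :> R.
Proof. by rewrite e2X -[2]/(2%:R) e2_nat -natrX. Qed.

(** * Normalised combinations that are small in measure *)

Section flat.
Context {R : realType}.
Variables (nu : {measure set nat -> \bar R}) (q r : R).
Hypotheses (q0 : 0 < q) (r0 : 0 < r).
Hypothesis nu_gt0 : forall k : nat, (0 < nu [set k])%E.
Hypothesis nu_lty : forall k : nat, (nu [set k] < +oo)%E.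
Implicit Types (f g : nat -> R) (y z : nat -> nat -> R) (s t : R).
Local Open Scope ereal_scope.
Local Notation D := (dist nu).
Local Notation N := (dnorm nu q r).
Local Notation Dr := (Dr nu).
Local Notation Nr := (Nr nu q r).

Definition comb L (a : nat -> R) y : nat -> R := fun k => (\sum_(n < L) a n * y n k)%R.

Section flat_sequence.
Variables (y : nat -> nat -> R) (B : R).
Hypothesis yB : forall L (a : nat -> R), (\sum_(n < L) a n ^+ 2 = 1)%R -> N (comb L a y) <= B%:E.

Lemma comb_single n : exists a : nat -> R,
  (\sum_(i < n.+1) a i ^+ 2 = 1)%R /\ comb n.+1 a y = y n.
Proof.
exists (fun i => (i == n)%:R)%R; split.
  rewrite big_ord_recr/= eqxx expr1n big1 ?add0r// => i _.
  by rewrite ltn_eqF ?ltn_ord// expr0n.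
apply/funext => k; rewrite /comb big_ord_recr/= eqxx mul1r big1 ?add0r// => i _.
by rewrite ltn_eqF ?ltn_ord// mul0r.
Qed.

Lemma flat_le n : N (y n) <= B%:E.
Proof. by have [a [/yB + yE]] := comb_single n; rewrite yE. Qed.

Lemma flat_lty n : N (y n) < +oo.
Proof. exact: le_lt_trans (flat_le n) (ltry _). Qed.

(** Test with the coefficients [y n k / sqrt S]: the combination takes the value [sqrt S] at atom
    [k], while the bound on [N] and the positive mass of the atom limit every value at [k]. *)
Lemma flat_coord_sum k : exists S : R, forall L, (\sum_(n < L) y n k ^+ 2 <= S)%R.
Proof.
have nk : (0 < fine (nu [set k]))%R by rewrite fine_gt0// nu_gt0 nu_lty.
pose c := (fine (nu [set k]) `^ r)%R; have c0 : (0 < c)%R by rewrite powR_gt0.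
have [j Hj] : exists j : nat, (B < e2 (q * j%:R) * c)%R.
  have [j Bj] := e2_unbounded (B / c) q0; exists j.
  by rewrite -ltr_pdivrMr.
exists (e2 (j%:R) ^+ 2)%R => L.
rewrite leNgt; apply/negP => SL; set S := (\sum_(n < L) _)%R in SL.
have S0 : (0 < S)%R by apply: lt_trans SL; rewrite exprn_gt0// e2_gt0.
pose s := Num.sqrt S; have s0 : (0 < s)%R by rewrite sqrtr_gt0.
have sS : (s ^+ 2 = S)%R by rewrite sqr_sqrtr// ltW.
have a1 : (\sum_(n < L) (y n k / s) ^+ 2 = 1)%R.
  under eq_bigr do rewrite expr_div_n.
  by rewrite -mulr_suml sS divff// gt_eqF.
have := le_trans (dterm_le_dnorm q r nu _ (Posz j)) (@yB L (fun n => y n k / s)%R a1).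
apply/negP; rewrite -ltNge; apply: (@lt_le_trans _ _ (e2 (q * j%:R) * c)%:E).
  by rewrite lte_fin.
rewrite EFinM; apply: lee_pmul; rewrite ?lee_fin ?e2_ge0 ?(ltW c0)//.
rewrite /c -poweR_EFin fineK ?ge0_fin_numE//.
rewrite gt0_ler_poweR ?(ltW r0)// ?in_itv/= ?leey ?andbT ?dist_ge0//.
apply: le_measure; rewrite ?inE; [exact: measN|exact: measN|].
move=> _ /= ->; rewrite /comb.
under eq_bigr do rewrite mulrAC -expr2.
rewrite -mulr_suml -/S -sS expr2 mulfK ?gt_eqF// gtr0_norm//.
by rewrite -(@ltr_pXn2r _ 2)// ?nnegrE ?e2_ge0 ?(ltW s0)// sS.
Qed.

Lemma flat_coord_null : coord_null y.
Proof.
move=> k e e0; have [S HS] := flat_coord_sum k.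
have cv : cvgn (series (fun n => y n k ^+ 2 : R^o)%R).
  apply: nondecreasing_is_cvgn.
    by apply/nondecreasing_seqP => n; rewrite !seriesEnat/= big_nat_recr//= lerDl sqr_ge0.
  by exists S => _ [n _ <-]; rewrite seriesEord; exact: HS.
have /cvgrPdist_le/(_ (e ^+ 2)%R) := cvg_series_cvg_0 cv.
rewrite exprn_gt0// => /(_ isT)[M _ HM]; exists M => n /HM.
rewrite sub0r normrN normrX -normrX.
by rewrite ger0_norm ?sqr_ge0// -real_normK ?num_real// ler_pXn2r// ?nnegrE ?(ltW e0).
Qed.

Lemma sum_delta (M L : nat) (n : nat -> nat) (F G : nat -> R) :
  (forall i, (i < M)%N -> (n i < L)%N) ->
  (\sum_(m < L) (\sum_(i < M) F i * (n i == m)%:R) * G m = \sum_(i < M) F i * G (n i))%R.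
Proof.
move=> nL; under eq_bigr do rewrite mulr_suml.
rewrite exchange_big/=; apply: eq_bigr => i _.
rewrite (bigD1 (Ordinal (nL _ (ltn_ord i))))//= eqxx mulr1 big1 ?addr0// => m mi.
have /negbTE -> : n i != m by apply: contraNneq mi => h; apply/eqP/val_inj.
by rewrite mulr0 mul0r.
Qed.

Lemma comb_reindex (M L : nat) (n : nat -> nat) (a : nat -> R) :
  (forall i, (i < M)%N -> (n i < L)%N) ->
  (forall i j, (i < M)%N -> (j < M)%N -> n i = n j -> i = j) ->
  exists b : nat -> R, (\sum_(m < L) b m ^+ 2 = \sum_(i < M) a i ^+ 2)%R /\
    comb L b y = comb M a (fun i => y (n i)).
Proof.
move=> nL ninj; pose b m := (\sum_(i < M) a i * (n i == m)%:R)%R.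
have bn i : (i < M)%N -> b (n i) = a i.
  move=> iM; rewrite /b (bigD1 (Ordinal iM))//= eqxx mulr1 big1 ?addr0// => j ji.
  have /negbTE -> : n j != n i by apply: contraNneq ji => /ninj h; apply/eqP/val_inj/h => //;
    exact: ltn_ord.
  by rewrite mulr0.
exists b; split.
  under eq_bigr do rewrite expr2.
  rewrite (@sum_delta M L n a b nL); apply: eq_bigr => i _.
  by rewrite bn// expr2.
by apply/funext => k; rewrite /comb (@sum_delta M L n a (fun m => y m k) nL).
Qed.

Lemma dist_e2_scale (f : nat -> R) (x t : R) :
  D (fun k => e2 x * f k)%R (e2 t) = D f (e2 (t - x)).
Proof. by rewrite dist_scale ?e2_gt0// -e2N -e2D. Qed.

(* p < 2: if the [y n] do not tend to 0 in measure, then the normalised sums of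
   [4 ^ J] almost disjoint terms are unbounded. *)
Lemma flat_lt2 (e : nat) : (q < 2 * r)%R ->
  exists n, D (y n) (e2 (- e%:R)) <= (e2 (- e%:R))%:E.
Proof.
move=> qr; apply: contrapT => /forallNP H.
have {}H n : (e2 (- e%:R))%:E < D (y n) (e2 (- e%:R)) by rewrite ltNge; apply/negP; exact: H.
pose eps : R := e2 (- e%:R); have eps0 : (0 < eps)%R by exact: e2_gt0.
have qr0 : (0 < 2 * r - q)%R by lra.
(* The term of level [-(J + e + 1)] of the normalised sum will be at least
   [2^((2r - q) J) * 2^(-(q + r)(e + 1))]; [J] is large enough for this to exceed [B]. *)
have [J HJ] := e2_unbounded (B * e2 ((q + r) * (e%:R + 1)))%R qr0.
pose M := (4 ^ J)%N; have M1 : (1 <= M%:R :> R)%R by rewrite ler1n expn_gt0.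
have M0 : (0 < M%:R :> R)%R by lra.
have ME : M%:R = e2 (2 * J%:R) :> R by rewrite e2_pow4 /M natrX.
have eta0 : (0 < eps / (4 * M%:R))%R by rewrite divr_gt0// mulr_gt0.
have [n [L [nL [ninj HL]]]] := dist_almost_disjoint_seq q0 r0 nu_lty M eta0 flat_coord_null flat_lty.
have [|//|_ lo] := HL (fun=> 1%R) _ (eps / 2)%R; first by rewrite normr1.
  by rewrite divr_ge0// ltW.
have Meta : (M%:R * (eps / (4 * M%:R)) = eps / 4)%R by field; rewrite gt_eqF.
rewrite -(mulrA 2%R) Meta in lo.
have [b [b1 bE]] := comb_reindex (fun=> e2 (- J%:R)) nL ninj.
have {}b1 : (\sum_(m < L) b m ^+ 2 = 1)%R.
  rewrite b1 sumr_const card_ord -e2X -[LHS]mulr_natl ME -e2D.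
  by rewrite -[RHS]e20; congr e2; ring.
have := le_trans (dterm_le_dnorm q r nu _ (- Posz (J + e.+1))%R) (yB b1).
have f1 : comb M (fun=> e2 (- J%:R)) (fun i => y (n i)) =
    (fun k => e2 (- J%:R) * \sum_(i < M) 1 * y (n i) k)%R.
  by apply/funext => k; rewrite /comb mulr_sumr; apply: eq_bigr => i _; rewrite mul1r.
have kE : (- Posz (J + e.+1))%:~R = (- J%:R + (- e%:R - 1))%R :> R.
  by rewrite rmorphN/= -[(Posz _)%:~R]/((J + e.+1)%:R) natrD -addn1 natrD; ring.
rewrite bE f1 /dterm kE dist_e2_scale addrAC subrr add0r.
have lo' : (M%:R * eps / 2)%:E <= D (fun k => \sum_(i < M) 1 * y (n i) k)%R (e2 (- e%:R - 1)).
  have e2E' : e2 (- e%:R - 1) = (eps / 2)%R by rewrite e2D [e2 (-1)]e2N e21.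
  rewrite e2E' -(leeD2rE _ _ (_ : (2 * (eps / 4))%:E \is a fin_num))//.
  apply: le_trans lo; apply: (@le_trans _ _ (\sum_(i < M) eps%:E)).
    rewrite sumEFin sumr_const card_ord -EFinD lee_fin -[leRHS]mulr_natl.
    have : (eps <= M%:R * eps)%R by rewrite ler_peMl// ltW.
    lra.
  apply: lee_sum => i _; apply: le_trans (ltW (H (n i))) _; apply: dist_le => k.
  by rewrite mul1r; apply: le_lt_trans; rewrite -/eps; lra.
apply/negP; rewrite -ltNge.
apply: (@lt_le_trans _ _ (e2 (q * (- J%:R + (- e%:R - 1))) * (M%:R * eps / 2) `^ r)%:E); last first.
  rewrite EFinM; apply: lee_wpmul2l; first by rewrite lee_fin e2_ge0.
  rewrite -poweR_EFin gt0_ler_poweR ?(ltW r0)// ?in_itv/= ?leey ?andbT ?dist_ge0//.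
  by rewrite lee_fin !mulr_ge0// ltW.
rewrite lte_fin ME /eps -e2D (_ : e2 _ / 2 = e2 (2 * J%:R - e%:R - 1))%R; last first.
  by rewrite [RHS]e2D [e2 (-1)]e2N e21.
rewrite -e2M -e2D -(ltr_pM2r (e2_gt0 ((q + r) * (e%:R + 1)))) -e2D.
apply: lt_le_trans HJ _; rewrite le_eqVlt; apply/orP; left; apply/eqP.
by congr e2; ring.
Qed.

(* p >= 2: split the unit mass of the coefficients evenly over many dyadic levels
   [l]. The average over the cyclic shifts of the coefficients of the distribution
   function at [2^(-e)] is then an average over [l] of [4^l * D (y n) (2^l)], a
   summable quantity up to the power [r]. *)
Lemma flat_ge2 (e : nat) : (2 * r <= q)%R ->
  exists L (a : nat -> R), (\sum_(n < L) a n ^+ 2 = 1)%R /\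
    D (comb L a y) (e2 (- e%:R)) <= (e2 (- e%:R))%:E.
Proof.
move=> rq; pose eps : R := e2 (- e%:R); have eps0 : (0 < eps)%R by exact: e2_gt0.
pose C : R := (4 * 4 ^+ e.+1)%R; have C0 : (0 < C)%R by rewrite mulr_gt0 ?exprn_gt0.
(* Since [2 r <= q], the [r]-th power of [v n k] is at most the dyadic term of level [k >= 0], so
   these powers sum to at most [B]. *)
pose v n k : R := (4 ^+ k * Dr (y n) (Posz k))%R.
have v0 n k : (0 <= v n k)%R by rewrite mulr_ge0 ?Dr_ge0 ?exprn_ge0.
have B0 : (0 <= B)%R by rewrite -lee_fin (le_trans _ (flat_le 0))// dnorm_ge0.
have vr n k : (v n k `^ r <= e2 (q * k%:R) * Dr (y n) (Posz k) `^ r)%R.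
  rewrite powRM ?exprn_ge0 ?Dr_ge0// ler_wpM2r ?powR_ge0//.
  by rewrite -e2_pow4 -e2M ler_e2 mulrAC ler_wpM2r.
have vsum n j K : (\sum_(k < K) v n (j + k)%N `^ r <= B)%R.
  rewrite -lee_fin; apply: le_trans (flat_le n).
  have inj : injective (fun k => Posz (j + k)) by move=> a b [] /addnI.
  apply: le_trans (@esum_int_ge_nat _ (dterm nu q r (y n)) K _ inj (dterm_ge0 q r nu (y n))).
  rewrite -sumEFin; apply: lee_sum => k _.
  by rewrite (dtermE r0 _ (flat_lty n)) lee_fin; exact: vr.
pose V : R := (B `^ r^-1)%R.
have vV n k : (v n k <= V)%R.
  have := vsum n k 1%N; rewrite big_ord1 addn0 => h.
  rewrite -[leLHS]powRr1// -(divff (lt0r_neq0 r0)) powRrM.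
  by apply: powR_le; rewrite ?invr_ge0 ?(ltW r0) ?powR_ge0.
have d0 : (0 < eps / (4 * C))%R by rewrite divr_gt0// mulr_gt0.
have [W W0 HW] := @sum_le_powR R r V (eps / (4 * C)) B r0 d0 (powR_ge0 _ _).
have two0 : (0 < 2 :> R)%R by [].
have [J0 HJ0] := e2_unbounded (W * B * C * 4 / eps)%R two0.
(* With [J = j + e + 1], a coefficient [2^(-(J + l))] observed at height [2^(-(e + 1))] calls for
   the distribution function at [2^(j + l)]. *)
pose J := (J0 + e.+1)%N; pose j := J0.
(* This makes the square sum of the [4^K] coefficients [2^(-(J + lev m))] exactly 1: before the
   factor [4^(-J)], each of the [K] levels contributes 3 and the index 0 contributes 1. *)
have [K KJ] : exists K, (K * 3 + 1 = 4 ^ J)%N.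
  elim: (J) => [|i [K KE]]; first by exists 0%N.
  by exists (4 * K + 1)%N; rewrite expnS -KE; clear; lia.
have K0 : (0 < K)%N.
  rewrite lt0n; apply/eqP => K0; move: KJ; rewrite K0 mul0n add0n /J addnS expnS.
  by clear; lia.
pose M := (4 ^ K)%N.
have [M' ME] : exists M', M = M'.+1.
  by exists M.-1; rewrite prednK// expn_gt0.
have M0 : (0 < M%:R :> R)%R by rewrite ME ltr0Sn.
have eta0 : (0 < eps / 2 / M%:R)%R by rewrite !divr_gt0.
have [n [L [nL [ninj HL]]]] := dist_almost_disjoint_seq q0 r0 nu_lty M eta0 flat_coord_null flat_lty.
pose lev m := trunc_log 4 m.
pose G i m : R := Dr (y (n i)) (Posz (j + lev m)).
(* [C] and [J0] are chosen so that [K * (eps / (4 * C))] and [W * B] are each at most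
   [4^j * eps / 16]. The factor 4 between [eps / 8] and [eps / 2] is the 1 + 3 of
   [sum_trunc_log]. *)
have bound i : (\sum_(m < M) G i m <= eps / 2)%R.
  rewrite (@sum_trunc_log _ (fun l => Dr (y (n i)) (Posz (j + l))) K) addn0.
  have h1 : (\sum_(k < K) 4 ^+ k * Dr (y (n i)) (Posz (j + k)) <=
            (4 ^+ j)^-1 * (K%:R * (eps / (4 * C)) + W * B))%R.
    rewrite ler_pdivlMl ?exprn_gt0// mulr_sumr.
    apply: le_trans (HW K (fun k => v (n i) (j + k)%N) _ (vsum _ _ _)).
      by apply: ler_sum => k _; rewrite mulrA -exprD.
    by move=> k; rewrite v0 vV.
  have h2 : (Dr (y (n i)) (Posz j) <= \sum_(k < K) 4 ^+ k * Dr (y (n i)) (Posz (j + k)))%R.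
    rewrite (bigD1 (Ordinal K0))//= expr0 mul1r addn0 lerDl sumr_ge0// => k _.
    by rewrite mulr_ge0 ?exprn_ge0 ?Dr_ge0.
  have j0 : (0 < 4 ^+ j :> R)%R by rewrite exprn_gt0.
  have h3 : ((4 ^+ j)^-1 * (K%:R * (eps / (4 * C)) + W * B) <= eps / 8)%R.
    have kC : (K%:R * (eps / (4 * C)) <= 4 ^+ j * (eps / 16))%R.
      have KJ' : (K%:R <= 4 ^+ j * 4 ^+ e.+1 :> R)%R.
        by rewrite -exprD -/J -natrX ler_nat -KJ; clear; lia.
      apply: (@le_trans _ _ (4 ^+ j * 4 ^+ e.+1 * (eps / (4 * C)))%R).
        by rewrite ler_wpM2r// ltW.
      rewrite le_eqVlt; apply/orP; left; apply/eqP; rewrite /C; field.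
      by rewrite expf_neq0.
    have WB0 : (0 <= W * B)%R by rewrite mulr_ge0.
    have wC : (W * B <= 4 ^+ j * (eps / 16))%R.
      rewrite e2_pow4 -/j ltr_pdivrMr// in HJ0.
      have : (W * B * 4 <= W * B * C)%R.
        by rewrite ler_wpM2l// /C ler_peMr// exprn_ege1// ler1n.
      lra.
    by rewrite mulrC ler_pdivrMr//; lra.
  apply: le_trans (_ : (_ <= 4 * (eps / 8))%R) _; last by lra.
  have := le_trans h1 h3; lra.
have sum_shift (H : nat -> R) (i : 'I_M'.+1) :
    (\sum_(t < M'.+1) H ((i + t) %% M'.+1)%N = \sum_(m < M'.+1) H m)%R.
  by rewrite [RHS](reindex_inj (@addrI _ i)).
(* For fixed [i] the cyclic shifts visit every position once, so the average over [t] of these sums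
   is at most [eps / 2], and some [t] does no worse. *)
have [t Ht] : exists t : 'I_M'.+1, (\sum_(i < M'.+1) G i ((i + t) %% M'.+1)%N <= eps / 2)%R.
  apply: contrapT => /forallNP Hn.
  have : (\sum_(t < M'.+1) \sum_(i < M'.+1) G i ((i + t) %% M'.+1)%N <= \sum_(i < M'.+1) (eps / 2))%R.
    rewrite exchange_big/=; apply: ler_sum => i _.
    by rewrite sum_shift; have := bound i; rewrite ME.
  apply/negP; rewrite -ltNge; apply: ltr_sum.
    by apply/hasP; exists ord0 => //; rewrite mem_index_enum.
  by move=> t _; rewrite ltNge; apply/negP; exact: Hn.
pose c i : R := e2 (- (lev ((i + t) %% M'.+1)%N + J)%:R).
have [b [b1 bE]] := comb_reindex c nL ninj.
exists L, b; split.
  pose H m : R := e2 (- (J + lev m)%N%:R * 2%:R).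
  transitivity (\sum_(i < M'.+1) H ((t + i) %% M'.+1)%N)%R.
    by rewrite b1 ME; apply: eq_bigr => i _; rewrite /c /H -e2X (addnC t i) (addnC J).
  rewrite (sum_shift H t) -ME /H.
  rewrite (@sum_trunc_log _ (fun l => e2 (- (J + l)%N%:R * 2%:R)) K) addn0.
  have l4 l : (4 ^+ l * e2 (- (J + l)%N%:R * 2%:R) = e2 (- J%:R * 2%:R) :> R)%R.
    by rewrite -e2_pow4 -e2D natrD; congr e2; ring.
  under eq_bigr do rewrite l4.
  rewrite sumr_const card_ord -[X in (_ + _ * X)%R]mulr_natl.
  have -> : (e2 (- J%:R * 2%:R) = (4 ^+ J)^-1 :> R)%R by rewrite mulNr mulrC e2N e2_pow4.
  rewrite -(natrX R 4%N) -KJ natrD natrM; field.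
  by apply: lt0r_neq0; have := ler0n R K; lra.
have c1 i : (`|c i| <= 1)%R.
  by rewrite ger0_norm ?e2_ge0// -e20 ler_e2 oppr_le0.
have [|up _] := HL c c1 (eps / 2)%R; first by rewrite divr_ge0// ltW.
have Meta : (M%:R * (eps / 2 / M%:R) = eps / 2)%R by rewrite mulrCA divff ?mulr1// gt_eqF.
rewrite Meta -splitr in up; rewrite bE; apply: le_trans up _.
rewrite -/eps [X in _ <= X%:E]splitr EFinD; apply: leeD2r.
move: Ht; rewrite -lee_fin -sumEFin ME; apply: le_trans.
apply: lee_sum => i _; rewrite /G -(DrE r0 _ (flat_lty _)).
have -> : (eps / 2)%R = e2 (- e%:R - 1) by rewrite e2D [e2 (-1)]e2N e21.
rewrite /c dist_e2_scale; set x := lev _.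
suff -> : (- e%:R - 1 - - (x + J)%:R = (Posz (j + x))%:~R :> R)%R by [].
rewrite -[RHS]/((j + x)%:R) /J !natrD -addn1 natrD /j; ring.
Qed.

Lemma flat (e : nat) : exists L (a : nat -> R), (\sum_(n < L) a n ^+ 2 = 1)%R /\
    D (comb L a y) (e2 (- e%:R)) <= (e2 (- e%:R))%:E.
Proof.
have [|qr] := (leP (2 * r) q)%R; first exact: flat_ge2.
have [n Hn] := flat_lt2 e qr; have [a [a1 aE]] := comb_single n.
by exists n.+1, a; rewrite aE.
Qed.

End flat_sequence.

End flat.

(** * Sums of combinations taken from several families *)

Section families.
Context {R : realType}.
Variables (nu : {measure set nat -> \bar R}) (q r : R).
Hypotheses (q0 : 0 < q) (r0 : 0 < r).
Hypothesis nu_gt0 : forall k : nat, (0 < nu [set k])%E.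
Hypothesis nu_lty : forall k : nat, (nu [set k] < +oo)%E.
Implicit Types (f g : nat -> R) (y z : nat -> nat -> R) (s t : R).
Local Open Scope ereal_scope.
Local Notation D := (dist nu).
Local Notation N := (dnorm nu q r).
Local Notation Dr := (Dr nu).
Local Notation Nr := (Nr nu q r).

Lemma comb_widen (L L' : nat) (a : nat -> R) y : (L <= L')%N ->
  let b n := (if (n < L)%N then a n else 0)%R in
  (\sum_(n < L') b n ^+ 2 = \sum_(n < L) a n ^+ 2)%R /\ comb L' b y = comb L a y.
Proof.
move=> LL' b.
have sw (G H : nat -> R) : (forall n, (n < L)%N -> G n = H n) ->
    (forall n, (L <= n)%N -> G n = 0)%R -> (\sum_(n < L') G n = \sum_(n < L) H n)%R.
  move=> GH G0; rewrite -(big_mkord xpredT G) (@big_cat_nat _ _ _ L)//=.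
  rewrite [X in (_ + X)%R]big1_seq ?addr0; last first.
    by move=> n /andP[_]; rewrite mem_index_iota => /andP[/G0].
  by rewrite big_mkord; apply: eq_bigr => n _; rewrite GH.
split; [|apply/funext => k].
  by apply: (sw (fun n => b n ^+ 2)%R (fun n => a n ^+ 2)%R) => n; rewrite /b;
    [move=> ->|rewrite leqNgt => /negbTE ->; rewrite expr0n].
by apply: (sw (fun n => b n * y n k)%R (fun n => a n * y n k)%R) => n; rewrite /b;
  [move=> ->|rewrite leqNgt => /negbTE ->; rewrite mul0r].
Qed.

(* Choosing for each [i] a combination of the [y i] small in measure, the sum of
   these [K] almost disjoint vectors is estimated both as an ell_q-sum, by the first
   hypothesis, and directly, by the second one. *)
Theorem lq_of_l2_families (K : nat) (y : nat -> nat -> nat -> R) (c1 C1 c2 C2 : R) :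
  (forall i L (a : nat -> R), (\sum_(n < L) a n ^+ 2 = 1)%R ->
     c1%:E <= N (comb L a (y i)) <= C1%:E) ->
  (forall L (a : nat -> nat -> R),
     (forall i, (i < K)%N -> \sum_(n < L) a i n ^+ 2 = 1)%R ->
     c2%:E <= N (fun k => \sum_(i < K) comb L (a i) (y i) k)%R <= C2%:E) ->
  (K%:R * c1 <= kap q r ^+ 2 * C2 /\ c2 <= kap q r * e2 r * K%:R * C1)%R.
Proof.
move=> h1 h2; have k1 : (1 <= kap q r)%R by exact: kap_ge1.
have k0 : (0 < kap q r)%R by exact: lt_le_trans k1.
have fl i e := flat q0 r0 nu_gt0 nu_lty (fun L a a1 => proj2 (andP (h1 i L a a1))) e.
have /choice[Lf /choice[af Hf]] : forall ie : nat * nat, exists L, exists a : nat -> R,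
    (\sum_(n < L) a n ^+ 2 = 1)%R /\ D (comb L a (y ie.1)) (e2 (- ie.2%:R)) <= (e2 (- ie.2%:R))%:E.
  by move=> [i e]; exact: fl.
pose z i e := comb (Lf (i, e)) (af (i, e)) (y i).
have sz i : small nu (z i) by move=> e; have [_] := Hf (i, e).
have zb i e : c1%:E <= N (z i e) <= C1%:E by apply: h1; have [] := Hf (i, e).
have Nz i e : N (z i e) < +oo.
  by have /andP[_ zC] := zb i e; exact: le_lt_trans zC (ltry _).
have zr i e : (c1 <= Nr (z i e) <= C1)%R.
  by have := zb i e; rewrite (NrE (Nz i e)) !lee_fin.
(* The slack of the almost additive choice is removed here; [t] is divided by the constants that
   multiply it. *)
suff key t : (0 < t)%R -> (K%:R * c1 <= kap q r ^+ 2 * (C2 + t) + t /\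
    c2 <= kap q r * (e2 r * (K%:R * C1) + t + t))%R.
  split; apply/ler_addgt0Pr => t t0.
    have k20 : (0 < kap q r ^+ 2 + 1)%R by rewrite addr_gt0// exprn_gt0.
      have [+ _] := key _ (divr_gt0 t0 k20); rewrite mulrDr -addrA.
    have -> // : (kap q r ^+ 2 * (t / (kap q r ^+ 2 + 1)) + t / (kap q r ^+ 2 + 1) = t)%R.
    by field; rewrite gt_eqF.
  have k20 : (0 < 2 * kap q r)%R by rewrite mulr_gt0.
  have [_] := key _ (divr_gt0 t0 k20).
  have -> // : (kap q r * (e2 r * (K%:R * C1) + t / (2 * kap q r) + t / (2 * kap q r)) =
    kap q r * e2 r * K%:R * C1 + t)%R.
  by field; rewrite gt_eqF.
move=> t0; have [n [F [E [h [FE [NE Et] Fh Fle leF]]]]] :=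
  almost_lq q0 r0 nu_gt0 nu_lty sz Nz K t0.
pose L := (\max_(i < K) Lf (nat_of_ord i, n i))%N.
(* The chosen combinations have different lengths, and are padded with zeros to the common length
   that the second hypothesis requires. *)
pose a' i m := (if (m < Lf (i, n i))%N then af (i, n i) m else 0)%R.
have LL i : (i < K)%N -> (Lf (i, n i) <= L)%N.
  by move=> iK; exact: (leq_bigmax (Ordinal iK)).
have a1 i : (i < K)%N -> (\sum_(m < L) a' i m ^+ 2 = 1)%R.
  move=> iK; have [-> _] := comb_widen (af (i, n i)) (y i) (LL _ iK).
  by have [] := Hf (i, n i).
have NF : N F < +oo by exact: (@dnorm_fin_supp _ _ _ _ q0 r0 nu_lty _ h).
have := h2 L a' a1.
have -> : (fun k => \sum_(i < K) comb L (a' i) (y i) k)%R = (fun k => F k + E k)%R.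
  apply/funext => k; rewrite -FE; apply: eq_bigr => i _.
  by have [_ ->] := comb_widen (af (nat_of_ord i, n i)) (y i) (LL _ (ltn_ord i)).
have NS : N (fun k => F k + E k)%R < +oo by exact: dnormD_lty.
rewrite (NrE NS) !lee_fin => /andP[cS SC].
have NrS := NrD r0 NF NE.
have Ksum : (K%:R * c1 <= \sum_(i < K) Nr (z i (n i)) <= K%:R * C1)%R.
  have Kc (c : R) : (K%:R * c = \sum_(i < K) c)%R by rewrite sumr_const card_ord mulr_natl.
  rewrite !Kc; apply/andP; split; apply: ler_sum => i _; by have /andP[] := zr i (n i).
have /andP[Ks1 Ks2] := Ksum.
have NFS : (Nr F <= kap q r * (C2 + t))%R.
  have NE' : N (fun k => - E k)%R < +oo.
    by apply: le_lt_trans NE; apply: le_dnorm_nat => // k; rewrite normrN.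
  have := NrD r0 NS NE'.
  have -> : (fun k => F k + E k + - E k)%R = F by apply/funext => k; rewrite addrK.
  move=> le; apply: le_trans le _; rewrite ler_wpM2l ?(ltW k0)// lerD//.
  apply: le_trans Et; apply: (Nr_le r0 NE) => k; by rewrite normrN.
split.
  apply: le_trans Ks1 (le_trans leF _); rewrite lerD2r expr2 -mulrA.
  by rewrite ler_wpM2l ?(ltW k0).
apply: le_trans cS (le_trans NrS _); rewrite ler_wpM2l ?(ltW k0)//.
rewrite lerD// (le_trans Fle)// lerD2r ler_wpM2l ?e2_ge0//.
Qed.

End families.

(** * Comparison with the Lorentz norm *)

Section shell_integral.
Context d (T : measurableType d) {R : realType}.
Variables (rho : {measure set T -> \bar R}) (D : set T) (mD : measurable D).
Local Open Scope ereal_scope.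

Lemma emeasurable_nneseries (a : nat -> T -> \bar R) :
  (forall n, measurable_fun D (a n)) -> (forall n x, 0 <= a n x) ->
  measurable_fun D (fun x => \sum_(n <oo) a n x).
Proof. by move=> ma a0; apply: ge0_emeasurable_sum. Qed.

Lemma integral_esum_int (a : int -> T -> \bar R) :
  (forall k, measurable_fun D (a k)) -> (forall k x, 0 <= a k x) ->
  measurable_fun D (fun x => \esum_(k in [set: int]) a k x) /\
  \int[rho]_(x in D) (\esum_(k in [set: int]) a k x) =
  \esum_(k in [set: int]) \int[rho]_(x in D) a k x.
Proof.
move=> ma a0.
have -> : (fun x => \esum_(k in [set: int]) a k x) =
    (fun x => \sum_(n <oo) a (Posz n) x + \sum_(n <oo) a (Negz n) x).
  by apply/funext => x; rewrite esum_int.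
have mP : measurable_fun D (fun x => \sum_(n <oo) a (Posz n) x) by exact: emeasurable_nneseries.
have mN : measurable_fun D (fun x => \sum_(n <oo) a (Negz n) x) by exact: emeasurable_nneseries.
split; first exact: emeasurable_funD.
rewrite ge0_integralD//; last 2 first.
- by move=> x _; exact: nneseries_ge0.
- by move=> x _; exact: nneseries_ge0.
rewrite !integral_nneseries// esum_int// => k; exact: integral_ge0.
Qed.

Variables (q : R) (q0 : (0 < q)%R) (g : T -> \bar R).
Hypotheses (mg : measurable_fun D g) (g0 : forall x, 0 <= g x).

(** A dyadic layer cake: the sum of [2^(q k)] over the levels below [g x] is geometric, hence
    comparable with its largest term and so with the [q]-th power of [g x]. *)
Let h x := \esum_(k in [set: int]) (e2 (q * k%:~R) * (nat_of_bool ((e2 k%:~R)%:E < g x)%E)%:R)%:E.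

Definition gsum : R := fine (\esum_(k in [set: int]) (geom2 q k)%:E).

Lemma gsumE : \esum_(k in [set: int]) (geom2 q k)%:E = gsum%:E.
Proof.
rewrite /gsum fineK// ge0_fin_numE ?esum_geom2_lty// esum_ge0// => k _.
by rewrite lee_fin ltW// geom2_gt0.
Qed.

Lemma gsum_gt0 : (0 < gsum)%R.
Proof.
rewrite -lte_fin -gsumE; apply: lt_le_trans (esum_int_ge 0 _) => /=.
  by rewrite lte_fin geom2_gt0.
by move=> k; rewrite lee_fin ltW// geom2_gt0.
Qed.

Let h_le x : h x <= gsum%:E * g x `^ q.
Proof.
have := g0 x; rewrite le_eqVlt => /predU1P[gx|gx0].
  rewrite -gx poweR0r ?gt_eqF// mule0 /h esum1// => k _.
  by rewrite -gx lte_fin ltNge e2_ge0 mulr0.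
have [->|gx] := eqVneq (g x) +oo.
  by rewrite poweRyr ?gt_eqF// gt0_muley ?leey// lte_fin gsum_gt0.
have [y yE] : exists y, g x = y%:E.
  by exists (fine (g x)); rewrite fineK// gt0_fin_numE// ltey.
rewrite /h yE; rewrite yE lte_fin in gx0.
have [j /andP[jy yj]] := e2_shell gx0.
(* Centred at the shell index [j], the one-sided geometric sum is bounded by the two-sided one,
   whence the constant [gsum]. *)
apply: (@le_trans _ _ ((e2 (q * j%:~R))%:E * \esum_(k in [set: int]) (geom2 q (k - j)%R)%:E)).
  rewrite -esumZl_int ?e2_ge0//; last by move=> k; rewrite lee_fin ltW// geom2_gt0.
  apply: le_esum => k _; rewrite lte_fin lee_fin.
  have [ky|_] := boolP (_ < y)%R; last by rewrite mulr0 mulr_ge0 ?e2_ge0// ltW// geom2_gt0.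
  have kj : (k <= j)%R.
    rewrite leNgt; apply/negP => jk; move: ky; apply/negP; rewrite -leNgt.
    by apply: le_trans yj _; rewrite ler_e2 ler_int; lia.
  rewrite mulr1 /geom2 -e2D ler_e2 -mulrN -mulrDr ler_wpM2l ?(ltW q0)//.
  by rewrite -rmorphN -rmorphD/= ler_int; lia.
rewrite (esum_int_shift (- j) (fun k => (geom2 q k)%:E)) gsumE muleC.
rewrite lee_wpmul2l ?lee_fin ?(ltW gsum_gt0)// mulrC e2M.
by apply: powR_le; rewrite ?(ltW q0) ?e2_ge0 ?(ltW jy).
Qed.

Let g_le x : g x `^ q <= (e2 q)%:E * h x.
Proof.
have t0 k : 0 <= (e2 (q * k%:~R) * (nat_of_bool ((e2 k%:~R)%:E < g x)%E)%:R)%:E.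
  by rewrite lee_fin mulr_ge0 ?e2_ge0.
have h0 : 0 <= h x by apply: esum_ge0.
have := g0 x; rewrite le_eqVlt => /predU1P[<-|gx0].
  by rewrite poweR0r ?gt_eqF// mule_ge0// lee_fin e2_ge0.
have [gx|gx] := eqVneq (g x) +oo.
  suff -> : h x = +oo by rewrite gt0_muley ?leey// lte_fin e2_gt0.
  apply/eq_infty => A; have [j Aj] := e2_unbounded A q0.
  apply: (@le_trans _ _ (e2 (q * j%:R))%:E); first by rewrite lee_fin ltW.
  apply: le_trans (esum_int_ge (Posz j) t0).
  by rewrite gx ltry mulr1.
have [y yE] : exists y, g x = y%:E.
  by exists (fine (g x)); rewrite fineK// gt0_fin_numE// ltey.
rewrite /h yE in t0 *; rewrite yE lte_fin in gx0.
have [j /andP[jy yj]] := e2_shell gx0.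
apply: (@le_trans _ _ ((e2 q)%:E * (e2 (q * j%:~R))%:E)).
  rewrite -EFinM -e2D poweR_EFin lee_fin.
  have -> : (q + q * j%:~R = (j + 1)%:~R * q)%R by rewrite rmorphD/=; ring.
  by rewrite e2M; apply: powR_le; rewrite ?(ltW q0) ?(ltW gx0).
rewrite lee_wpmul2l ?lee_fin ?e2_ge0//; apply: le_trans (esum_int_ge j t0).
by rewrite lte_fin jy mulr1.
Qed.

Let A k := D `&` [set x | (e2 k%:~R)%:E < g x].

Let mA k : measurable (A k).
Proof. exact: emeasurable_fun_o_infty. Qed.

Let memA k x : D x -> (x \in A k) = ((e2 k%:~R)%:E < g x).
Proof. by move=> Dx; apply/idP/idP; rewrite inE /A/=; [case|split]. Qed.

Let hE k : \int[rho]_(x in D) (e2 (q * k%:~R) * (nat_of_bool ((e2 k%:~R)%:E < g x)%E)%:R)%:E =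
  (e2 (q * k%:~R))%:E * rho (A k).
Proof.
transitivity (\int[rho]_(x in D) ((e2 (q * k%:~R))%:E * (\1_(A k) x)%:E)).
  apply: eq_integral => x; rewrite inE => Dx; by rewrite EFinM indicE memA.
rewrite ge0_integralZl_EFin ?e2_ge0//; last first.
  by apply/measurable_EFinP; exact: measurable_indic.
rewrite integral_indic//; congr (_ * rho _).
by rewrite /A setIC setIA setIid.
Qed.

Let mh k : measurable_fun D
  (fun x => (e2 (q * k%:~R) * (nat_of_bool ((e2 k%:~R)%:E < g x)%E)%:R)%:E : \bar R).
Proof.
apply: (@eq_measurable_fun _ _ _ _ _ (fun x => ((e2 (q * k%:~R))%:E * (\1_(A k) x)%:E))).
  move=> x; rewrite inE => Dx; by rewrite EFinM indicE memA.
by apply: measurable_funeM; apply/measurable_EFinP; exact: measurable_indic.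
Qed.

Let t0 k x : 0 <= (e2 (q * k%:~R) * (nat_of_bool ((e2 k%:~R)%:E < g x)%E)%:R)%:E :> \bar R.
Proof. by rewrite lee_fin mulr_ge0 ?e2_ge0. Qed.

Let sumE : \esum_(k in [set: int]) ((e2 (q * k%:~R))%:E * rho (D `&` [set x | (e2 k%:~R)%:E < g x]))
   = \int[rho]_(x in D) h x.
Proof. by rewrite (integral_esum_int mh t0).2; apply: eq_esum => k _; rewrite hE. Qed.

Let mgq : measurable_fun D (fun x => g x `^ q).
Proof. exact: (measurableT_comp (measurable_poweR q)). Qed.

Lemma esum_shell_le :
  \esum_(k in [set: int]) ((e2 (q * k%:~R))%:E * rho (D `&` [set x | (e2 k%:~R)%:E < g x]))
  <= gsum%:E * \int[rho]_(x in D) (g x `^ q).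
Proof.
rewrite sumE -ge0_integralZl_EFin ?(ltW gsum_gt0)//; last by move=> x _; exact: poweR_ge0.
apply: ge0_le_integral => //.
- by move=> x _; apply: esum_ge0.
- exact: (integral_esum_int mh t0).1.
- exact: measurable_funeM.
Qed.

Lemma le_esum_shell : \int[rho]_(x in D) (g x `^ q) <=
  (e2 q)%:E *
  \esum_(k in [set: int]) ((e2 (q * k%:~R))%:E * rho (D `&` [set x | (e2 k%:~R)%:E < g x])).
Proof.
have h0 x : 0 <= h x by apply: esum_ge0.
rewrite sumE -ge0_integralZl_EFin ?e2_ge0//; last exact: (integral_esum_int mh t0).1.
apply: ge0_le_integral => //.
- by move=> x _; exact: poweR_ge0.
- by apply: measurable_funeM; exact: (integral_esum_int mh t0).1.
Qed.

End shell_integral.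

Section lorentz_dyadic.
Context d (T : measurableType d) {R : realType}.
Variables (mu : {measure set T -> \bar R}) (p q : R).
Hypotheses (p0 : 0 < p) (q0 : 0 < q).
Local Open Scope ereal_scope.
Local Notation r := (q / p)%R.
Local Notation rho := (lebesgue_stieltjes_measure (power_cdf r)).

Let r0 : (0 < r)%R. Proof. by rewrite divr_gt0. Qed.

Lemma power_measure_oc (b : R) : (0 <= b)%R -> rho `]0%R, b]%classic = (b `^ r)%:E.
Proof.
move=> b0; rewrite /lebesgue_stieltjes_measure /measure_extension measurable_mu_extE/=;
  last exact: is_ocitv.
rewrite wlength_itv_bnd// /power_cdf maxxx max_l// (gtr0_norm r0) powR0 ?gt_eqF//.
by rewrite subr0.
Qed.

Variable f : {mfun T >-> R}.
Local Notation fs := (rearrangement mu f).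
Local Notation Df := (dist mu f).

Lemma measurable_dist s : measurable [set x | (s < `|f x|)%R].
Proof.
have mh : measurable_fun setT (fun x => `|f x|)%R by exact: measurableT_comp.
have := mh measurableT _ (measurable_itv `]s, +oo[).
by rewrite setTI; congr measurable; apply/seteqP; split=> x /=; rewrite in_itv/= andbT.
Qed.

Lemma rearrangement_ge0 t : 0 <= fs t.
Proof. by apply: le_ereal_inf_tmp => _ [s [s0 _] <-]; rewrite lee_fin ltW. Qed.

(** The converse direction rests on right-continuity of the distribution function: the sets above
    [s + 1/(n+1)] increase to the set above [s], so one of them already has measure more than
    [t]. *)
Lemma rearrangement_gt (s t : R) : (0 < s)%R -> (s%:E < fs t) = (t%:E < Df s).
Proof.
move=> s0; apply/idP/idP => [|tD].
  rewrite !ltNge; apply: contra => Dt; apply: ereal_inf_lbound.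
  by exists s.
pose A n := [set x | (s + n.+1%:R^-1 < `|f x|)%R].
have mA n : measurable (A n) by exact: measurable_dist.
have cv : mu \o A @ \oo --> mu (\bigcup_n A n).
  apply: nondecreasing_cvg_mu => //; first exact: bigcup_measurable.
  apply/nondecreasing_seqP => n; apply/subsetPset => x /=; apply: le_lt_trans.
  by rewrite lerD2l lef_pV2 ?posrE// ler_nat.
have AE : \bigcup_n A n = [set x | (s < `|f x|)%R].
  apply/seteqP; split => [x [n _]|x /= sx].
    by apply: le_lt_trans; rewrite lerDl invr_ge0.
  have [n sn] := ltr_add_invr sx.
  by exists n.
rewrite AE in cv.
have [n tn] : exists n, t%:E < mu (A n).
  apply: contrapT => /forallNP H.
  move: tD; apply/negP; rewrite -leNgt.
  apply: cvge_le cv.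
  by apply: nearW => n /=; rewrite leNgt; apply/negP; exact: H.
apply: (@lt_le_trans _ _ (s + n.+1%:R^-1)%:E).
  by rewrite lte_fin ltrDl invr_gt0.
apply: le_ereal_inf_tmp => _ [s' [s'0 Dt] <-]; rewrite lee_fin leNgt; apply/negP => ss'.
move: tn; apply/negP; rewrite -leNgt; apply: le_trans Dt.
apply: le_measure; rewrite ?inE //; first exact: measurable_dist.
by move=> x /=; exact: lt_trans.
Qed.

Lemma rearrangement_le s t : (s <= t)%R -> fs t <= fs s.
Proof.
move=> st; apply: ereal_inf_le_tmp => _ [x [x0 xs] <-]; exists x => //; split => //.
by apply: le_trans xs _; rewrite lee_fin.
Qed.

Lemma measurable_rearrangement (D : set (measurableTypeR R)) : measurable_fun D fs.
Proof.
move=> mD; apply: (measurability _ (ErealGenOInfty.measurableE R)) => //.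
move=> /= _ [_] [y] -> <-; apply: measurableI => //; apply: is_interval_measurable => s t/=.
rewrite !in_itv/= !andbT => ys yt u /andP[su ut].
by rewrite in_itv/= andbT (lt_le_trans yt)// rearrangement_le.
Qed.

(** By [rearrangement_gt] the set consists of the [t > 0] below [Df s]. For the lower bound an
    interval of half the length suffices, which costs [2^(-r)]; an infinite [Df s] is exhausted by
    bounded intervals. *)
Lemma power_measure_dist s : (0 < s)%R ->
  (e2 (- r))%:E * Df s `^ r <= rho (`]0%R, +oo[%classic `&` [set t | s%:E < fs t]) <= Df s `^ r.
Proof.
move=> s0; set S := _ `&` _.
have SE : S = [set t : R | (0 < t)%R /\ t%:E < Df s].
  by apply/seteqP; split => t; rewrite /S/= in_itv/= andbT rearrangement_gt// => -[].
have mS : measurable S.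
  apply: (@emeasurable_fun_o_infty _ (measurableTypeR R)) => //.
  exact: measurable_rearrangement.
have lo b : (0 <= b)%R -> b%:E < Df s -> (b `^ r)%:E <= rho S.
  move=> b0 bD; rewrite -power_measure_oc//.
  apply: le_measure; rewrite ?inE//.
  move=> t; rewrite SE /= in_itv/= => /andP[t0 tb]; split => //.
  by apply: le_lt_trans bD; rewrite lee_fin.
have D0 : 0 <= Df s by exact: measure_ge0.
case DE : (Df s) (D0) => [c| |]// c0.
- rewrite lee_fin in c0; apply/andP; split.
    move: c0; rewrite le_eqVlt => /predU1P[<-|c0].
      by rewrite poweR0r ?gt_eqF// mule0 measure_ge0.
    apply: le_trans (lo (c / 2)%R _ _); first last.
    + by rewrite DE lte_fin ltr_pdivrMr// ltr_pMr// ltr1n.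
    + by rewrite divr_ge0// ltW.
    rewrite poweR_EFin -EFinM lee_fin powRM ?(ltW c0) ?invr_ge0// mulrC.
    by rewrite e2N /e2 -powRN -(powR_inv1 (ler0n R 2)) -powRrM mulN1r.
  rewrite poweR_EFin -power_measure_oc//.
  apply: le_measure; rewrite ?inE//.
  by move=> t; rewrite SE DE /= in_itv/= lte_fin => -[-> /ltW].
- rewrite poweRyr ?gt_eqF// gt0_muley ?lte_fin ?e2_gt0// leey andbT.
  rewrite leye_eq; apply/eqP/eq_infty => B; have [j Bj] := e2_unbounded B r0.
  apply: le_trans (lo (e2 j%:R) (e2_ge0 _) _); last by rewrite DE ltry.
  by rewrite lee_fin -e2M mulrC ltW.
Qed.

Lemma lorentz_integral_bounds :
  (((gsum (R := R) q)^-1 * e2 (- r))%:E * dnorm mu q r f <=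
    \int[rho]_(t in `]0%R, +oo[%classic) (fs t `^ q)) /\
  \int[rho]_(t in `]0%R, +oo[%classic) (fs t `^ q) <= (e2 q)%:E * dnorm mu q r f.
Proof.
have mfs : measurable_fun (`]0%R, +oo[%classic : set (measurableTypeR R)) fs.
  exact: measurable_rearrangement.
have mD : measurable (`]0%R, +oo[%classic : set (measurableTypeR R)) by [].
have g0 : (0 < gsum (R := R) q)%R by exact: gsum_gt0.
split.
  rewrite EFinM -muleA lee_pdivrMl//; apply: le_trans (esum_shell_le rho mD q0 mfs rearrangement_ge0).
  rewrite /dnorm -esumZl_int ?e2_ge0//; last by move=> k; exact: dterm_ge0.
  apply: le_esum => k _; rewrite /dterm muleCA lee_wpmul2l ?lee_fin ?e2_ge0//.
  by have /andP[] := power_measure_dist (e2_gt0 k%:~R).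
apply: le_trans (le_esum_shell rho mD q0 mfs rearrangement_ge0) _.
rewrite lee_wpmul2l ?lee_fin ?e2_ge0//.
apply: le_esum => k _; rewrite /dterm lee_wpmul2l ?lee_fin ?e2_ge0//.
by have /andP[] := power_measure_dist (e2_gt0 k%:~R).
Qed.

End lorentz_dyadic.

Section lorentz_norm_dyadic.
Context d (T : measurableType d) {R : realType}.
Variables (mu : {measure set T -> \bar R}) (p q : R).
Hypotheses (p0 : 0 < p) (q0 : 0 < q).
Local Open Scope ereal_scope.
Local Notation r := (q / p)%R.

(** A sum rather than a maximum, so that one constant dominates those of both inequalities. *)
Definition dyadic_const : R := (gsum (R := R) q * e2 r + e2 q)%R.

Lemma dyadic_const_gt0 : (0 < dyadic_const)%R.
Proof. by rewrite addr_gt0 ?e2_gt0// mulr_gt0 ?e2_gt0// gsum_gt0. Qed.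

Lemma lorentz_norm_dyadic (f : {mfun T >-> R}) :
  let L := lorentz_norm mu p q (\pi_({mfun_ mu, T >-> R})%qT f) in
  dnorm mu q r f <= dyadic_const%:E * L `^ q /\ L `^ q <= dyadic_const%:E * dnorm mu q r f.
Proof.
move=> L; rewrite /L lorentz_norm_pi -poweRrM mulVf ?gt_eqF// poweRe1; last first.
  by apply: integral_ge0 => t _; exact: poweR_ge0.
have [lo up] := lorentz_integral_bounds mu p0 q0 f.
have g0 : (0 < gsum (R := R) q)%R by exact: gsum_gt0.
have N0 := dnorm_ge0 q r mu f.
split.
  have ge0 : (0 < (gsum (R := R) q)^-1 * e2 (- r))%R by rewrite mulr_gt0 ?e2_gt0// invr_gt0.
  move: lo; rewrite -lee_pdivlMl// => lo; apply: le_trans lo _.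
  rewrite lee_wpmul2r//; first by apply: integral_ge0 => t _; exact: poweR_ge0.
  by rewrite lee_fin invfM invrK e2N invrK lerDl e2_ge0.
apply: le_trans up _; rewrite lee_wpmul2r// lee_fin lerDr.
by rewrite mulr_ge0 ?e2_ge0// ltW.
Qed.

End lorentz_norm_dyadic.

(** * Rademacher functions *)

Section rademacher.
Context {R : realType}.
Implicit Types (a : nat -> R) (s : R).

Lemma sum_double (G : nat -> R) N :
  \sum_(i < N.*2) G i = \sum_(i < N) (G i.*2 + G i.*2.+1).
Proof.
elim: N => [|N ih]; first by rewrite !big_ord0.
by rewrite doubleS !big_ord_recr/= ih addrA.
Qed.

Lemma sum_blocks (G : nat -> R) m N :
  \sum_(i < m * N) G i = \sum_(j < m) \sum_(i < N) G (j * N + i)%N.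
Proof.
elim: m => [|m ih]; first by rewrite mul0n !big_ord0.
rewrite big_ord_recr/= -ih mulSn addnC.
rewrite -(big_mkord xpredT G) (@big_cat_nat _ _ _ (m * N)) ?leq_addr//= big_mkord; congr (_ + _).
by rewrite -{1}[(m * N)%N]add0n big_addn addKn big_mkord; apply: eq_bigr => i _; rewrite addnC.
Qed.

(** The value of a Rademacher sum on the [i]-th dyadic interval of level [L]: the parity of
    [i / 2^(L-n-1)] is the [n]-th binary digit of [i], counted from the most significant one. *)
Definition rad a L i : R := \sum_(n < L) a n * (-1) ^+ (i %/ 2 ^ (L - n.+1))%N.

(** The last binary digit of [i] carries the last coefficient. With powers and exponentials for [F],
    moments follow by induction on [L]. *)
Lemma sum_rad_recr (F : R -> R) a L : \sum_(i < 2 ^ L.+1) F (rad a L.+1 i) =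
  \sum_(i < 2 ^ L) (F (rad a L i + a L) + F (rad a L i - a L)).
Proof.
rewrite expnS mul2n (sum_double (fun i => F (rad a L.+1 i))); apply: eq_bigr => i _.
have half (b : bool) (n : 'I_L) : ((i.*2 + b) %/ 2 ^ (L.+1 - n.+1) = i %/ 2 ^ (L - n.+1))%N.
  rewrite subSS -(@subnSK n L)// expnS divnMA; congr (_ %/ _)%N.
  by rewrite -muln2 divnMDl// (divn_small (_ : (b < 2)%N)) ?addn0//; case: b.
have E (b : bool) : rad a L.+1 (i.*2 + b)%N = rad a L i + a L * (-1) ^+ b.
  rewrite /rad big_ord_recr/= subnn divn1; congr (_ + _ * _).
    by apply: eq_bigr => n _; rewrite half.
  by rewrite exprD -mul2n exprM sqrrN expr1n expr1n mul1r.
have := E false; have := E true; rewrite addn0 addn1 => -> ->.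
by rewrite expr0 expr1 mulr1 mulrN1.
Qed.

Lemma sum_rad2 a L : \sum_(i < 2 ^ L) rad a L i ^+ 2 = 2 ^+ L * \sum_(n < L) a n ^+ 2.
Proof.
elim: L => [|L ih]; first by rewrite expn0 big_ord1 /rad !big_ord0 mulr0 expr0n.
rewrite (sum_rad_recr (fun x => x ^+ 2)) big_ord_recr/=.
under eq_bigr => i _.
  rewrite (_ : _ + _ = 2 * rad a L i ^+ 2 + 2 * a L ^+ 2); last by ring.
  over.
rewrite big_split/= -mulr_sumr ih sumr_const card_ord -[X in _ + X]mulr_natl natrX [2 ^+
  L.+1]exprS; ring.
Qed.

Lemma sum_rad4 a L :
  \sum_(i < 2 ^ L) rad a L i ^+ 4 <= 3 * 2 ^+ L * (\sum_(n < L) a n ^+ 2) ^+ 2.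
Proof.
elim: L => [|L ih]; first by rewrite expn0 big_ord1 /rad !big_ord0 !expr0n/= mulr0.
rewrite (sum_rad_recr (fun x => x ^+ 4)) big_ord_recr/=.
under eq_bigr => i _.
  rewrite (_ : _ + _ = 2 * rad a L i ^+ 4 + 12 * a L ^+ 2 * rad a L i ^+ 2 + 2 * a L ^+ 4); last by ring.
  over.
rewrite !big_split/= -2!mulr_sumr sum_rad2 sumr_const card_ord -[X in _ + X]mulr_natl natrX [2
  ^+ L.+1]exprS.
set A := \sum_(n < L) _ in ih *; set S := \sum_(i < _) _ in ih *.
have P0 : 0 <= 2 ^+ L :> R by rewrite exprn_ge0.
have h4 : 0 <= 4 * 2 ^+ L * a L ^+ 4 by apply: mulr_ge0; [exact: mulr_ge0|exact: exprn_even_ge0].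
rewrite -subr_ge0 in ih; rewrite -subr_ge0.
rewrite (_ : _ - _ = 2 * (3 * 2 ^+ L * A ^+ 2 - S) + 4 * 2 ^+ L * a L ^+ 4); last by ring.
by apply: addr_ge0 => //; exact: mulr_ge0.
Qed.

(** From [exp v <= 1 / (1 - v)] at [u] and [-u] the left side is at most [2 / (1 - u^2)], which for
    [u^2 <= 1/4] is below [2 * (1 + 2 u^2)]. *)
Lemma cosh_le (u : R) : `|u| <= 2^-1 -> expR u + expR (- u) <= 2 * expR (2 * u ^+ 2).
Proof.
move=> u2; have u2' : - 2^-1 <= u <= 2^-1 by rewrite -ler_norml.
have up (v : R) : v < 1 -> expR v <= (1 - v)^-1.
  move=> v1; rewrite -[expR v]invrK -expRN lef_pV2 ?posrE ?expR_gt0 ?subr_gt0//.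
  exact: expR_ge1Dx.
have usq : u ^+ 2 <= 4^-1.
  have -> : 4^-1 = (2^-1) ^+ 2 :> R by rewrite expr2; lra.
  by rewrite -real_normK ?num_real// ler_pXn2r// ?nnegrE.
apply: (@le_trans _ _ ((1 - u)^-1 + (1 + u)^-1)).
  by apply: lerD; [apply: up; lra|rewrite -[X in 1 + X]opprK; apply: up; lra].
have -> : (1 - u)^-1 + (1 + u)^-1 = 2 / (1 - u ^+ 2).
  by field; rewrite !gt_eqF ?andbT//=; try lra; nra.
rewrite ler_pM2l//; apply: le_trans (expR_ge1Dx _).
rewrite -[leLHS]mul1r ler_pdivrMr; last by lra.
have : 0 <= u ^+ 2 by rewrite sqr_ge0.
nra.
Qed.

(** The parameter 1/2 keeps [a n / 2] in the range of [cosh_le] when the coefficients have modulus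
    at most 1. *)
Lemma sum_rad_exp a L : (forall n, (n < L)%N -> `|a n| <= 1) ->
  \sum_(i < 2 ^ L) expR (rad a L i / 2) <= 2 ^+ L * expR ((\sum_(n < L) a n ^+ 2) / 2).
Proof.
elim: L => [|L ih] a1; first by rewrite expn0 big_ord1 /rad !big_ord0 mul0r mul1r.
rewrite (sum_rad_recr (fun x => expR (x / 2))) big_ord_recr/=.
apply: (@le_trans _ _ (\sum_(i < 2 ^ L) expR (rad a L i / 2) * (2 * expR (a L ^+ 2 / 2)))).
  apply: ler_sum => i _; rewrite mulrDl mulrBl !expRD -mulrDr ler_wpM2l ?expR_ge0//.
  have := @cosh_le (a L / 2).
  have -> : 2 * (a L / 2) ^+ 2 = a L ^+ 2 / 2 by field.
  by apply; rewrite normrM [`|2^-1|]ger0_norm ?invr_ge0// ler_piMl ?invr_ge0 ?a1.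
rewrite -mulr_suml [2 ^+ L.+1]exprS (mulrDl (\sum_(i < L) a i ^+ 2)) expRD.
rewrite [leRHS](_ : _ = 2 ^+ L * expR ((\sum_(n < L) a n ^+ 2) / 2) * (2 * expR (a L ^+ 2 / 2)));
  last by ring.
apply: ler_wpM2r; first by rewrite mulr_ge0// expR_ge0.
by apply: ih => n nL; apply: a1; exact: leqW.
Qed.

Definition count_gt a L s : R := \sum_(i < 2 ^ L) (s < `|rad a L i|)%R%:R.

Lemma coef_le1 a L : \sum_(n < L) a n ^+ 2 = 1 -> forall n, (n < L)%N -> `|a n| <= 1.
Proof.
move=> a1 n nL; rewrite -(@ler_pXn2r _ 2)// ?nnegrE// expr1n real_normK ?num_real// -a1.
by rewrite (bigD1 (Ordinal nL))//= lerDl sumr_ge0// => i _; rewrite sqr_ge0.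
Qed.

(** Markov's inequality for the exponential moment, applied to [a] and to its opposite. *)
Lemma rad_tail a L s : \sum_(n < L) a n ^+ 2 = 1 ->
  count_gt a L s <= 2 ^+ L * (2 * expR 2^-1 * expR (- (s / 2))).
Proof.
move=> a1; have half b : (forall n, b n ^+ 2 = a n ^+ 2) ->
    \sum_(i < 2 ^ L) (s < rad b L i)%R%:R <= 2 ^+ L * (expR 2^-1 * expR (- (s / 2))).
  move=> ba; have b1 : \sum_(n < L) b n ^+ 2 = 1 by under eq_bigr do rewrite ba.
  have := sum_rad_exp (coef_le1 b1); rewrite b1 mul1r => h.
  rewrite mulrA expRN ler_pdivlMr ?expR_gt0//; apply: le_trans h.
  rewrite mulr_suml; apply: ler_sum => i _.
  case: ltP => [sr|_]; last by rewrite mul0r expR_ge0.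
  by rewrite mul1r ler_expR ler_wpM2r ?invr_ge0// ltW.
have -> : 2 * expR 2^-1 * expR (- (s / 2)) =
  expR 2^-1 * expR (- (s / 2)) + expR 2^-1 * expR (- (s / 2)) by ring.
rewrite mulrDr; apply: le_trans (lerD (half a (fun=> erefl)) (half (fun n => - a n) (fun=> sqrrN _))).
rewrite -big_split/=; apply: ler_sum => i _.
have -> : rad (fun n => - a n) L i = - rad a L i.
  by rewrite /rad -sumrN; apply: eq_bigr => n _; rewrite mulNr.
rewrite -natrD ler_nat; case: ltP => // sr.
have [|ra] := ltP s (rad a L i) => //.
suff -> : s < - rad a L i by [].
by move: sr; rewrite ltr_normr ltNge ra.
Qed.

(** A Paley-Zygmund argument in pointwise form: [x^2 <= 1/4 + x^4 / 8], plus 2 where [|x| > 1/2].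
    Second moment 1 and fourth moment at most 3 leave [1 - 1/4 - 3/8 = 3/8] for twice the
    frequency. *)
Lemma rad_anticoncentration a L : \sum_(n < L) a n ^+ 2 = 1 ->
  3 / 16 * 2 ^+ L <= count_gt a L 2^-1.
Proof.
move=> a1; have := sum_rad2 a L; rewrite a1 mulr1 => e2L.
have := sum_rad4 a L; rewrite a1 expr1n mulr1 => e4.
have : \sum_(i < 2 ^ L) rad a L i ^+ 2 <=
    \sum_(i < 2 ^ L) (4^-1 + 8^-1 * rad a L i ^+ 4 + 2 * (2^-1 < `|rad a L i|)%R%:R).
  apply: ler_sum => i _; set x := rad a L i.
  have x4 : x ^+ 4 = (x ^+ 2) ^+ 2 by rewrite -exprM.
  case: ltP => [_|x2].
    rewrite x4 mulr1; move: (x ^+ 2) => y; have := sqr_ge0 (y - 4); rewrite !expr2; lra.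
  have : x ^+ 2 <= 4^-1.
    have -> : 4^-1 = (2^-1) ^+ 2 :> R by rewrite expr2; lra.
    by rewrite -real_normK ?num_real// ler_pXn2r// ?nnegrE.
  have := sqr_ge0 (x ^+ 2); rewrite -x4 mulr0 addr0; lra.
rewrite !big_split/= -!mulr_sumr sumr_const card_ord -[X in X + _ + _]mulr_natl natrX.
rewrite -/(count_gt a L 2^-1) e2L; lra.
Qed.

End rademacher.

Section pieces.
Context {R : realType}.
Local Notation mu01 := (lebesgue01 R).

Lemma lebesgue01E (A : set (measurableTypeR R)) :
  mu01 A = lebesgue_measure (A `&` `]0%R, 1%R[%classic).
Proof. by []. Qed.

Definition piece (M : nat) (x : R) : nat := Num.truncn (M%:R * x).

Lemma piece_lt M (x : R) : (0 < M)%N -> 0 < x < 1 -> (piece M x < M)%N.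
Proof.
move=> M0 /andP[x0 x1]; rewrite /piece truncn_lt_nat ?mulr_ge0 ?(ltW x0)//.
by rewrite gtr_pMr// ltr0n.
Qed.

Lemma piece_div M K (x : R) : (0 < K)%N -> 0 <= x -> (piece (M * K) x %/ K)%N = piece M x.
Proof.
move=> K0 x0; apply/esym/truncn_def; set i := piece (M * K) x.
have := @truncn_itv R ((M * K)%:R * x); rewrite mulr_ge0// => /(_ isT).
rewrite -/(piece (M * K) x) -/i => /andP[lo hi].
have K0' : 0 < K%:R :> R by rewrite ltr0n.
rewrite natrM mulrAC in lo hi; apply/andP; split.
  rewrite -(ler_pM2r K0') (le_trans _ lo)// -natrM ler_nat; exact: leq_divM.
rewrite -(ltr_pM2r K0') (lt_le_trans hi)// -natrM ler_nat.
by rewrite -ltn_divLR.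
Qed.

Lemma measurable_piece_le M n : measurable [set x : measurableTypeR R | (piece M x <= n)%N].
Proof.
rewrite (_ : [set _ | _] = [set x | M%:R * x < n.+1%:R]); last first.
  by apply/seteqP; split=> x /=; rewrite /piece truncn_le_nat.
have mf : measurable_fun [set: measurableTypeR R] (fun x : R => M%:R * x).
  exact: mulrl_measurable.
have := mf measurableT _ (measurable_itv `]-oo, n.+1%:R[); rewrite setTI.
by congr measurable; apply/seteqP; split => x /=; rewrite in_itv.
Qed.

Lemma measurable_piece_eq M n : measurable [set x : measurableTypeR R | piece M x = n].
Proof.
case: n => [|n].
  rewrite (_ : [set _ | _] = [set x : measurableTypeR R | (piece M x <= 0)%N]);
    first exact: measurable_piece_le.
  by apply/seteqP; split => x /=; rewrite leqn0 => /eqP.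
rewrite (_ : [set _ | _] = [set x : measurableTypeR R | (piece M x <= n.+1)%N] `\`
   [set x : measurableTypeR R | (piece M x <= n)%N]).
  by apply: measurableD; exact: measurable_piece_le.
apply/seteqP; split => x /=; first by move=> ->; split => //; rewrite ltnn.
by move=> [a /negP]; rewrite -ltnNge => b; apply/eqP; rewrite eqn_leq a b.
Qed.

Lemma measurable_fun_piece M (h : nat -> R) :
  measurable_fun [set: measurableTypeR R] (fun x : R => h (piece M x)).
Proof.
move=> _ B mB; rewrite setTI.
rewrite (_ : _ @^-1` _ = \bigcup_(n in [set n | B (h n)]) [set x : measurableTypeR R | piece M x = n]).
  by apply: bigcup_measurable => n _; exact: measurable_piece_eq.
by apply/seteqP; split => x /=; [move=> Bx; exists (piece M x)|move=> [n /= Bn ->]].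
Qed.

Lemma lebesgue01_piece M i : (i < M)%N ->
  mu01 [set x : R | piece M x = i] = (M%:R^-1)%:E.
Proof.
move=> iM; have M0 : 0 < M%:R :> R by rewrite ltr0n (leq_ltn_trans _ iM).
rewrite lebesgue01E.
have e (x : R) : 0 <= x -> (piece M x = i) <-> (i%:R / M%:R <= x < i.+1%:R / M%:R).
  move=> x0; rewrite ler_pdivrMr// ltr_pdivlMr// ![x * _]mulrC.
  rewrite /piece -(truncn_eq _ (mulr_ge0 (ltW M0) x0)); split; first by move=> ->.
  by move/eqP.
have iM1 : i.+1%:R / M%:R <= 1 :> R by rewrite ler_pdivrMr// mul1r ler_nat.
have i0 : 0 <= i%:R / M%:R :> R by rewrite divr_ge0// ltW.
have li : i%:R / M%:R < i.+1%:R / M%:R :> R by rewrite ltr_pM2r ?invr_gt0// ltr_nat.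
have dE : (i.+1%:R / M%:R - i%:R / M%:R = M%:R^-1 :> R) by rewrite -mulrBl -natrB// subSnn mul1r.
have [i00|i00] := posnP i.
  rewrite (_ : _ `&` _ = `]i%:R / M%:R, i.+1%:R / M%:R[%classic).
    by rewrite lebesgue_measure_itv/= lte_fin li -EFinB dE.
  apply/seteqP; split => x /=; rewrite !in_itv/=.
    by move=> [px /andP[x0 x1]]; have /andP[_ ->] := (e x (ltW x0)).1 px; rewrite i00 mul0r x0.
  move=> /andP[x0 x1]; have xp : 0 < x by exact: le_lt_trans x0.
  by split; [apply/(e x (ltW xp)).2; rewrite (ltW x0) x1|rewrite xp (lt_le_trans x1)].
have i0' : 0 < i%:R / M%:R :> R by rewrite divr_gt0// ltr0n.
rewrite (_ : _ `&` _ = `[i%:R / M%:R, i.+1%:R / M%:R[%classic).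
  by rewrite lebesgue_measure_itv/= lte_fin li -EFinB dE.
apply/seteqP; split => x /=; rewrite !in_itv/=.
  by move=> [px /andP[x0 x1]]; apply/(e x (ltW x0)).1.
move=> /andP[x0 x1]; have xp : 0 < x by exact: lt_le_trans x0.
split; last by rewrite xp (lt_le_trans x1).
by apply/(e x (ltW xp)).2; rewrite x0.
Qed.

Lemma lebesgue01_pieces M (P : pred nat) : (0 < M)%N ->
  mu01 [set x : R | P (piece M x)] = (M%:R^-1 * \sum_(i < M) (P i)%:R)%:E.
Proof.
move=> M0; pose A i := if P i then [set x : measurableTypeR R | piece M x = i] else set0.
have mA i : measurable (A i).
  by rewrite /A; case: ifP => // _; exact: measurable_piece_eq.
transitivity (mu01 (\big[setU/set0]_(i < M) A i)).
  rewrite -bigcup_mkord !lebesgue01E; congr (lebesgue_measure _).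
  apply/seteqP; split => x /= [h x01]; split => //; rewrite in_itv/= in x01.
    by exists (piece M x); [exact: piece_lt|rewrite /A h].
  by move: h => [i _]; rewrite /A; case: ifP => // Pi /= ->.
rewrite measure_semi_additive_ord_I//; last 2 first.
- move=> i j _ _ [x [Ax Bx]]; move: Ax Bx; rewrite /A.
  by case: ifP => // _ /= <-; case: ifP => // _ /= <-.
- by apply: bigsetU_measurable => i _; exact: mA.
transitivity (\sum_(i < M) (M%:R^-1 * (P i)%:R : R)%:E)%E.
  apply: eq_bigr => i _; rewrite /A; case: ifP => _; last by rewrite measure0 mulr0.
  by rewrite mulr1; exact: lebesgue01_piece.
by rewrite sumEFin -mulr_sumr.
Qed.

(* [rfun m j n] is the n-th Rademacher function of the j-th of the [m] equal
   pieces of (0, 1). *)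
Definition rfun (m j n : nat) (x : measurableTypeR R) : R :=
  (piece m x == j)%:R * (-1) ^+ (piece (m * 2 ^ n.+1) x).

Lemma measurable_rfun m j n : measurable_fun setT (rfun m j n).
Proof.
apply: measurable_funM; first exact: (measurable_fun_piece m (fun i => (i == j)%:R)).
exact: (measurable_fun_piece (m * 2 ^ n.+1) (fun i => (-1) ^+ i)).
Qed.

HB.instance Definition _ m j n := isMeasurableFun.Build _ _ _ _ (rfun m j n) (measurable_rfun m j n).

Definition rcomb (m L : nat) (a : nat -> nat -> R) (x : R) : R :=
  \sum_(j < m) \sum_(n < L) a j n * rfun m j n x.

Lemma rcombE m L a x : (0 < m)%N -> 0 < x < 1 -> let i := piece (m * 2 ^ L) x in
  rcomb m L a x = rad (a (i %/ 2 ^ L)%N) L (i %% 2 ^ L)%N.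
Proof.
move=> m0 x01 i; have x0 : 0 <= x by case/andP: x01 => /ltW.
have pm : piece m x = (i %/ 2 ^ L)%N by rewrite piece_div// expn_gt0.
have jm : (piece m x < m)%N by exact: piece_lt.
rewrite /rcomb (bigD1 (Ordinal jm))//= [X in _ + X]big1 ?addr0; last first.
  move=> j ji; apply: big1 => n _; rewrite /rfun.
  have /negbTE -> : piece m x != j by apply: contraNneq ji => h; apply/eqP/val_inj.
  by rewrite mul0r mulr0.
rewrite /rad -pm; apply: eq_bigr => n _; congr (_ * _).
rewrite /rfun eqxx mul1r.
have -> : piece (m * 2 ^ n.+1) x = (i %/ 2 ^ (L - n.+1))%N.
  rewrite -(@piece_div _ (2 ^ (L - n.+1))) ?expn_gt0// -mulnA -expnD subnKC//.
(* The offset of the piece is a multiple of [2^(n+1)], hence even, and does not affect the sign. *)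
have -> : (i %/ 2 ^ (L - n.+1) = piece m x * 2 ^ n.+1 + i %% 2 ^ L %/ 2 ^ (L - n.+1))%N.
  rewrite {1}(divn_eq i (2 ^ L)) -pm -{1}(@subnKC n.+1 L)// expnD mulnA.
  by rewrite divnMDl// expn_gt0.
by rewrite exprD expnS mulnCA exprM sqrrN expr1n expr1n mul1r.
Qed.

Lemma dist_rcomb m L a s : (0 < m)%N ->
  dist mu01 (rcomb m L a) s = ((m%:R * 2 ^+ L)^-1 * \sum_(j < m) count_gt (a j) L s)%:E.
Proof.
move=> m0; have M0 : (0 < m * 2 ^ L)%N by rewrite muln_gt0 m0 expn_gt0.
pose P i := (s < `|rad (a (i %/ 2 ^ L)%N) L (i %% 2 ^ L)%N|)%R.
transitivity (mu01 [set x : R | P (piece (m * 2 ^ L) x)]).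
  rewrite /dist !lebesgue01E; congr (lebesgue_measure _).
  by apply/seteqP; split => x /= [h x01]; split => //; move: h; rewrite in_itv/= in x01;
    rewrite /P rcombE.
rewrite lebesgue01_pieces// natrM natrX; congr (_ * _)%:E.
rewrite (sum_blocks (fun i => (P i)%:R)); apply: eq_bigr => j _; apply: eq_bigr => i _.
by rewrite /P divnMDl ?expn_gt0// divn_small ?addn0// modnMDl modn_small.
Qed.

End pieces.

Section rcomb_norm.
Context {R : realType}.
Local Open Scope ereal_scope.

(** Tail decay of order [n] with [n * r > q] makes the levels [k >= 0] decay geometrically; for
    [k < 0] the factor [2^(q k)] does. The slower rate is used on both sides. The power [t^r] is
    factored out because the order in [t] is what later separates [p] from [q]. *)
Lemma dnorm_le_tail d (T : measurableType d) (mu : set T -> \bar R) (q r : R)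
    (f : T -> R) (n : nat) (E t : R) :
  (0 < q)%R -> (0 < r)%R -> (q < n%:R * r)%R -> (0 <= E)%R -> (0 <= t)%R ->
  (forall k : int, 0 <= dist mu f (e2 k%:~R) <= t%:E) ->
  (forall k : nat, dist mu f (e2 k%:R) <= (t * (E * e2 (- (k%:R * n%:R))))%:E) ->
  dnorm mu q r f <= ((1 + E `^ r) * gsum (R := R) (Num.min q (n%:R * r - q)) * t `^ r)%:E.
Proof.
move=> q0 r0 qn E0 t0 ft fE; set s := Num.min _ _.
have s0 : (0 < s)%R by rewrite lt_min q0 subr_gt0.
have Er0 : (0 <= E `^ r)%R by exact: powR_ge0.
have sq : (s <= q)%R by rewrite ge_min lexx.
have snq : (s <= n%:R * r - q)%R by rewrite ge_min lexx orbT.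
have C0 : (0 <= (1 + E `^ r) * t `^ r)%R by rewrite mulr_ge0 ?powR_ge0 ?addr_ge0.
rewrite mulrAC EFinM -(gsumE s0).
rewrite -(@esumZl_int R _ (fun k => (geom2 s k)%:E)) => [|k|//]; last by rewrite lee_fin ltW// geom2_gt0.
apply: le_esum => k _; rewrite /dterm -EFinM.
have p (b : R) : (0 <= b)%R -> dist mu f (e2 k%:~R) <= b%:E -> dist mu f (e2 k%:~R) `^ r <= (b `^ r)%:E.
  move=> b0 fb; rewrite -poweR_EFin gt0_ler_poweR ?(ltW r0)// in_itv/= ?leey ?andbT//.
  by have /andP[] := ft k.
case: k p => [k|k] p.
  have te0 : (0 <= t * (E * e2 (- (k%:R * n%:R))))%R by rewrite !mulr_ge0// e2_ge0.
  apply: (@le_trans _ _ ((e2 (q * k%:R))%:E * ((t * (E * e2 (- (k%:R * n%:R)))) `^ r)%:E)).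
    by rewrite lee_wpmul2l ?lee_fin ?e2_ge0// p// fE.
  rewrite -EFinM lee_fin powRM ?mulr_ge0 ?e2_ge0// powRM ?e2_ge0//.
  rewrite [leLHS](_ : _ = E `^ r * t `^ r * (e2 (q * k%:R) * e2 (- (k%:R * n%:R)) `^ r))%R; last by ring.
  apply: ler_pM.
  - by rewrite mulr_ge0 ?powR_ge0.
  - by rewrite mulr_ge0 ?powR_ge0 ?e2_ge0.
  - by rewrite ler_wpM2r ?powR_ge0// lerDr.
  - rewrite /geom2 -e2M -e2D ler_e2 -[(`|Posz k|)%:~R]/(k%:R).
    have k0 : (0 <= k%:R :> R)%R by [].
    have : (s * k%:R <= (n%:R * r - q) * k%:R)%R by rewrite ler_wpM2r.
    lra.
have /andP[_ ftk] := ft (Negz k).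
apply: (@le_trans _ _ ((e2 (q * (Negz k)%:~R))%:E * (t `^ r)%:E)).
  by rewrite lee_wpmul2l ?lee_fin ?e2_ge0// p.
rewrite -EFinM lee_fin [leLHS]mulrC; apply: ler_pM; rewrite ?powR_ge0 ?e2_ge0//.
  by rewrite ler_peMl ?powR_ge0// lerDl.
rewrite /geom2 ler_e2 NegzE -[(`|- _|)%:~R]/(k.+1%:R) rmorphN/= mulrN lerN2.
by rewrite ler_wpM2r.
Qed.

(** From [1 + x <= exp x] at [x = s / (2 n)], raised to the power [n]. *)
Lemma expR_tail (n : nat) (s : R) : (0 < n)%N -> (0 < s)%R ->
  (expR (- (s / 2)) <= (2 * n%:R) ^+ n / s ^+ n)%R.
Proof.
move=> n0 s0; have n0' : (0 < n%:R :> R)%R by rewrite ltr0n.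
rewrite expRN -[leRHS]invrK lef_pV2 ?posrE ?expR_gt0 ?invr_gt0 ?divr_gt0 ?exprn_gt0 ?mulr_gt0//.
rewrite invf_div -expr_div_n.
have -> : (s / 2 = s / (2 * n%:R) *+ n)%R.
  by rewrite -[RHS]mulr_natr; field; rewrite gt_eqF.
rewrite -[X in expR X]mulr_natl expRM_natl.
rewrite ler_pXn2r ?nnegrE ?expR_ge0 ?divr_ge0 ?mulr_ge0 ?(ltW s0)//.
by apply: le_trans (expR_ge1Dx _); rewrite lerDr.
Qed.

(** Only the measure [t] of the pieces marked by [J] enters; the constants are uniform in [m], [L]
    and [a]. From below the single level [2^(-1)] is enough, by anticoncentration; from above the
    exponential tail is traded for a power [n] with [n * r > q]. *)
Lemma rcomb_bounds (q r : R) : (0 < q)%R -> (0 < r)%R ->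
  exists c C : R, (0 < c)%R /\ (0 < C)%R /\
  forall (m L : nat) (a : nat -> nat -> R) (J : pred nat), (0 < m)%N ->
    (forall j, (j < m)%N -> J j -> \sum_(n < L) a j n ^+ 2 = 1)%R ->
    (forall j, (j < m)%N -> ~~ J j -> forall n, (n < L)%N -> a j n = 0)%R ->
    let t := (m%:R^-1 * \sum_(j < m) (J j)%:R)%R in
    (c * t `^ r)%:E <= dnorm (lebesgue01 R) q r (rcomb m L a) <= (C * t `^ r)%:E.
Proof.
move=> q0 r0; pose n := (Num.bound (q / r)).+1.
have qn : (q < n%:R * r)%R.
  rewrite -ltr_pdivrMr//; apply: lt_le_trans (archi_boundP _) _; first by rewrite divr_ge0// ltW.
  by rewrite ler_nat leqnSn.
pose E : R := (2 * expR 2^-1 * (2 * n%:R) ^+ n)%R.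
have E0 : (0 <= E)%R.
  by rewrite /E; apply: mulr_ge0; [rewrite mulr_ge0 ?expR_ge0|rewrite exprn_ge0 ?mulr_ge0].
have s0 : (0 < Num.min q (n%:R * r - q))%R by rewrite lt_min q0 subr_gt0.
exists (e2 (- q) * (3 / 16) `^ r)%R, ((1 + E `^ r) * gsum (R := R) (Num.min q (n%:R * r - q)))%R.
split; first by rewrite mulr_gt0 ?e2_gt0// powR_gt0.
split; first by rewrite mulr_gt0 ?gsum_gt0// ltr_wpDr ?powR_ge0.
move=> m L a J m0 aJ aN; cbv zeta; set t := (m%:R^-1 * _)%R.
have m0' : (0 < m%:R :> R)%R by rewrite ltr0n.
have L0 : (0 < 2 ^+ L :> R)%R by rewrite exprn_gt0.
have t0 : (0 <= t)%R by rewrite mulr_ge0 ?invr_ge0// sumr_ge0.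
have cgt0 j s : (j < m)%N -> ~~ J j -> (0 <= s)%R -> count_gt (a j) L s = 0%R.
  move=> jm Jj s0'; rewrite /count_gt big1// => i _.
  suff -> : rad (a j) L i = 0%R by rewrite normr0 ltNge s0'.
  by rewrite /rad big1// => k _; rewrite (aN j)// mul0r.
have distE s : dist (lebesgue01 R) (rcomb m L a) s =
    (m%:R^-1 * \sum_(j < m) (count_gt (a j) L s / 2 ^+ L))%:E%R.
  by rewrite dist_rcomb// invfM -mulrA -mulr_suml (mulrC (_ ^-1)%R (\sum_(_ < _) _)%R).
have up (b s : R) : (0 <= s)%R -> (0 <= b)%R -> (forall j, (j < m)%N -> J j -> count_gt (a j)
  L s <= 2 ^+ L * b)%R ->
    dist (lebesgue01 R) (rcomb m L a) s <= (t * b)%:E.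
  move=> s0' b0 H; rewrite distE lee_fin /t -mulrA ler_wpM2l ?invr_ge0// mulr_suml.
  apply: ler_sum => j _; have [Jj|Jj] := boolP (J j).
    by rewrite mul1r ler_pdivrMr// mulrC H.
  by rewrite cgt0// !mul0r.
apply/andP; split.
  apply: le_trans (dterm_le_dnorm q r _ _ (-1)).
  rewrite /dterm -mulrA EFinM.
  have -> : (q * (-1)%:~R = - q :> R)%R by rewrite rmorphN/= mulrN1.
  rewrite lee_wpmul2l ?lee_fin ?e2_ge0// -powRM//.
  rewrite -poweR_EFin gt0_ler_poweR ?(ltW r0)// ?in_itv/= ?leey ?andbT ?lee_fin ?mulr_ge0//.
    by rewrite sumr_ge0.
  have -> : e2 (-1)%:~R = 2^-1%R :> R by rewrite rmorphN/= e2N e21.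
  rewrite distE lee_fin /t mulrCA ler_wpM2l ?invr_ge0// mulr_sumr.
  apply: ler_sum => j _; rewrite ler_pdivlMr//; have [Jj|Jj] := boolP (J j).
    by rewrite mulr1; apply: rad_anticoncentration; exact: aJ.
  by rewrite mulr0 mul0r cgt0// invr_ge0.
apply: dnorm_le_tail => //.
- move=> k; rewrite distE lee_fin mulr_ge0 ?invr_ge0//=; last first.
    by apply: sumr_ge0 => j _; rewrite divr_ge0 ?exprn_ge0// sumr_ge0.
  rewrite -distE -[t]mulr1; apply: up => //; first exact: e2_ge0.
  move=> j jm Jj; rewrite mulr1 /count_gt -natrX.
  have -> : ((2 ^ L)%:R = \sum_(i < 2 ^ L) 1 :> R)%R by rewrite sumr_const card_ord.
  by apply: ler_sum => i _; case: (_ < _)%R.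
- move=> k; apply: up; [exact: e2_ge0|by rewrite mulr_ge0 ?e2_ge0|].
  move=> j jm Jj; apply: le_trans (rad_tail _ (aJ _ jm Jj)) _.
  rewrite ler_wpM2l ?(ltW L0)// /E -[leRHS]mulrA ler_wpM2l ?mulr_ge0 ?expR_ge0//.
  apply: le_trans (@expR_tail n (e2 k%:R) (ltn0Sn _) (e2_gt0 _)) _.
  by rewrite e2N e2X.
Qed.

End rcomb_norm.

(** * Functions on a purely atomic space as sequences *)

Section mkmfun.
Context d (T : measurableType d) {R : realType}.

Definition mkmfun (f : T -> R) (mf : measurable_fun setT f) : {mfun T >-> R} :=
  mfun_Sub (mem_set mf).

Lemma dist_ae_eq (mu : {measure set T -> \bar R}) (f g : {mfun T >-> R}) :
  f = g %[ae mu] -> dist mu f = dist mu g.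
Proof.
move=> fg; apply/funext => s.
have le (h k : {mfun T >-> R}) : h = k %[ae mu] -> (dist mu h s <= dist mu k s)%E.
  move=> -[N [mN N0 hkN]]; rewrite /dist -[leRHS](measureU0 (measurable_dist k s) mN N0).
  apply: le_measure; rewrite ?inE//; [exact: measurable_dist|apply: measurableU => //;
    exact: measurable_dist|].
  move=> x /= shx; have [xN|xN] := pselect (N x); first by right.
  left; have <- // : h x = k x.
  by apply: contrapT => hk; apply/xN/hkN => /= /(_ I).
by apply/eqP; rewrite eq_le !le//; exact: ae_eq_sym.
Qed.

End mkmfun.

Section atoms_to_nat.
Context d (T : measurableType d) {R : realType}.
Variables (mu : {measure set T -> \bar R}) (A : nat -> set T).
Hypotheses (hmu : purely_atomic mu) (hA : atoms_are mu A).
Hypothesis hfin : forall n, (mu (A n) < +oo)%E.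
Local Open Scope ereal_scope.

Let mA n : measurable (A n). Proof. by have [h _ _] := hA; have [] := h n. Qed.

Let A' := seqDU A.

Let mA' n : measurable (A' n). Proof. exact: seqDU_measurable. Qed.

Definition nonatomic_part := ~` \bigcup_n A n.
Local Notation Z := nonatomic_part.

Let mZ : measurable Z. Proof. by apply: measurableC; exact: bigcup_measurable. Qed.

(** If the part outside all [A n] had positive measure it would contain an atom, which would agree
    up to a null set with some [A n] although disjoint from it. *)
Let Z0 : mu Z = 0.
Proof.
apply/eqP; rewrite -measure_le0 leNgt; apply/negP => /(hmu mZ)[B aB BZ].
have [mB B0 _] := aB.
have [_ _ /(_ B aB)[n Bn]] := hA.
move: B0; rewrite -Bn ltNge => /negP; apply; apply: le_measure; rewrite ?inE//.
  by apply: measurableU; apply: measurableD.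
by move=> x Bx; left; split => // Ax; apply: (BZ x Bx); exists n.
Qed.

(** The default 0 puts the null set outside all [A n] into cell 0, so that the index map is total
    and cells differ from atoms by null sets only. *)
Definition atom_index (x : T) : nat := xget 0%N [set n | A' n x].
Local Notation phi := atom_index.

Definition atom_cell n := phi @^-1` [set n].
Local Notation D := atom_cell.

Let phiA n x : A' n x -> phi x = n.
Proof.
move=> Anx; rewrite /phi; case: xgetP => [m _ Amx|/(_ n)//].
by apply: (@trivIset_seqDU _ A m n I I); exists x.
Qed.

Let phiZ x : Z x -> phi x = 0%N.
Proof.
move=> Zx; rewrite /phi; case: xgetP => // m _ Amx.
by exfalso; apply: Zx; exists m => //; exact: subset_seqDU Amx.
Qed.

Let cover x : Z x \/ exists n, A' n x.
Proof.
have [Zx|] := pselect (Z x); first by left.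
rewrite /Z => /contrapT; rewrite (seqDU_bigcup_eq A) => -[n _ An]; right; by exists n.
Qed.

Let DE n : D n = if n == 0%N then A' n `|` Z else A' n.
Proof.
apply/seteqP; split => x /=.
  rewrite /D/= => xn; have [Zx|[m Am]] := cover x.
    by rewrite -xn (phiZ Zx) eqxx; right.
  by have := phiA Am; rewrite xn => nm; rewrite nm; case: ifP => _ //; left.
case: ifP => [/eqP n0|_]; last exact: phiA.
by move=> [/phiA//|/phiZ xn]; rewrite /D/= xn n0.
Qed.

Let mD n : measurable (D n).
Proof. by rewrite DE; case: ifP => // _; exact: measurableU. Qed.

Lemma measurable_atom_index : measurable_fun setT phi.
Proof.
move=> _ B _; rewrite setTI (_ : phi @^-1` B = \bigcup_(n in B) D n).
  by apply: bigcup_measurable => n _; exact: mD.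
by apply/seteqP; split => x /=; [move=> Bx; exists (phi x)|move=> [n Bn /= ->]].
Qed.

Let overlap0 n : mu.-negligible (A n `\` A' n).
Proof.
have [_ dA _] := hA.
apply: (@negligibleS _ _ _ mu (\bigcup_k if (k < n)%N then A k `&` A n else set0) _).
  move=> x [Anx]; rewrite /A' /seqDU /= => /not_andP[//|/contrapT].
  by rewrite -bigcup_mkord => -[k /= kn Ak]; exists k => //; rewrite kn.
apply: negligible_bigcup => k; case: ifP => kn; last exact: negligible_set0.
apply/negligibleP; first exact: measurableI.
by apply: dA => e; rewrite e ltnn in kn.
Qed.

Let negZ : mu.-negligible Z. Proof. exact/negligibleP. Qed.

Let DA n : mu.-negligible (A n `\` D n) /\ mu.-negligible (D n `\` A n).
Proof.
have AD : A' n `<=` D n by move=> x A'x; rewrite DE; case: ifP => // _; left.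
split.
  by apply: (negligibleS _ (overlap0 n)) => x [Ax Dx]; split => // /AD.
apply: (negligibleS _ negZ) => x []; rewrite DE; case: ifP => _.
  by case=> // /(@subset_seqDU _ A n x).
by move=> /(@subset_seqDU _ A n x).
Qed.

Let muD n : mu (D n) = mu (A n).
Proof.
have [AD DA'] := DA n.
have le (B C : set T) : measurable B -> measurable C -> mu.-negligible (B `\` C) -> mu B <= mu C.
  move=> mB mC /negligibleP BC; have mBC : measurable (B `\` C) by exact: measurableD.
  rewrite -[leRHS](measureU0 mC mBC (BC mBC)); apply: le_measure; rewrite ?inE//;
    first exact: measurableU.
  by move=> x Bx; have [|] := pselect (C x); [left|right].
by apply/eqP; rewrite eq_le !le.
Qed.

Let mpre (B : set nat) : measurable (phi @^-1` B).
Proof. by rewrite -[X in measurable X]setTI; apply: measurable_atom_index. Qed.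

Definition atom_measure (B : set nat) : \bar R := mu (phi @^-1` B).

Let atom_measure0 : atom_measure set0 = 0.
Proof. by rewrite /atom_measure preimage_set0 measure0. Qed.

Let atom_measure_ge0 B : 0 <= atom_measure B.
Proof. exact: measure_ge0. Qed.

Let atom_measure_sigma_additive : semi_sigma_additive atom_measure.
Proof.
move=> F mF tF mUF; rewrite /atom_measure preimage_bigcup.
apply: measure_semi_sigma_additive => //.
  apply/trivIsetP => /= i j _ _ ij; rewrite -preimage_setI.
  by move/trivIsetP : tF => /(_ _ _ _ _ ij) ->//; rewrite preimage_set0.
by rewrite -preimage_bigcup.
Qed.

HB.instance Definition _ := isMeasure.Build _ _ _
  atom_measure atom_measure0 atom_measure_ge0 atom_measure_sigma_additive.

Lemma atom_measure_gt0 n : 0 < atom_measure [set n].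
Proof. by have [h _ _] := hA; have [_ + _] := h n; rewrite -muD. Qed.

Lemma atom_measure_lty n : atom_measure [set n] < +oo.
Proof. by have := hfin n; rewrite -muD. Qed.

Lemma measurable_lift (y : nat -> R) : measurable_fun setT (fun x => y (phi x)).
Proof. by move=> _ B _; rewrite setTI; exact: (mpre (y @^-1` B)). Qed.

Definition atom_lift (y : nat -> R) : {mfun T >-> R} := mkmfun (measurable_lift y).

Let zero_one n B : measurable B -> B `<=` D n -> mu.-negligible B \/ mu.-negligible (D n `\` B).
Proof.
move=> mB BD; have [h _ _] := hA; have [_ _ hn] := h n; have [AD DA'] := DA n.
have mBA : measurable (B `&` A n) by exact: measurableI.
have [B0|B0] := hn _ mBA (@subIsetr _ _ _).
  left; apply: (@negligibleS _ _ _ mu ((B `&` A n) `|` (D n `\` A n)) _).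
    by move=> x Bx; have [|] := pselect (A n x); [left|right; split => //; exact: BD].
  by apply: negligibleU => //; exact/negligibleP.
right; apply: (@negligibleS _ _ _ mu ((A n `\` (B `&` A n)) `|` (D n `\` A n)) _).
  move=> x [Dx Bx]; have [Ax|Ax] := pselect (A n x); last by right.
  by left; split => // -[].
by apply: negligibleU => //; apply/negligibleP => //; exact: measurableD.
Qed.

(** The constant is the essential supremum of [f] on the cell. By [zero_one], for each [c] either
    [f <= c] or [f > c] holds almost everywhere there, so the points where [f] misses the infimum of
    the admissible [c] are covered by countably many null sets. *)
Let const_on_cell (f : {mfun T >-> R}) n :
  exists c : R, mu.-negligible (D n `&` [set x | f x <> c]).
Proof.
have mf (c : R) : measurable [set x | (c < f x)%R].
  have := measurable_funPT f measurableT (`]c, +oo[%classic : set R) (measurable_itv _); rewrite setTI.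
  by congr measurable; apply/seteqP; split => x /=; rewrite in_itv/= andbT.
have mDf c : measurable (D n `&` [set x | (c < f x)%R]) by exact: measurableI.
have Dn0 : ~ mu.-negligible (D n).
  move=> /negligibleP => /(_ (mD n)) h; have := atom_measure_gt0 n.
  by rewrite /atom_measure -/(D n) h ltxx.
pose S := [set c : R | mu.-negligible (D n `&` [set x | (c < f x)%R])].
have Sup c : ~ S c -> mu.-negligible (D n `&` [set x | (f x <= c)%R]).
  move=> Sc; have [//|h] := zero_one (mDf c) (@subIsetl _ _ _).
  by apply: (negligibleS _ h) => x [Dx /= fc]; split => // -[_] /=; rewrite ltNge fc.
have Smono c c' : S c -> (c <= c')%R -> S c'.
  move=> Sc cc'; apply: (negligibleS _ Sc) => x [Dx /= fx]; split => //=.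
  exact: le_lt_trans fx.
(* If no [c] were admissible, or arbitrarily negative ones were, the cell would be a countable union
   of null sets. *)
have S_ne : S !=set0.
  apply: contrapT => S0; apply: Dn0.
  apply: (@negligibleS _ _ _ mu (\bigcup_k (D n `&` [set x | (f x <= k%:R)%R])) _).
    move=> x Dx; exists (Num.bound `|f x|) => //; split => //=.
    by rewrite (le_trans (ler_norm _))// ltW// archi_boundP.
  apply: negligible_bigcup => k; apply: Sup => Sk.
  by apply: S0; exists k%:R%R.
have S_lb : has_lbound S.
  apply: contrapT => nlb; apply: Dn0.
  apply: (@negligibleS _ _ _ mu (\bigcup_k (D n `&` [set x | (- k%:R < f x)%R])) _).
    move=> x Dx; exists (Num.bound `|f x|).+1 => //; split => //=.
    rewrite ltrNl; apply: (@le_lt_trans _ _ `|f x|%R); first by rewrite -normrN ler_norm.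
    by apply: (lt_trans (archi_boundP _)) => //; rewrite ltr_nat.
  apply: negligible_bigcup => k; apply: contrapT => Sk; apply: nlb.
  exists (- k%:R)%R => c Sc; rewrite leNgt; apply/negP => ck; apply: Sk.
  exact: Smono Sc (ltW ck).
exists (inf S).
apply: (@negligibleS _ _ _ mu (\bigcup_k
  (D n `&` [set x | (inf S + k.+1%:R^-1 < f x)%R]) `|`
  \bigcup_k (D n `&` [set x | (f x <= inf S - k.+1%:R^-1)%R])) _).
  move=> x [Dx /= /eqP]; rewrite neq_lt => /orP[fx|fx].
    have [k hk] := ltr_add_invr fx; right; exists k => //; split => //=.
    by rewrite lerBrDr ltW.
  by have [k hk] := ltr_add_invr fx; left; exists k.
apply: negligibleU; apply: negligible_bigcup => k.
  have : (inf S < inf S + k.+1%:R^-1)%R by rewrite ltrDl invr_gt0.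
  by move=> /(inf_lt S_ne)[c Sc ck]; exact: Smono Sc (ltW ck).
apply: Sup => Sk; have := ge_inf S_lb Sk.
by apply/negP; rewrite -ltNge ltrBlDr ltrDl invr_gt0.
Qed.

Lemma ae_eq_atom_lift (f : {mfun T >-> R}) : exists y, f = atom_lift y %[ae mu].
Proof.
have /choice[y Hy] := const_on_cell f; exists y.
apply: (@negligibleS _ _ _ mu (\bigcup_n (D n `&` [set x | f x <> y n])) _).
  move=> x /= /not_implyP[_ h]; exists (phi x) => //; split => //.
exact: negligible_bigcup.
Qed.

Lemma atoms_to_nat : exists (nu : {measure set nat -> \bar R})
    (phi : T -> nat) (lift : (nat -> R) -> {mfun T >-> R}),
  [/\ forall n, 0 < nu [set n] < +oo,
      forall y x, lift y x = y (phi x),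
      forall y, dist mu (lift y) = dist nu y &
      forall f : {mfun T >-> R}, exists y, f = lift y %[ae mu]].
Proof.
exists atom_measure, atom_index, atom_lift; split => // [n|f].
  by rewrite atom_measure_gt0 atom_measure_lty.
exact: ae_eq_atom_lift.
Qed.

End atoms_to_nat.

(** * Exponents of an embedding *)

Section dnorm_classes.
Context d (T : measurableType d) {R : realType}.
Variable mu : {measure set T -> \bar R}.
Local Open Scope ereal_scope.
Local Open Scope quotient_scope.
Local Notation V := {mfun_ mu, T >-> R}.

Lemma dnorm_pi (q r : R) (f : {mfun T >-> R}) :
  dnorm mu q r (repr (\pi_V f)) = dnorm mu q r f.
Proof. by rewrite /dnorm /dterm (dist_ae_eq (mfun_ae_reprK mu f)). Qed.

Lemma finite_part_dnorm (p q : R) (u : V) : (0 < p)%R -> (0 < q)%R ->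
  lorentz_norm mu p q u < +oo <-> dnorm mu q (q / p) (repr u) < +oo.
Proof.
move=> p0 q0; have C0 := dyadic_const_gt0 p q0.
have := @lorentz_norm_dyadic _ _ _ mu _ _ p0 q0 (repr u); rewrite reprK => -[lo up].
split=> h.
  apply: (le_lt_trans lo); rewrite lte_mul_pinfty ?lee_fin ?(ltW C0)//.
  by rewrite poweR_lty// poweR_ge0.
rewrite ltNge leye_eq; apply/negP => /eqP e; move: up; rewrite e poweRyr ?gt_eqF//.
by rewrite leye_eq => /eqP E; have := lte_mul_pinfty _ _ h; move=> /(_ (dyadic_const p q)%:E);
  rewrite E lee_fin ltxx (ltW C0) => /(_ isT isT).
Qed.

End dnorm_classes.

Section norm_comparison.
Context d1 d2 (T1 : measurableType d1) (T2 : measurableType d2) {R : realType}.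
Variables (mu1 : {measure set T1 -> \bar R}) (mu2 : {measure set T2 -> \bar R}).
Variables (p q : R).
Hypotheses (p0 : 0 < p) (q0 : 0 < q).
Local Open Scope ereal_scope.
Variables (u : {mfun_ mu1, T1 >-> R}) (v : {mfun_ mu2, T2 >-> R}).
Local Notation r := (q / p)%R.
Local Notation K := (dyadic_const p q).
Local Notation du := (dnorm mu1 q r (repr u)).
Local Notation dv := (dnorm mu2 q r (repr v)).
Local Notation Lu := (lorentz_norm mu1 p q u).
Local Notation Lv := (lorentz_norm mu2 p q v).

Let K0 : (0 <= K)%R. Proof. exact/ltW/dyadic_const_gt0. Qed.

(** The constants of an isomorphism carry no sign condition, hence [|C|]; passing to the dyadic
    quasi-norm on both sides contributes the factor [K^2]. *)
Lemma dnorm_le_of_lorentz (C : R) :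
  Lu <= C%:E * Lv -> du <= (K ^+ 2 * `|C| `^ q)%:E * dv.
Proof.
move=> LC.
have := @lorentz_norm_dyadic _ _ _ mu1 _ _ p0 q0 (repr u); rewrite reprK => -[+ _].
have := @lorentz_norm_dyadic _ _ _ mu2 _ _ p0 q0 (repr v); rewrite reprK => -[_ vL] uL.
apply: (le_trans uL); rewrite expr2 -mulrA EFinM -muleA lee_wpmul2l ?lee_fin//.
have Lv0 : 0 <= Lv by exact: poweR_ge0.
apply: (@le_trans _ _ ((`|C|%:E * Lv) `^ q)).
  apply: gt0_ler_poweR; rewrite ?in_itv/= ?leey ?andbT ?(ltW q0)//.
  - exact: poweR_ge0.
  - by rewrite mule_ge0.
  - by apply: (le_trans LC); rewrite lee_wpmul2r// lee_fin ler_norm.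
rewrite poweRM//.
by rewrite poweR_EFin mulrC EFinM -muleA lee_wpmul2l// lee_fin powR_ge0.
Qed.

End norm_comparison.

Section bounded_functions.
Context {R : realType}.
Local Open Scope ereal_scope.

Lemma dnorm_bounded_lty (q r B : R) (f : {mfun measurableTypeR R >-> R}) :
  (0 < q)%R -> (0 < r)%R -> (forall x, `|f x| <= B)%R ->
  dnorm (lebesgue01 R) q r f < +oo.
Proof.
move=> q0 r0 fB; pose n := (Num.bound (q / r)).+1.
have qn : (q < n%:R * r)%R.
  rewrite -ltr_pdivrMr//; apply: lt_le_trans (archi_boundP _) _; first by rewrite divr_ge0// ltW.
  by rewrite ler_nat leqnSn.
have B0 : (0 <= B)%R by rewrite (le_trans _ (fB 0%R)).
have d1 s : dist (lebesgue01 R) f s <= 1.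
  have <- : lebesgue01 R [set: R] = 1.
    by rewrite lebesgue01E setTI lebesgue_measure_itv/= lte_fin ltr01 oppr0 adde0.
  by apply: le_measure; rewrite ?inE//; exact: measurable_dist.
(* The tail bound [(B / 2^k)^n] is at least 1 for [2^k < B], and from [B] on the distribution
   function vanishes. *)
have := @dnorm_le_tail R _ _ (lebesgue01 R) q r f n (B ^+ n)%R 1%R q0 r0 qn.
move=> /(_ _ _ _ _)/le_lt_trans; apply.
- exact: exprn_ge0.
- exact: ler01.
- by move=> k; rewrite measure_ge0 d1.
- move=> k; rewrite mul1r; have [Bk|kB] := leP B (e2 k%:R).
    suff -> : dist (lebesgue01 R) f (e2 k%:R) = 0.
      by rewrite lee_fin mulr_ge0 ?e2_ge0// exprn_ge0.
    rewrite -(measure0 (lebesgue01 R)); congr (lebesgue01 R _).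
    by apply/seteqP; split => x //=; rewrite ltNge (le_trans (fB x)).
  apply: (le_trans (d1 _)); rewrite lee_fin -mulNr e2X e2N -exprMn exprn_ege1//.
  by rewrite ler_pdivlMr ?e2_gt0// mul1r ltW.
- by rewrite ltry.
Qed.

End bounded_functions.

Section transfer.
Context d (T : measurableType d) {R : realType}.
Variables (p q : R) (mu : {measure set T -> \bar R}).
Hypotheses (p0 : 0 < p) (q0 : 0 < q).
Variables (nu : {measure set nat -> \bar R}) (phi : T -> nat).
Variable lift : (nat -> R) -> {mfun T >-> R}.
Hypothesis lift_index : forall y x, lift y x = y (phi x).
Hypothesis dist_lift : forall y, dist mu (lift y) = dist nu y.
Hypothesis lift_onto : forall f : {mfun T >-> R}, exists y, f = lift y %[ae mu].
Local Open Scope ereal_scope.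
Local Open Scope quotient_scope.
Local Notation r := (q / p)%R.
Local Notation U := {mfun_ lebesgue01 R, measurableTypeR R >-> R}.
Local Notation V := {mfun_ mu, T >-> R}.
Local Notation fin := (finite_part (lorentz_norm (lebesgue01 R) p q)).

Let r0 : (0 < r)%R. Proof. by rewrite divr_gt0. Qed.

(** [Y m j n] represents the image of a Rademacher function as a sequence. The embedding is thereby
    reduced to a two-sided estimate on finite combinations. *)
Lemma embedding_rademacher :
  embeds_isomorphically (lorentz_norm (lebesgue01 R) p q) (lorentz_norm mu p q) ->
  exists (Y : nat -> nat -> nat -> nat -> R) (B : R), (0 < B)%R /\
  forall m L (a : nat -> nat -> R),
    let N1 := dnorm (lebesgue01 R) q r (rcomb m L a) in
    let N2 := dnorm nu q r (fun k => \sum_(j < m) \sum_(n < L) a j n * Y m j n k)%R in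
    N1 <= B%:E * N2 /\ N2 <= B%:E * N1.
Proof.
move=> [Z [_ [J [Jlin _ [C1 JC1] [C2 JC2]]]]].
have finE (f : {mfun measurableTypeR R >-> R}) B : (forall x, `|f x| <= B)%R ->
    fin (\pi_U f).
  move=> fB; apply/(finite_part_dnorm _ p0 q0); rewrite dnorm_pi.
  exact: dnorm_bounded_lty fB.
have fin0 : fin (0%R : U).
  by apply: (finE 0%R 0%R) => x; rewrite normr0.
have J0 : J 0%R = 0%R.
  by have := Jlin 1%R 0%R 0%R fin0 fin0;
    rewrite !scale1r addr0 => /(congr1 (fun z => z - J 0%R)%R); rewrite subrr addrK => ->.
have lift0 : \pi_V (lift (fun=> 0%R)) = 0%R.
  by congr (\pi_V _); apply/mfuneqP => x; rewrite lift_index.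
have liftD c y z : \pi_V (lift (fun k => c * y k + z k)%R) = (c *: \pi_V (lift y) + \pi_V (lift z))%R.
  rewrite -mfun_ae_piZ -mfun_ae_piD; congr (\pi_V _); apply/mfuneqP => x.
  by rewrite lift_index/= -!lift_index.
have /choice[Y0 HY] : forall i : nat * nat * nat, exists y,
    J (\pi_U (rfun i.1.1 i.1.2 i.2)) = \pi_V (lift y).
  move=> i; have [y Hy] := lift_onto (repr (J (\pi_U (rfun i.1.1 i.1.2 i.2)))).
  by exists y; rewrite -[LHS]reprK; apply/mfun_ae_eqP.
pose Y m j n := Y0 (m, j, n).
have rb m j n x : (`|rfun m j n x : R| <= 1)%R.
  by rewrite /rfun normrM normrX normrN1 expr1n mulr1; case: eqP; rewrite ?normr1 ?normr0.
(* The explicit bounds [b] are carried along because [J] is linear on vectors of finite norm only,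
   and bounded functions on (0, 1) are such vectors. *)
have lincomb (I : eqType) (s : seq I) (f : I -> {mfun measurableTypeR R >-> R})
    (y : I -> nat -> R) (b : I -> R) (c : I -> R) :
  (forall i x, `|f i x| <= b i)%R -> (forall i, J (\pi_U (f i)) = \pi_V (lift (y i))) ->
  exists F : {mfun measurableTypeR R >-> R},
    [/\ forall x, F x = (\sum_(i <- s) c i * f i x)%R,
        forall x, (`|F x| <= \sum_(i <- s) `|c i| * b i)%R &
        J (\pi_U F) = \pi_V (lift (fun k => \sum_(i <- s) c i * y i k)%R)].
  move=> fb Jf; elim: s => [|i s [F [FE Fb JF]]].
    exists 0%R; split => [x|x|]; rewrite ?big_nil ?normr0//.
    rewrite -[\pi_U 0%R]/(0%R : U) J0 -lift0; congr (\pi_V (lift _)).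
    by apply/funext => k; rewrite big_nil.
  exists (c i *: f i + F)%R; split => [x|x|].
  - by rewrite big_cons -FE.
  - rewrite big_cons/=; apply: (le_trans (ler_normD _ _)); rewrite lerD//.
    by rewrite normrM ler_wpM2l.
  - rewrite mfun_ae_piD mfun_ae_piZ Jlin; [|exact: finE (fb i)|exact: finE Fb].
    rewrite Jf JF -liftD; congr (\pi_V (lift _)).
    by apply/funext => k; rewrite big_cons.
pose B := (dyadic_const p q ^+ 2 * `|C1| `^ q + dyadic_const p q ^+ 2 * `|C2| `^ q + 1)%R.
have K0 : (0 <= dyadic_const p q)%R by rewrite ltW// dyadic_const_gt0.
have b1 : (0 <= dyadic_const p q ^+ 2 * `|C1| `^ q)%R by rewrite mulr_ge0 ?exprn_ge0// powR_ge0.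
have b2 : (0 <= dyadic_const p q ^+ 2 * `|C2| `^ q)%R by rewrite mulr_ge0 ?exprn_ge0// powR_ge0.
exists Y, B; split; first by rewrite /B; lra.
move=> m L a N1 N2.
have inner j := @lincomb 'I_L (index_enum 'I_L) (fun n => rfun m j n) (fun n => Y m j n)
  (fun=> 1%R) (fun n => a j n) (fun n => rb m j n) (fun n => HY (m, j, val n)).
have /choice[G HG] := inner.
have [F [FE Fb JF]] := @lincomb 'I_m (index_enum 'I_m) (fun j => G j)
  (fun j k => \sum_(n < L) a j n * Y m j n k)%R
  (fun j => \sum_(n < L) `|a j n| * 1)%R (fun=> 1%R)
  (fun j => let: And3 _ h _ := HG j in h) (fun j => let: And3 _ _ h := HG j in h).
have N1E : N1 = dnorm (lebesgue01 R) q r (repr (\pi_U F)).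
  rewrite dnorm_pi /N1; congr dnorm; apply/funext => x.
  rewrite FE /rcomb; apply: eq_bigr => j _; rewrite mul1r.
  by have [-> _ _] := HG j.
have N2E : N2 = dnorm mu q r (repr (J (\pi_U F))).
  rewrite JF dnorm_pi /N2 /dnorm /dterm dist_lift; apply: eq_esum => k _.
  congr (_ * dist nu _ _ `^ _); apply/funext => i.
  by apply: eq_bigr => j _; rewrite mul1r.
have finF : fin (\pi_U F) by exact: finE Fb.
rewrite N1E N2E; split.
- apply: (le_trans (dnorm_le_of_lorentz p0 q0 (JC2 _ finF))).
  by rewrite lee_wpmul2r ?dnorm_ge0// lee_fin /B; lra.
- apply: (le_trans (dnorm_le_of_lorentz p0 q0 (JC1 _ finF))).
  by rewrite lee_wpmul2r ?dnorm_ge0// lee_fin /B; lra.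
Qed.

End transfer.

Lemma exponent_le0 {R : realType} (s x M : R) : 0 < x ->
  (forall j : nat, e2 (s * j%:R) * x <= M) -> s <= 0.
Proof.
move=> x0 h; rewrite leNgt; apply/negP => /(@e2_unbounded R s (M / x))[j].
by rewrite ltNge ler_pdivlMr// h.
Qed.

Section no_embedding.
Context d (T : measurableType d) {R : realType}.
Variables (p q : R) (mu : {measure set T -> \bar R}) (A : nat -> set T).
Hypotheses (p0 : 0 < p) (q0 : 0 < q).
Hypotheses (hmu : purely_atomic mu) (hA : atoms_are mu A).
Hypothesis hfin : forall n, (mu (A n) < +oo)%E.
Local Notation r := (q / p).

Let r0 : 0 < r. Proof. by rewrite divr_gt0. Qed.

Lemma embedding_exponents :
  embeds_isomorphically (lorentz_norm (lebesgue01 R) p q) (lorentz_norm mu p q) ->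
  r = 1 /\ q = 2.
Proof.
have [nu [phi [lift [nuP liftE dlift lift_onto]]]] := atoms_to_nat hmu hA hfin.
move=> /(embedding_rademacher p0 q0 liftE dlift lift_onto)[Y [B [B0 HY]]].
have nu_gt0 k : (0 < nu [set k])%E by have /andP[] := nuP k.
have nu_lty k : (nu [set k] < +oo)%E by have /andP[] := nuP k.
have [c [C [c0 [C0 HC]]]] := @rcomb_bounds R q r q0 r0.
pose Yc m L (a : nat -> nat -> R) k := \sum_(j < m) \sum_(n < L) a j n * Y m j n k.
have Ybounds m L (a : nat -> nat -> R) (J : pred nat) : (0 < m)%N ->
    (forall j, (j < m)%N -> J j -> \sum_(n < L) a j n ^+ 2 = 1) ->
    (forall j, (j < m)%N -> ~~ J j -> forall n, (n < L)%N -> a j n = 0) ->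
    ((c / B * (m%:R^-1 * \sum_(j < m) (J j)%:R) `^ r)%:E <= dnorm nu q r (Yc m L a)
      <= (B * C * (m%:R^-1 * \sum_(j < m) (J j)%:R) `^ r)%:E)%E.
  move=> m0 J1 J0; have /andP[lo up] := HC m L a J m0 J1 J0.
  have [h1 h2] := HY m L a; apply/andP; split.
    by rewrite mulrAC mulrC EFinM lee_pdivrMl//; exact: le_trans h1.
  apply: (le_trans h2); rewrite -mulrA EFinM lee_wpmul2l ?lee_fin ?(ltW B0)//.
have tr (f g : nat -> R) (x y : \bar R) : (x <= dnorm nu q r f <= y)%E ->
    (forall k, f k = g k) -> (x <= dnorm nu q r g <= y)%E by move=> + /funext <-.
have c0' : 0 < c / B by rewrite divr_gt0.
split.
  have key (K : nat) : (0 < K)%N ->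
      K%:R * (c / B * K%:R^-1 `^ r) <= kap q r ^+ 2 * (B * C) /\
      c / B <= kap q r * e2 r * K%:R * (B * C * K%:R^-1 `^ r).
    move=> K0.
    (* The index is reduced modulo [K] because the first hypothesis ranges over all [i]. *)
    have H := @lq_of_l2_families R nu q r q0 r0 nu_gt0 nu_lty K
      (fun i n k => Y K (i %% K)%N n k) (c / B * K%:R^-1 `^ r) (B * C * K%:R^-1 `^ r) (c / B) (B * C).
    apply: H => [i L a a1|L a a1].
      have := @Ybounds K L (fun j n => (j == i %% K)%N%:R * a n) (pred1 (i %% K)%N) K0.
      have iK : (i %% K < K)%N by rewrite ltn_mod.
      have -> : Yc K L (fun j n => (j == i %% K)%N%:R * a n) =
          comb L a (fun n k => Y K (i %% K)%N n k).
        apply/funext => k; rewrite /Yc (bigD1 (Ordinal iK))//= [X in _ + X]big1 ?addr0.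
          by apply: eq_bigr => n _; rewrite eqxx mul1r.
        move=> j ji; apply: big1 => n _.
        by have /negbTE -> : (val j != i %% K)%N by []; rewrite !mul0r.
      rewrite (bigD1 (Ordinal iK))//= eqxx big1 ?addr0 ?mulr1; last first.
        by move=> j ji; have /negbTE -> : (val j != i %% K)%N by [].
      apply.
        by move=> j _ /eqP ->; rewrite eqxx; under eq_bigr do rewrite mul1r.
      by move=> j _ /negbTE -> n _; rewrite mul0r.
    have := @Ybounds K L a predT K0 (fun j jK _ => a1 j jK) (fun j _ h => False_ind _ (elimN idP h isT)).
    rewrite sumr_const card_ord mulVf ?pnatr_eq0 -?lt0n// powR1 !mulr1.
    move=> /tr; apply => k.
    by apply: eq_bigr => j _; apply: eq_bigr => n _; rewrite modn_small.
  have E j : (2 ^ j)%:R = e2 j%:R :> R by rewrite natrX e2_nat.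
  have Ej j : (2 ^ j)%:R^-1 `^ r = e2 (- (r * j%:R)) :> R.
    by rewrite E -e2N -e2M; congr e2; ring.
  apply/eqP; rewrite eq_le; apply/andP; split; rewrite -subr_le0.
    apply: (@exponent_le0 R _ _ (kap q r * e2 r * (B * C)) c0') => j.
    have [|_] := key (2 ^ j)%N; first by rewrite expn_gt0.
    rewrite Ej E => /(ler_wpM2l (e2_ge0 ((r - 1) * j%:R)))/le_trans; apply.
    have e1 : e2 ((r - 1) * j%:R) * e2 j%:R * e2 (- (r * j%:R)) = 1.
      by rewrite -!e2D -[RHS]e20; congr e2; ring.
    by rewrite -[leRHS]mulr1 -[X in _ <= _ * X]e1 le_eqVlt; apply/orP; left; apply/eqP; ring.
  apply: (@exponent_le0 R _ _ (kap q r ^+ 2 * (B * C)) c0') => j.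
  have [|+ _] := key (2 ^ j)%N; first by rewrite expn_gt0.
  rewrite Ej E; apply: le_trans.
  have -> : (1 - r) * j%:R = j%:R + - (r * j%:R) by ring.
  by rewrite e2D -mulrA [_ * (c / B)]mulrC.
(* Family [i] consists of the indices [n * K + i]. As [K = 4^J], the sum of [K] normalised
   combinations is [2^J] times a normalised one, and [dnorm_scale] applies without loss. *)
have key (J : nat) (K := (4 ^ J)%N) :
    K%:R * (c / B) <= kap q r ^+ 2 * (e2 (q * J%:R) * (B * C)) /\
    e2 (q * J%:R) * (c / B) <= kap q r * e2 r * K%:R * (B * C).
  have K0 : (0 < K)%N by rewrite expn_gt0.
  have Y1 (L : nat) (b : nat -> R) : \sum_(l < L * K) b l ^+ 2 = 1 ->
      ((c / B)%:E <= dnorm nu q r (fun k => \sum_(n < L) \sum_(i < K) b (n * K + i)%N * Y 1%N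
        0%N (n * K + i)%N k)%R <= (B * C)%:E)%E.
    move=> b1; have := @Ybounds 1%N (L * K)%N (fun _ => b) predT isT (fun _ _ _ => b1) (fun j
      _ h => False_ind _ (elimN idP h isT)).
    rewrite big_ord1 invr1 mul1r powR1 !mulr1.
    move=> /tr; apply => k.
    by rewrite /Yc big_ord1 (sum_blocks (fun l => b l * Y 1%N 0%N l k)).
  have H := @lq_of_l2_families R nu q r q0 r0 nu_gt0 nu_lty K
    (fun i n k => Y 1%N 0%N (n * K + i %% K)%N k) (c / B) (B * C) (e2 (q * J%:R) * (c / B))
      (e2 (q * J%:R) * (B * C)).
  have modK (n : nat) (i : 'I_K) : ((n * K + i) %% K = i)%N by rewrite modnMDl modn_small.
  have divK (n : nat) (i : 'I_K) : ((n * K + i) %/ K = n)%N by rewrite divnMDl// divn_small// addn0.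
  apply: H => [i L a a1|L a a1].
    have iK : (i %% K < K)%N by rewrite ltn_mod.
    pose b l := if (l %% K == i %% K)%N then a (l %/ K)%N else 0.
    have bE (h : R -> nat -> R) : (forall l, h 0 l = 0) -> forall L,
        \sum_(n < L) \sum_(j < K) h (b (n * K + j)%N) (n * K + j)%N = \sum_(n < L) h (a n) (n
          * K + i %% K)%N.
      move=> h0 L'; apply: eq_bigr => n _; rewrite (bigD1 (Ordinal iK))//= big1 ?addr0.
        by rewrite /b (modK _ (Ordinal iK)) (divK _ (Ordinal iK)) eqxx.
      move=> j ji; rewrite /b modK.
      by have /negbTE -> : (val j != i %% K)%N by [].
    have := Y1 L b; rewrite (sum_blocks (fun l => b l ^+ 2)) (bE (fun x _ => x ^+ 2)) => [|_];
      last by rewrite expr0n.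
    move=> /(_ a1)/tr; apply => k.
    by rewrite (bE (fun x l => x * Y 1%N 0%N l k)) => [|l]; rewrite ?mul0r.
  pose b l := e2 (- J%:R) * a (l %% K)%N (l %/ K)%N.
  have b1 : \sum_(l < L * K) b l ^+ 2 = 1.
    rewrite (sum_blocks (fun l => b l ^+ 2)) exchange_big/=.
    under eq_bigr => i _.
      under eq_bigr => n _ do rewrite /b modK divK exprMn.
      rewrite -mulr_sumr a1//; over.
    rewrite sumr_const card_ord mulr1 -[_ *+ K]mulr_natr /K natrX -e2_pow4 -e2X -e2D.
    by rewrite -e20; congr e2; ring.
  have := Y1 L b b1.
  set F := (X in dnorm _ _ _ X); set G := (X in _ -> is_true (_ <= dnorm _ _ _ X <= _)%E).
  have -> : G = (fun k => e2 (Posz J)%:~R * F k).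
    apply/funext => k; rewrite /G /F /comb exchange_big mulr_sumr; apply: eq_bigr => n _.
    rewrite mulr_sumr; apply: eq_bigr => i _.
    rewrite /b modK divK modn_small// e2N. by rewrite mulrA mulrA mulfV ?mul1r// gt_eqF// e2_gt0.
  rewrite (dnorm_scale q r nu F (Posz J)) => /andP[lo up]; rewrite !EFinM.
  by rewrite !lee_wpmul2l ?lee_fin ?e2_ge0.
have E j : (4 ^ j)%:R = e2 (2 * j%:R) :> R by rewrite natrX e2_pow4.
apply/eqP; rewrite eq_le; apply/andP; split; rewrite -subr_le0.
  apply: (@exponent_le0 R _ _ (kap q r * e2 r * (B * C)) c0') => j.
  have [_] := key j; rewrite E => /(ler_wpM2l (e2_ge0 (- (2 * j%:R)))).
  have e3 : e2 (- (2 * j%:R)) * e2 (q * j%:R) = e2 ((q - 2) * j%:R).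
    by rewrite -e2D; congr e2; ring.
  rewrite [X in X <= _]mulrA e3 => /le_trans; apply.
  have e1 : e2 (- (2 * j%:R)) * e2 (2 * j%:R) = 1 :> R by rewrite -e2D addNr e20.
  by rewrite -[leRHS]mulr1 -[X in _ <= _ * X]e1 le_eqVlt; apply/orP; left; apply/eqP; ring.
apply: (@exponent_le0 R _ _ (kap q r ^+ 2 * (B * C)) c0') => j.
have [+ _] := key j; rewrite E => /(ler_wpM2l (e2_ge0 (- (q * j%:R)))).
have e3 : e2 (- (q * j%:R)) * e2 (2 * j%:R) = e2 ((2 - q) * j%:R).
  by rewrite -e2D; congr e2; ring.
rewrite [X in X <= _]mulrA e3 => /le_trans; apply.
have e1 : e2 (- (q * j%:R)) * e2 (q * j%:R) = 1 by rewrite -e2D addNr e20.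
by rewrite -[leRHS]mulr1 -[X in _ <= _ * X]e1 le_eqVlt; apply/orP; left; apply/eqP; ring.
Qed.

End no_embedding.

(** * The case p = q = 2 *)

Section sqint_dnorm.
Context d (T : measurableType d) {R : realType}.
Variables (rho : {measure set T -> \bar R}) (D : set T) (mD : measurable D).
Local Open Scope ereal_scope.

Definition sqint (f : T -> R) : \bar R := \int[rho]_(x in D) (f x ^+ 2)%:E.

Lemma sqint_ge0 f : 0 <= sqint f.
Proof. by apply: integral_ge0 => x _; rewrite lee_fin sqr_ge0. Qed.

Variables (mu : set T -> \bar R).
Hypothesis muE : forall A, mu A = rho (D `&` A).
Variables (f : T -> R) (mf : measurable_fun D f).

Let mg : measurable_fun D (fun x => `|f x|%:E).
Proof. by apply/measurable_EFinP; exact: measurableT_comp. Qed.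

Let sumE : dnorm mu 2 1 f = \esum_(k in [set: int])
  ((e2 (2 * k%:~R))%:E * rho (D `&` [set x | (e2 k%:~R)%:E < `|f x|%:E])).
Proof.
apply: eq_esum => k _; rewrite /dterm /dist muE poweRe1; last exact: measure_ge0.
by [].
Qed.

Let intE : \int[rho]_(x in D) (`|f x|%:E `^ 2) = sqint f.
Proof.
apply: eq_integral => x _.
by rewrite poweR_EFin -[2%R]/(2%:R) powR_mulrn// real_normK// num_real.
Qed.

Lemma dnorm_le_sqint : dnorm mu 2 1 f <= (gsum 2)%:E * sqint f.
Proof. by rewrite sumE -intE; apply: esum_shell_le. Qed.

Lemma sqint_le_dnorm : sqint f <= 4%:E * dnorm mu 2 1 f.
Proof.
have -> : 4%R = e2 2 :> R by rewrite -[2%R]/(2%:R) e2_nat; ring.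
by rewrite sumE -intE; apply: le_esum_shell.
Qed.

End sqint_dnorm.

(** * Dyadic intervals and Haar coefficients on (0, 1) *)

Section unit_interval.
Context {R : realType}.
Local Notation leb := (@lebesgue_measure R).
Local Notation D := (`]0%R, 1%R[%classic : set (measurableTypeR R)).
Implicit Types f g : measurableTypeR R -> R.

Definition dyadic (L i : nat) : set (measurableTypeR R) :=
  D `&` [set x | piece (2 ^ L) x = i].

Lemma measurable_dyadic L i : measurable (dyadic L i).
Proof. by apply: measurableI => //; exact: measurable_piece_eq. Qed.

Lemma sub_dyadic L i : dyadic L i `<=` D.
Proof. exact: subIsetl. Qed.

Lemma lebesgue_dyadic L i : (i < 2 ^ L)%N -> leb (dyadic L i) = ((2 ^+ L)^-1)%:E.
Proof.
by move=> iL; rewrite /dyadic setIC -lebesgue01E lebesgue01_piece// natrX.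
Qed.

Lemma dyadicS L i : dyadic L i = dyadic L.+1 i.*2 `|` dyadic L.+1 i.*2.+1.
Proof.
apply/seteqP; split => x; rewrite /dyadic /=.
  move=> [x01 xi]; move: (x01); rewrite in_itv/= => /andP[x0 _].
  have h : (piece (2 ^ L * 2) x %/ 2 = i)%N by rewrite piece_div// ltW.
  rewrite expnSr; move: h; set k := piece _ _ => h.
  have := divn_eq k 2; rewrite h muln2; have : (k %% 2 < 2)%N by rewrite ltn_mod.
  by case: (k %% 2)%N => [|[|//]] _; rewrite ?addn0 ?addn1 => ->; [left|right].
have h : D x -> (piece (2 ^ L * 2) x %/ 2 = piece (2 ^ L) x)%N.
  by rewrite /= in_itv/= => /andP[x0 _]; rewrite piece_div// ltW.
by rewrite expnSr => -[] [x01 e]; split => //; rewrite -h//= e divn2/= ?uphalf_double ?doubleK.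
Qed.

Lemma dyadicS_disj L i : [disjoint dyadic L.+1 i.*2 & dyadic L.+1 i.*2.+1].
Proof. by apply/disj_set2P/seteqP; split => x // [[_ /= e] [_ /= /eqP]]; rewrite e ltn_eqF. Qed.

Definition dyint f L i : R := \int[leb]_(x in dyadic L i) f x.

Lemma integrable_dyadic f L i : leb.-integrable D (EFin \o f) ->
  leb.-integrable (dyadic L i) (EFin \o f).
Proof.
by apply: integrableS => //; [exact: measurable_dyadic|exact: sub_dyadic].
Qed.

Lemma dyintS f L i : leb.-integrable D (EFin \o f) ->
  dyint f L i = dyint f L.+1 i.*2 + dyint f L.+1 i.*2.+1.
Proof.
move=> intf; rewrite /dyint [in LHS]dyadicS Rintegral_setU//.
- exact: measurable_dyadic.
- exact: measurable_dyadic.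
- by rewrite -dyadicS; exact: integrable_dyadic.
- exact: dyadicS_disj.
Qed.

Lemma sum_dyint f L : leb.-integrable D (EFin \o f) ->
  \sum_(i < 2 ^ L) dyint f L i = \int[leb]_(x in D) f x.
Proof.
move=> intf; elim: L => [|L <-].
  rewrite expn0 big_ord1 /dyint; congr Rintegral; apply/seteqP; split => x; first by case.
  move=> x01; split => //=; apply/eqP; rewrite -leqn0 -ltnS; exact: piece_lt.
rewrite expnS mul2n sum_double; apply: eq_bigr => i _.
by rewrite (dyintS L i intf).
Qed.

(* Coefficients with respect to the Haar basis: for [n = 2 ^ L + i] with
   [i < 2 ^ L], the coefficient on the two halves of the dyadic interval [i] of
   level [L]. *)
Definition haar f n : R :=
  if n is 0 then dyint f 0 0 else
  let L := trunc_log 2 n in let i := (n - 2 ^ L)%N in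
  Num.sqrt (2 ^+ L) * (dyint f L.+1 i.*2 - dyint f L.+1 i.*2.+1).

(** The right side is the square integral of the averages of [f] over the dyadic intervals of level
    [L]. One more level is the identity [(a + b)^2 + (a - b)^2 = 2 (a^2 + b^2)] for the two halves
    of each interval. *)
Lemma haar_parseval f L : leb.-integrable D (EFin \o f) ->
  \sum_(n < 2 ^ L) haar f n ^+ 2 = 2 ^+ L * \sum_(i < 2 ^ L) dyint f L i ^+ 2.
Proof.
move=> intf; elim: L => [|L ih].
  by rewrite !expn0 !big_ord1 mul1r.
rewrite expnS mul2n -addnn big_split_ord/= ih.
rewrite addnn (sum_double (fun i => dyint f L.+1 i ^+ 2)).
rewrite exprS !mulr_sumr -big_split/=; apply: eq_bigr => i _.
have tl : trunc_log 2 (2 ^ L + i) = L.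
  by apply: trunc_log_eq => //; rewrite leq_addr/= expnS mul2n -addnn ltn_add2l.
have -> : haar f (2 ^ L + i) =
    Num.sqrt (2 ^+ L) * (dyint f L.+1 i.*2 - dyint f L.+1 i.*2.+1).
  have : (0 < 2 ^ L + i)%N by rewrite addn_gt0 expn_gt0.
  move: tl (addKn (2 ^ L) i); rewrite /haar; case: (2 ^ L + i)%N => // n -> -> _.
  by [].
rewrite (dyintS L i intf) exprMn sqr_sqrtr ?exprn_ge0//; ring.
Qed.

Lemma sqint_integrable f : measurable_fun D f -> (sqint leb D f < +oo)%E ->
  leb.-integrable D (EFin \o (fun x => f x ^+ 2)) /\ leb.-integrable D (EFin \o f).
Proof.
move=> mf fi.
have i2 : leb.-integrable D (EFin \o (fun x => f x ^+ 2)).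
  apply/integrableP; split; first by apply/measurable_EFinP; exact: measurable_funX.
  by under eq_integral do rewrite /= ger0_norm ?sqr_ge0//.
split=> //.
have i1 : leb.-integrable D (EFin \o (fun=> 1 : R)).
  apply/integrableP; split; first exact: measurable_cst.
  under eq_integral do rewrite /= normr1.
  by rewrite integral_cst//= lebesgue_measure_itv/= lte_fin ltr01 oppr0 adde0 mul1e ltry.
apply: (le_integrable _ _ _ (integrableD _ i1 i2)) => //.
  exact/measurable_EFinP.
move=> x _ /=; rewrite lee_fin [leRHS]ger0_norm ?addr_ge0 ?sqr_ge0//.
rewrite -[f x ^+ 2]real_normK ?num_real//.
have := sqr_ge0 (`|f x| - 1); rewrite sqrrB1; have := normr_ge0 (f x); nra.
Qed.

End unit_interval.

Section sqint_fatou.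
Context d (T : measurableType d) {R : realType}.
Variables (rho : {measure set T -> \bar R}) (D : set T) (mD : measurable D).
Local Open Scope ereal_scope.

(** Lower semicontinuity of the square integral under almost everywhere convergence; it serves the
    Haar expansion and again completeness. *)
Lemma sqint_fatou (g : nat -> T -> R) (f : T -> R) (M : \bar R) :
  (forall n, measurable_fun D (g n)) -> measurable_fun D f ->
  {ae rho, forall x, D x -> g n x @[n --> \oo] --> f x} ->
  (forall n, sqint rho D (g n) <= M) -> sqint rho D f <= M.
Proof.
move=> mg mf gf gM.
have mg2 n : measurable_fun D (fun x => (g n x ^+ 2)%:E).
  by apply/measurable_EFinP; exact: measurable_funX.
pose h x := limn_einf (fun n => (g n x ^+ 2)%:E).
have mh : measurable_fun D h.
  rewrite (_ : h = fun x => - limn_esup (fun n => - (g n x ^+ 2)%:E)); last first.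
    by apply/funext => x; rewrite -limn_einfN; congr limn_einf; apply/funext => n /=; rewrite opprK.
  apply: measurableT_comp => //;
    apply: (@measurable_fun_limn_esup _ _ _ _ (fun n x => - (g n x ^+ 2)%:E)) => n.
  exact: measurableT_comp.
have h0 x : 0 <= h x.
  rewrite /h limn_einf_lim; apply: lime_ge; first exact: is_cvg_einfs.
  by apply: nearW => n; apply: le_ereal_inf_tmp => _ [k _ <-]; rewrite lee_fin sqr_ge0.
apply: (@le_trans _ _ (\int[rho]_(x in D) h x)).
  apply: ae_ge0_le_integral => //.
  - by move=> x _; rewrite lee_fin sqr_ge0.
  - by apply/measurable_EFinP; exact: measurable_funX.
  - apply: filterS gf => x gfx Dx.
    have /cvg_limn_einf_sup[] : (g n x ^+ 2)%:E @[n --> \oo] --> (f x ^+ 2)%:E.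
      by apply: cvg_EFin; [exact: nearW|apply: (cvgM (gfx Dx) (gfx Dx))].
    by rewrite /h => ->.
apply: le_trans (fatou rho mD mg2 _) _ => [n x _|]; first by rewrite lee_fin sqr_ge0.
rewrite limn_einf_lim; apply: lime_le; first exact: is_cvg_einfs.
apply: nearW => n; apply: le_trans (gM n).
by apply: ereal_inf_lbound; exists n => //=.
Qed.

End sqint_fatou.

Section haar_norm.
Context {R : realType}.
Local Notation leb := (@lebesgue_measure R).
Local Notation D := (`]0%R, 1%R[%classic : set (measurableTypeR R)).
Implicit Types f g : measurableTypeR R -> R.
Local Notation energy f L := (2 ^+ L * \sum_(i < 2 ^ L) dyint f L i ^+ 2).

Lemma integrable_cst_dyadic (c : R) L i : (i < 2 ^ L)%N ->
  leb.-integrable (dyadic L i) (EFin \o cst c).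
Proof.
move=> iL; apply: measurable_bounded_integrable.
- exact: measurable_dyadic.
- by rewrite (_ : (_ < _)%E = (leb (dyadic L i) < +oo)%E)// lebesgue_dyadic// ltry.
- exact: measurable_cst.
- by exists `|c|; split => // M cM x _; exact: ltW.
Qed.

Lemma Rintegral_cst_dyadic (c : R) L i : (i < 2 ^ L)%N ->
  \int[leb]_(_ in dyadic L i) c = c * (2 ^+ L)^-1.
Proof.
move=> iL; rewrite Rintegral_cst; last exact: measurable_dyadic.
by rewrite [X in fine X](lebesgue_dyadic iL).
Qed.

(** On each dyadic interval, the integral of [(f - t)^2] is nonnegative when [t] is the mean of [f]
    there. *)
Lemma energy_le f L : measurable_fun D f -> (sqint leb D f < +oo)%E ->
  ((energy f L)%:E <= sqint leb D f)%E.
Proof.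
move=> mf fi; have [i2 i1] := sqint_integrable mf fi.
have -> : sqint leb D f = (\int[leb]_(x in D) (f x ^+ 2))%:E.
  rewrite /Rintegral fineK//; exact: integrable_fin_num i2.
rewrite lee_fin -(sum_dyint L i2) mulr_sumr; apply: ler_sum => i _.
have mP := measurable_dyadic L i.
have i1P := integrable_dyadic L i i1; have i2P := integrable_dyadic L i i2.
pose t := 2 ^+ L * dyint f L i.
have i3P : leb.-integrable (dyadic L i) (EFin \o (fun x => (- (2 * t)) * f x)).
  exact: (integrableZl _ _ i1P).
have i4P := @integrable_cst_dyadic (t ^+ 2) L i (ltn_ord i).
have : 0 <= \int[leb]_(x in dyadic L i) ((f x ^+ 2 + (- (2 * t)) * f x) + t ^+ 2).
  apply: Rintegral_ge0 => x _.
  have -> : f x ^+ 2 + - (2 * t) * f x + t ^+ 2 = (f x - t) ^+ 2 by ring.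
  exact: sqr_ge0.
rewrite RintegralD//; last exact: (integrableD _ i2P i3P).
rewrite RintegralD// RintegralZl// Rintegral_cst_dyadic//.
rewrite -/(dyint f L i) -/(dyint (fun x => f x ^+ 2) L i) /t.
have p0 : 2 ^+ L != 0 :> R by rewrite expf_neq0.
have -> : (2 ^+ L * dyint f L i) ^+ 2 * (2 ^+ L)^-1 = 2 ^+ L * dyint f L i ^+ 2.
  by field.
rewrite -subr_ge0 => h; apply: le_trans h _; rewrite le_eqVlt; apply/orP; left; apply/eqP; ring.
Qed.

(** Dyadic intervals shrink to the point only inside [D]; elsewhere balls of the same measure take
    their place, so that the family is defined at every point. *)
Let E (x : measurableTypeR R) n := if x \in D then dyadic n (piece (2 ^ n) x)
  else ball (x : R) (2 ^+ n.+1)^-1 : set R.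

Let E_shrinking x : nicely_shrinking x (E x).
Proof.
have p0 n : 0 < (2 ^+ n.+1)^-1 :> R by rewrite invr_gt0 exprn_gt0.
split => [n|].
  by rewrite /E; case: ifP => _; [exact: measurable_dyadic|exact: measurable_ball].
have p0' n : 0 < 2 * (2 ^+ n)^-1 :> R by rewrite mulr_gt0// invr_gt0 exprn_gt0.
(* A dyadic interval of length [2^(-n)] containing [x] lies in the ball of radius [2 * 2^(-n)],
   whose measure is 4 times that length. *)
exists (4, fun n => PosNum (p0' n)); split => //=.
- rewrite -[X in _ --> X](mulr0 2); apply: cvgMr.
  under eq_fun do rewrite -exprVn.
  by apply: cvg_expr; rewrite ger0_norm ?invr_ge0// invf_lt1// ltr1n.
- move=> n; rewrite /E; case: ifPn => [/set_mem xD y [yD /= yx]|_]; last first.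
    apply: le_ball; rewrite exprS invfM; have := p0 n; rewrite exprS invfM.
    have : (0 : R) < (2 ^+ n)^-1 by rewrite invr_gt0 exprn_gt0.
    lra.
  move: xD yD; rewrite /= !in_itv/= => /andP[x0 _] /andP[y0 _].
  rewrite /ball/= ltr_pdivlMr ?exprn_gt0//.
  have tr (z : R) : 0 < z -> (piece (2 ^ n) z)%:R <= 2 ^+ n * z < (piece (2 ^ n) z).+1%:R.
    move=> z0; rewrite -natrX; apply: truncn_itv; by rewrite mulr_ge0// ltW.
  have := tr x x0; have := tr y y0; rewrite yx => /andP[y1 y2] /andP[x1 x2].
  have P0 : (0 : R) < 2 ^+ n by rewrite exprn_gt0.
  rewrite -[X in _ * X]gtr0_norm// -normrM ltr_norml.
  rewrite -natr1 in y2 x2; apply/andP; split; lra.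
- move=> n; rewrite lebesgue_measure_ball ?(ltW (p0' n))//.
  have q0 : (0 : R) < (2 ^+ n)^-1 by rewrite invr_gt0 exprn_gt0.
  rewrite /E; case: ifPn => [xD|_].
    rewrite lebesgue_dyadic; last first.
      by move/set_mem : xD; rewrite /= in_itv/= => x01; apply: piece_lt; rewrite ?expn_gt0.
    by rewrite -EFinM lee_fin mulr2n; lra.
  rewrite lebesgue_measure_ball ?(ltW (p0 n))// -EFinM lee_fin exprS invfM.
  by rewrite -[leLHS]mulr_natr -[X in _ <= _ * X]mulr_natr; lra.
Qed.

Lemma sqint_le_energy f (M : R) : measurable_fun setT f ->
  leb.-integrable D (EFin \o f) ->
  (forall L, energy f L <= M) -> (sqint leb D f <= M%:E)%E.
Proof.
move=> mf intf fM.
(* The mean of [f] over the dyadic interval of level [L] around [x]; its square integral is the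
   energy of that level. *)
pose g L (x : measurableTypeR R) := 2 ^+ L * dyint f L (piece (2 ^ L) x).
have mg L : measurable_fun setT (g L).
  exact: (measurable_fun_piece (2 ^ L) (fun i => 2 ^+ L * dyint f L i)).
apply: (@sqint_fatou _ _ _ leb D _ g).
- by [].
- by move=> n; apply: measurable_funTS; exact: mg.
- exact: measurable_funTS.
- have locf := integrable_locally_restrict (measurable_itv `]0%R, 1%R[) intf.
  have [N [mN N0 HN]] := lebesgue_differentiation locf.
  exists N; split => // x /= nx; apply: HN => /= xpt; apply: nx => xD.
  have := nice_lebesgue_differentiation E_shrinking locf xpt.
  rewrite /patch mem_set// => h.
  have P0 n : (0 : R) < 2 ^+ n by rewrite exprn_gt0.
  have {h} : (g n x)%:E @[n --> \oo] --> (f x)%:E.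
    apply: cvg_trans h; apply: near_eq_cvg; apply: nearW => n.
    rewrite /E mem_set//.
    have iL : (piece (2 ^ n) x < 2 ^ n)%N.
      by apply: piece_lt; [rewrite expn_gt0|move: xD; rewrite /= in_itv].
    rewrite lebesgue_dyadic// inver gt_eqF ?invr_gt0// invrK /g EFinM; congr (_ * _)%E.
    rewrite /dyint /Rintegral fineK; last first.
      by apply: integrable_fin_num; [exact: measurable_dyadic|exact: integrable_dyadic].
    apply: eq_integral => y /set_mem/sub_dyadic yD.
    by rewrite /patch mem_set.
  by move/fine_cvgP => [].
- move=> L; rewrite (le_trans _ (_ : (energy f L)%:E <= _)%E) ?lee_fin//.
  have gi : leb.-integrable D (EFin \o (fun x => g L x ^+ 2)).
    apply: measurable_bounded_integrable => //.
    - rewrite (_ : (_ < _)%E = (leb D < +oo)%E)//.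
      by rewrite lebesgue_measure_itv/= lte_fin ltr01 oppr0 adde0 ltry.
    - by apply: measurable_funX; apply: measurable_funTS; exact: mg.
    - pose B := \sum_(i < 2 ^ L) (2 ^+ L * dyint f L i) ^+ 2.
      exists B; split; first by rewrite num_real.
      move=> M' BM x /= xD; rewrite ger0_norm ?sqr_ge0// (le_trans _ (ltW BM))//.
      have iL : (piece (2 ^ L) x < 2 ^ L)%N.
        by apply: piece_lt; [rewrite expn_gt0|move: xD; rewrite /= in_itv].
      by rewrite /B (bigD1 (Ordinal iL))//= lerDl sumr_ge0// => i _; exact: sqr_ge0.
  have -> : sqint leb D (g L) = (\int[leb]_(x in D) (g L x ^+ 2))%:E.
    by rewrite /Rintegral fineK//; exact: integrable_fin_num gi.
  rewrite lee_fin -(sum_dyint L gi) mulr_sumr; apply: ler_sum => i _.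
  rewrite {1}/dyint (@eq_Rintegral _ _ _ _ _ (fun=> (2 ^+ L * dyint f L i) ^+ 2)); last first.
    by move=> x /set_mem[_ /= xi]; rewrite /g xi.
  rewrite Rintegral_cst_dyadic//.
  have p0 : 2 ^+ L != 0 :> R by rewrite expf_neq0.
  by rewrite le_eqVlt; apply/orP; left; apply/eqP; field.
Qed.

End haar_norm.

(** * Completeness for the square integral *)

Section sqint_complete.
Context d (T : measurableType d) {R : realType}.
Variables (rho : {measure set T -> \bar R}) (D : set T) (mD : measurable D).
Hypothesis D1 : (rho D <= 1)%E.
Local Open Scope ereal_scope.

(** In place of the Cauchy-Schwarz inequality, the pointwise bound [|h| <= s / 2 + h^2 / (2 s)] is
    integrated over a set of mass at most 1. *)
Let integral_le_of_sqint (h : T -> R) (s : R) : (0 < s)%R -> measurable_fun D h ->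
  sqint rho D h <= (s ^+ 2)%:E -> \int[rho]_(x in D) `|h x|%:E <= s%:E.
Proof.
move=> s0 mh hs.
have mh2 : measurable_fun D (fun x => (h x ^+ 2)%:E).
  by apply/measurable_EFinP; exact: measurable_funX.
have s20 : (0 <= (2 * s)^-1)%R by rewrite invr_ge0 mulr_ge0// ltW.
apply: (@le_trans _ _ (\int[rho]_(x in D) ((s / 2)%:E + ((2 * s)^-1)%:E * (h x ^+ 2)%:E))).
  apply: ge0_le_integral => //.
  - by apply/measurable_EFinP; exact: measurableT_comp.
  - by apply: emeasurable_funD; [exact: measurable_cst|exact: measurable_funeM].
  - move=> x _; rewrite -EFinM -EFinD lee_fin -[(h x ^+ 2)%R]real_normK ?num_real//.
    have /(mulr_ge0 s20) := sqr_ge0 (`|h x| - s)%R.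
    have -> : ((2 * s)^-1 * (`|h x| - s) ^+ 2 = s / 2 + (2 * s)^-1 * `|h x| ^+ 2 - `|h x|)%R.
      by field; rewrite gt_eqF.
    by rewrite subr_ge0.
rewrite ge0_integralD//; last 3 first.
- by move=> x _; rewrite lee_fin ltW// divr_gt0.
- by move=> x _; rewrite -EFinM lee_fin mulr_ge0// sqr_ge0.
- exact: measurable_funeM.
rewrite integral_cst// ge0_integralZl_EFin//; last first.
  by move=> x _; rewrite lee_fin sqr_ge0.
apply: (@le_trans _ _ ((s / 2)%:E * 1 + ((2 * s)^-1)%:E * (s ^+ 2)%:E)).
  by apply: leeD; apply: lee_wpmul2l => //; rewrite lee_fin ltW// divr_gt0.
rewrite mule1 -EFinM -EFinD lee_fin le_eqVlt; apply/orP; left; apply/eqP.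
by field; rewrite gt_eqF.
Qed.

(** Riesz-Fischer with a rate: the increments are summable in L_1, so the telescoping series
    converges almost everywhere, and [sqint_fatou] carries the Cauchy bound to the limit. *)
Lemma sqint_complete (f : nat -> T -> R) : (forall n, measurable_fun setT (f n)) ->
  (forall k m, (k <= m)%N -> sqint rho D (fun x => f m x - f k x)%R <= ((4 ^- k) ^+ 2)%:E) ->
  exists2 g : T -> R, measurable_fun setT g &
    forall k, sqint rho D (fun x => g x - f k x)%R <= ((4 ^- k) ^+ 2)%:E.
Proof.
move=> mf fC.
have p0 k : (0 < 4 ^- k :> R)%R by rewrite invr_gt0 exprn_gt0.
pose h k x := (f k.+1 x - f k x)%R.
have mh k : measurable_fun D (h k).
  by apply: measurable_funB; apply: measurable_funTS; exact: mf.
have mhE k : measurable_fun D (fun x => `|h k x|%:E).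
  by apply/measurable_EFinP; exact: measurableT_comp.
pose G x := \sum_(k <oo) `|h k x|%:E.
have G0 x : 0 <= G x by apply: nneseries_ge0.
have intG : rho.-integrable D G.
  apply/integrableP; split; first exact: ge0_emeasurable_sum.
  under eq_integral do rewrite gee0_abs//.
  rewrite integral_nneseries//.
  apply: (@le_lt_trans _ _ (\sum_(k <oo) ((4^-1 : R) ^+ k)%:E)).
    apply: lee_nneseries => [k *|k *]; first by apply: integral_ge0.
    by rewrite exprVn; apply: integral_le_of_sqint => //; exact: fC.
  by rewrite nneseries_geometric ?ltry//; lra.
(* The upper limit is measurable on the whole space and agrees with the limit wherever the sequence
   converges. *)
pose g x := fine (limn_esup (fun n => (f n x)%:E)).
have mg : measurable_fun setT g.
  apply: measurableT_comp => //.
  apply: (@measurable_fun_limn_esup _ _ _ _ (fun n x => (f n x)%:E)) => n.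
  exact/measurable_EFinP.
have fg : {ae rho, forall x, D x -> f n x @[n --> \oo] --> g x}.
  apply: filterS (integrable_ae mD intG) => x + Dx => /(_ Dx) Gx.
  have cs : cvgn (series (fun k => h k x)).
    apply: normed_cvg; apply: nondecreasing_is_cvgn.
      by apply: nondecreasing_series => n _ _ /=.
    exists (fine (G x)) => _ [n _ <-]; rewrite -lee_fin fineK//.
    rewrite /series/= -sumEFin; exact: nneseries_lim_ge.
  have cf : cvgn (fun n => f n x).
    have e : (fun n => f n x) = (fun n => series (fun k => h k x) n + f 0%N x)%R.
      apply/funext => n; rewrite [series _](_ : _ = series (telescope (fun n => f n x)))//.
      by rewrite telescopeK /= subrK.
    by rewrite e; apply: is_cvgD => //; exact: is_cvg_cst.
  have : (f n x)%:E @[n --> \oo] --> (limn (fun n => f n x))%:E.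
    by apply: cvg_EFin; [exact: nearW|exact: cf].
  by rewrite /g => /cvg_limn_einf_sup[_ ->].
exists g => // k; apply: (@sqint_fatou _ _ _ _ _ mD (fun n x => f (n + k)%N x - f k x)%R).
- by move=> n; apply: measurable_funB; apply: measurable_funTS; exact: mf.
- by apply: measurable_funB; apply: measurable_funTS.
- apply: filterS fg => x fgx Dx; apply: cvgB; last exact: cvg_cst.
  by rewrite (cvg_shiftn k (fun n => f n x)); exact: fgx.
- by move=> n; apply: fC; rewrite leq_addl.
Qed.

End sqint_complete.

Section sqint_algebra.
Context d (T : measurableType d) {R : realType}.
Variables (rho : {measure set T -> \bar R}) (D : set T) (mD : measurable D).
Local Open Scope ereal_scope.
Local Notation N := (sqint rho D).

Lemma sqintD_le (a : R) (f g : T -> R) : measurable_fun D f -> measurable_fun D g ->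
  N (fun x => a * f x + g x)%R <= (2 * a ^+ 2)%:E * N f + 2%:E * N g.
Proof.
move=> mf mg.
have m2 (h : T -> R) : measurable_fun D h -> measurable_fun D (fun x => (h x ^+ 2)%:E).
  by move=> mh; apply/measurable_EFinP; exact: measurable_funX.
have a0 : (0 <= 2 * a ^+ 2)%R by rewrite mulr_ge0// sqr_ge0.
have h0 (h : T -> R) x : D x -> 0 <= (h x ^+ 2)%:E by rewrite lee_fin sqr_ge0.
rewrite -!ge0_integralZl_EFin//; [|exact: h0|exact: m2|exact: h0|exact: m2].
rewrite -ge0_integralD//; last 4 first.
- by move=> x Dx; rewrite mule_ge0 ?h0.
- by apply: measurable_funeM; exact: m2.
- by move=> x Dx; rewrite mule_ge0 ?h0.
- by apply: measurable_funeM; exact: m2.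
apply: ge0_le_integral => //.
- by move=> x Dx; exact: (h0 (fun x => a * f x + g x)%R).
- by apply: (m2 (fun x => a * f x + g x)%R); apply: measurable_funD => //; exact: measurable_funM.
- by apply: emeasurable_funD; apply: measurable_funeM; exact: m2.
- move=> x _; rewrite -!EFinM -EFinD lee_fin.
  by have := sqr_ge0 (a * f x - g x)%R; nra.
Qed.

Lemma sqint_eq0 (f : T -> R) : measurable_fun D f -> N f <= 0 ->
  {ae rho, forall x, D x -> f x = 0%R}.
Proof.
move=> mf f0.
have mf2 : measurable_fun D (fun x => (f x ^+ 2)%:E).
  by apply/measurable_EFinP; exact: measurable_funX.
have : ae_eq rho D (fun x => (f x ^+ 2)%:E) (cst 0).
  apply/(ae_eq_integral_abs rho mD mf2)/eqP; rewrite eq_le integral_ge0// andbT.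
  by under eq_integral do rewrite gee0_abs ?lee_fin ?sqr_ge0//.
apply: filterS => x h Dx; have /eqP := h Dx.
by rewrite eqe sqrf_eq0 => /eqP.
Qed.

End sqint_algebra.

Section sqint_nat.
Context {R : realType}.
Variables (nu : {measure set nat -> \bar R}).
Local Open Scope ereal_scope.

Lemma sqint_natE (y : nat -> R) :
  sqint nu setT y = \sum_(k <oo) ((y k ^+ 2)%:E * nu [set k]).
Proof.
rewrite /sqint (_ : setT = \bigcup_k [set k]); last first.
  by apply/seteqP; split => // k _; exists k.
rewrite ge0_integral_bigcup//; last first.
  by apply/trivIsetP => i j _ _ ij; apply/seteqP; split => // k [/= -> /eqP]; rewrite (negbTE ij).
  by move=> x _; rewrite lee_fin sqr_ge0.
apply: eq_eseriesr => k _; rewrite (@eq_integral _ _ _ _ _ (cst (y k ^+ 2)%:E)).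
  by rewrite integral_cst.
by move=> i /set_mem /= ->.
Qed.

End sqint_nat.

Section haar_properties.
Context {R : realType}.
Local Notation leb := (@lebesgue_measure R).
Local Notation D := (`]0%R, 1%R[%classic : set (measurableTypeR R)).
Implicit Types f g : measurableTypeR R -> R.

Lemma dyint_lin a f g L i : leb.-integrable D (EFin \o f) ->
  leb.-integrable D (EFin \o g) ->
  dyint (fun x => a * f x + g x) L i = a * dyint f L i + dyint g L i.
Proof.
move=> /(integrable_dyadic L i) fi /(integrable_dyadic L i) gi.
have mP := measurable_dyadic L i.
rewrite /dyint RintegralD ?RintegralZl//.
exact: (integrableZl _ _ fi).
Qed.

Lemma haar_lin a f g n : leb.-integrable D (EFin \o f) ->
  leb.-integrable D (EFin \o g) ->
  haar (fun x => a * f x + g x) n = a * haar f n + haar g n.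
Proof. by move=> fi gi; rewrite /haar; case: n => [|n]; rewrite !dyint_lin//; ring. Qed.

Lemma haar_ae (f g : {mfun measurableTypeR R >-> R}) :
  f = g %[ae lebesgue01 R] -> haar f = haar g.
Proof.
move=> [N [mN N0 fgN]].
suff e L i : dyint f L i = dyint g L i by apply/funext => -[|n]; rewrite /haar !e.
congr fine; apply: ae_eq_integral.
- exact: measurable_dyadic.
- by apply/measurable_EFinP; exact: measurable_funTS.
- by apply/measurable_EFinP; exact: measurable_funTS.
exists (N `&` D); split.
- exact: measurableI.
- by rewrite -N0 lebesgue01E.
- move=> x /= /not_implyP[[xD _] fg]; split => //; apply: fgN => /= h.
  by apply: fg; rewrite /= h.
Qed.

Lemma haar_isometry f : measurable_fun setT f -> (sqint leb D f < +oo)%E ->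
  (\sum_(n <oo) (haar f n ^+ 2)%:E = sqint leb D f)%E.
Proof.
move=> mf fi; have mfD : measurable_fun D f by exact: measurable_funTS.
have [_ i1] := sqint_integrable mfD fi.
have h0 n : (0 <= (haar f n ^+ 2)%:E)%E by rewrite lee_fin sqr_ge0.
have le1 : (\sum_(n <oo) (haar f n ^+ 2)%:E <= sqint leb D f)%E.
  apply: lime_le; first exact: is_cvg_nneseries.
  apply: nearW => n; apply: le_trans (energy_le n mfD fi).
  rewrite -haar_parseval// sumEFin lee_fin -(big_mkord xpredT (fun i => haar f i ^+ 2)).
  rewrite (@big_cat_nat _ _ _ n 0 (2 ^ n))//=; last exact/ltnW/ltn_expl.
  by rewrite lerDl sumr_ge0// => i _; exact: sqr_ge0.
apply/eqP; rewrite eq_le le1/=.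
have fS : (\sum_(n <oo) (haar f n ^+ 2)%:E)%E \is a fin_num.
  rewrite ge0_fin_numE ?nneseries_ge0//; exact: le_lt_trans fi.
rewrite -(fineK fS); apply: sqint_le_energy => // L.
rewrite -haar_parseval// -lee_fin fineK// -sumEFin -(big_mkord xpredT (fun i => (haar f i ^+ 2)%:E)).
exact: nneseries_lim_ge.
Qed.

End haar_properties.

Section lorentz_sq.
Context d (T : measurableType d) {R : realType} d' (T' : measurableType d').
Variables (mu : {measure set T -> \bar R}) (rho : {measure set T' -> \bar R}).
Variables (D : set T') (mD : measurable D).
Variables (f : {mfun T >-> R}) (g : T' -> R) (mg : measurable_fun D g).
Hypothesis fg : forall s, dist mu f s = rho (D `&` [set x | s < `|g x|]).
Local Open Scope ereal_scope.
Local Notation L := (lorentz_norm mu 2 2 (\pi_({mfun_ mu, T >-> R})%qT f)).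

Definition sq_const : R := (dyadic_const (2 : R) 2 * (gsum (2 : R) + 4))%R.

Lemma sq_const_gt0 : (0 < sq_const)%R.
Proof. by rewrite mulr_gt0 ?dyadic_const_gt0// addr_gt0// gsum_gt0. Qed.

(** Only the distribution functions are compared, so [g] may live on another space: this covers
    Lebesgue measure restricted to (0, 1) as well as lifted sequences. *)
Lemma lorentz_sq : L `^ 2 <= sq_const%:E * sqint rho D g /\
  sqint rho D g <= sq_const%:E * L `^ 2.
Proof.
have g0 : (0 < gsum (2 : R))%R by exact: gsum_gt0.
have K0 : (0 < dyadic_const (2 : R) 2)%R by exact: dyadic_const_gt0.
pose mu' A := rho (D `&` A).
have e : dnorm mu 2 (2 / 2) f = dnorm mu' 2 1 g.
  by rewrite divff ?pnatr_eq0// /dnorm /dterm; apply: eq_esum => k _; rewrite fg.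
have := @lorentz_norm_dyadic _ _ _ mu 2%R 2%R (ltr0n _ 2) (ltr0n _ 2) f.
rewrite e => -[lo up]; split.
  apply: (le_trans up); rewrite /sq_const EFinM -muleA lee_wpmul2l ?lee_fin ?(ltW K0)//.
  apply: (le_trans (@dnorm_le_sqint _ _ _ rho D mD mu' _ g mg)) => //.
  by rewrite lee_wpmul2r ?sqint_ge0// lee_fin lerDl.
apply: (le_trans (@sqint_le_dnorm _ _ _ rho D mD mu' _ g mg)) => //.
apply: (@le_trans _ _ (4%:E * ((dyadic_const (2 : R) 2)%:E * L `^ 2))).
  by rewrite lee_wpmul2l.
rewrite muleA -EFinM lee_wpmul2r ?poweR_ge0// lee_fin /sq_const mulrC.
by rewrite ler_wpM2l ?(ltW K0)// lerDr ltW.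
Qed.

End lorentz_sq.

Section poweR2.
Context {R : realType}.
Implicit Types (x y : \bar R) (K : R).
Local Open Scope ereal_scope.

Lemma le_poweR2 x y : 0 <= x -> x <= y -> x `^ 2 <= y `^ 2.
Proof.
move=> x0 xy; apply: gt0_ler_poweR; rewrite ?in_itv/= ?leey ?andbT//.
exact: le_trans xy.
Qed.

Lemma poweR2_le_sq x y K : 0 <= x -> 0 <= y -> (0 <= K)%R ->
  x `^ 2 <= (K ^+ 2)%:E * y `^ 2 -> x <= K%:E * y.
Proof.
move=> x0 y0 K0 h.
have E (z : \bar R) : 0 <= z -> z = (z `^ 2) `^ 2^-1.
  by move=> z0; rewrite -poweRrM mulfV ?pnatr_eq0// poweRe1.
rewrite [X in X <= _]E// [X in _ <= X]E ?mule_ge0//.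
apply: gt0_ler_poweR; rewrite ?in_itv/= ?leey ?andbT ?poweR_ge0// ?invr_ge0//.
by rewrite poweRM// poweR_EFin -[2%R]/(2%:R) powR_mulrn.
Qed.

Lemma poweR2_lty x y K : 0 <= x -> (0 < K)%R ->
  x `^ 2 <= K%:E * y -> y <= K%:E * x `^ 2 -> x < +oo <-> y < +oo.
Proof.
move=> x0 K0 xy yx; split => h.
  by apply: (le_lt_trans yx); rewrite lte_mul_pinfty ?lee_fin ?(ltW K0)// poweR_lty.
rewrite ltNge leye_eq; apply/negP => /eqP e; move: xy; rewrite e poweRyr ?pnatr_eq0//.
have := lte_mul_pinfty (ltW (K0 : 0 < K%:E)) isT h.
by move=> /lt_le_trans/[apply]; rewrite ltxx.
Qed.

End poweR2.

(** * The Haar isometry as an embedding of classes *)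

Section hilbert_embedding.
Context d (T : measurableType d) {R : realType}.
Variables (mu : {measure set T -> \bar R}) (nu : {measure set nat -> \bar R}).
Variables (phi : T -> nat) (lift : (nat -> R) -> {mfun T >-> R}).
Hypothesis nuP : forall n, (0 < nu [set n] < +oo)%E.
Hypothesis lift_index : forall y x, lift y x = y (phi x).
Hypothesis dist_lift : forall y, dist mu (lift y) = dist nu y.
Hypothesis lift_onto : forall f : {mfun T >-> R}, exists y, f = lift y %[ae mu].
Local Open Scope quotient_scope.
Local Notation leb := (@lebesgue_measure R).
Local Notation D := (`]0%R, 1%R[%classic : set (measurableTypeR R)).
Local Notation M01 := {mfun measurableTypeR R >-> R}.
Local Notation U := {mfun_ lebesgue01 R, measurableTypeR R >-> R}.
Local Notation V := {mfun_ mu, T >-> R}.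
Local Notation LU := (lorentz_norm (lebesgue01 R) 2 2).
Local Notation LV := (lorentz_norm mu 2 2).
Local Notation SU f := (sqint leb D f).
Local Notation SV z := (sqint nu setT z).
Local Notation K := (@sq_const R).
Implicit Types (u v : U) (z : nat -> R).

Let K0 : 0 < K. Proof. exact: sq_const_gt0. Qed.

Let weight k : R := fine (nu [set k]).

Let weight_gt0 k : 0 < weight k.
Proof. by have /andP[n0 n1] := nuP k; rewrite fine_gt0 ?n0. Qed.

Let weightE k : nu [set k] = (weight k)%:E.
Proof. by have /andP[n0 n1] := nuP k; rewrite fineK// ge0_fin_numE. Qed.

Definition haar_seq (f : measurableTypeR R -> R) k : R := haar f k / Num.sqrt (weight k).

Lemma haar_seq_isometry f : measurable_fun setT f -> (SU f < +oo)%E ->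
  SV (haar_seq f) = SU f.
Proof.
move=> mf fi; rewrite sqint_natE -haar_isometry//; apply: eq_eseriesr => k _.
rewrite weightE -EFinM /haar_seq expr_div_n sqr_sqrtr ?(ltW (weight_gt0 k))//.
by rewrite divfK// gt_eqF.
Qed.

Definition haar_map u : V := \pi_V (lift (haar_seq (repr u))).

Let lorU u : (LU u `^ 2 <= K%:E * SU (repr u) /\ SU (repr u) <= K%:E * LU u `^ 2)%E.
Proof.
have := @lorentz_sq _ _ R _ _ (lebesgue01 R) leb D _ (repr u) (repr u).
rewrite reprK; apply => //; first exact: measurable_funTS.
by move=> s; rewrite /dist lebesgue01E setIC.
Qed.

Let lorV z : (LV (\pi_V (lift z)) `^ 2 <= K%:E * SV z /\
  SV z <= K%:E * LV (\pi_V (lift z)) `^ 2)%E.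
Proof.
have := @lorentz_sq _ _ R _ _ mu nu setT _ (lift z) z; apply => //.
by move=> s; rewrite dist_lift setTI.
Qed.

Let finU u : finite_part LU u <-> (SU (repr u) < +oo)%E.
Proof. by have [a b] := lorU u; apply: (poweR2_lty _ K0 a b); exact: poweR_ge0. Qed.

Let mD : measurable D. Proof. by []. Qed.

Let mT (f : M01) : measurable_fun setT f. Proof. by []. Qed.

Let mDf (f : M01) : measurable_fun D f. Proof. exact: measurable_funTS. Qed.

Let leb_ae (f g : M01) : f = g %[ae lebesgue01 R] <-> {ae leb, forall x, D x -> f x = g x}.
Proof.
split=> -[N [mN N0 fgN]].
  exists (N `&` D); split; [exact: measurableI|by rewrite -N0 lebesgue01E|].
  move=> x /= /not_implyP[xD fg]; split => //; apply: fgN => /= h.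
  by apply: fg; rewrite h.
exists (N `|` ~` D); split.
- by apply: measurableU => //; exact: measurableC.
- rewrite lebesgue01E setIUl setICl setU0; apply/eqP; rewrite -measure_le0 -N0.
  by apply: le_measure; rewrite ?inE//; exact: measurableI.
- move=> x /= h; have [xD|] := pselect (D x); last by right.
  by left; apply: fgN => /= fg; apply: h => _; exact: fg.
Qed.

Let sqint_ae (f g : M01) : f = g %[ae lebesgue01 R] -> SU f = SU g.
Proof.
move=> /leb_ae fg; apply: ae_eq_integral => //.
- by apply/measurable_EFinP; exact: measurable_funX.
- by apply/measurable_EFinP; exact: measurable_funX.
by move: fg => [N [mN N0 fgN]]; exists N; split => // x /= h; apply: fgN => /= fg; apply: h => xD;
  rewrite fg.
Qed.

Let lift_lin a y z :
  \pi_V (lift (fun k => a * y k + z k)) = a *: \pi_V (lift y) + \pi_V (lift z).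
Proof.
rewrite -mfun_ae_piZ -mfun_ae_piD; congr (\pi_V _); apply/mfuneqP => x.
by rewrite lift_index/= -!lift_index.
Qed.

Let SU_lin (a : R) (f g : M01) : (SU f < +oo)%E -> (SU g < +oo)%E ->
  (SU (fun x => a * f x + g x)%R < +oo)%E.
Proof.
move=> fi gi; apply: (le_lt_trans (sqintD_le _ _ a (mDf f) (mDf g))) => //.
rewrite lte_add_pinfty// lte_mul_pinfty ?lee_fin ?sqint_ge0//.
by rewrite mulr_ge0// sqr_ge0.
Qed.

Let haar_seq_lin (a : R) (f g : M01) : (SU f < +oo)%E -> (SU g < +oo)%E ->
  haar_seq (fun x => a * f x + g x) = (fun k => a * haar_seq f k + haar_seq g k).
Proof.
move=> fi gi; apply/funext => k; rewrite /haar_seq haar_lin; first by ring.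
  by have [] := sqint_integrable (mDf f) fi.
by have [] := sqint_integrable (mDf g) gi.
Qed.

Let repr_lin (a : R) u v : (repr (a *: u + v) : M01) = (a *: repr u + repr v : M01) %[ae lebesgue01 R].
Proof. by apply/mfun_ae_eqP; rewrite mfun_ae_piD mfun_ae_piZ !reprK. Qed.

Let fin_lin (a : R) u v : finite_part LU u -> finite_part LU v ->
  finite_part LU (a *: u + v).
Proof.
move=> /finU ui /finU vi; apply/finU; rewrite (sqint_ae (repr_lin a u v)).
exact: SU_lin.
Qed.

Lemma haar_map_lin a u v : finite_part LU u -> finite_part LU v ->
  haar_map (a *: u + v) = a *: haar_map u + haar_map v.
Proof.
move=> /finU ui /finU vi; rewrite /haar_map -lift_lin; congr (\pi_V (lift _)).
rewrite -(haar_seq_lin _ ui vi) /haar_seq.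
by rewrite (haar_ae (repr_lin a u v)).
Qed.

Lemma haar_map_norm u : finite_part LU u ->
  (LV (haar_map u) <= K%:E * LU u)%E /\ (LU u <= K%:E * LV (haar_map u))%E.
Proof.
move=> /finU ui; have := haar_seq_isometry (mT (repr u)) ui => e.
have [U1 U2] := lorU u; have [] := lorV (haar_seq (repr u)).
rewrite e -/(haar_map u) => V1 V2.
split; (apply: poweR2_le_sq; [exact: poweR_ge0|exact: poweR_ge0|exact: ltW|]);
  rewrite expr2 EFinM -muleA.
  by apply: (le_trans V1); rewrite lee_wpmul2l ?lee_fin ?(ltW K0).
by apply: (le_trans U1); rewrite lee_wpmul2l ?lee_fin ?(ltW K0).
Qed.

Let haar_seq_dist u v : finite_part LU u -> finite_part LU v ->
  SV (fun k => haar_seq (repr u) k - haar_seq (repr v) k)%R =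
  SU (fun x => repr u x - repr v x)%R.
Proof.
move=> /finU ui /finU vi.
have -> : (fun k => haar_seq (repr u) k - haar_seq (repr v) k) =
    haar_seq (fun x => -1 * repr v x + repr u x).
  by rewrite haar_seq_lin//; apply/funext => k; rewrite mulN1r addrC.
have -> : (fun x => repr u x - repr v x) = (fun x => -1 * repr v x + repr u x).
  by apply/funext => x; rewrite mulN1r addrC.
rewrite haar_seq_isometry//; last exact: SU_lin.
by apply: measurable_funD => //; exact: measurable_funM.
Qed.

Let SV0 : SV (fun=> 0)%R = 0%E.
Proof. by apply: integral0_eq => k _; rewrite expr0n. Qed.

Let SV_eq0 z : (SV z <= 0)%E -> z = (fun=> 0).
Proof.
rewrite sqint_natE => h; apply/funext => k; apply: contrapT => /eqP zk.
move: h; apply/negP; rewrite -ltNge.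
have h0 i : (0 <= (z i ^+ 2)%:E * nu [set i])%E by rewrite mule_ge0// lee_fin sqr_ge0.
apply: (@lt_le_trans _ _ ((z k ^+ 2)%:E * nu [set k])%E).
  by rewrite weightE -EFinM lte_fin mulr_gt0// exprn_even_gt0.
apply: (@le_trans _ _ (\sum_(0 <= i < k.+1) ((z i ^+ 2)%:E * nu [set i]))%E).
  by rewrite big_nat_recr//= leeDr// sume_ge0.
exact: nneseries_lim_ge.
Qed.

(** The difference has square integral 0 and every atom has positive mass, so equality of classes is
    equality of sequences. *)
Let lift_inj y z : \pi_V (lift y) = \pi_V (lift z) -> y = z.
Proof.
move=> e; pose w k := -1 * z k + y k.
have w0 : \pi_V (lift w) = \pi_V (lift (fun=> 0)).
  rewrite /w lift_lin e -(lift_lin (-1)); congr (\pi_V (lift _)).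
  by apply/funext => k; rewrite mulN1r addNr.
have [_ a] := lorV w; have [b _] := lorV (fun=> 0).
have : (SV w <= 0)%E.
  apply: (le_trans a); rewrite w0; apply: (@le_trans _ _ (K%:E * (K%:E * SV (fun=> 0)%R))%E).
    by rewrite lee_wpmul2l// lee_fin ltW.
  by rewrite SV0 !mule0.
move=> /SV_eq0 we; apply/funext => k; have := congr1 (fun f => f k) we.
by rewrite /w mulN1r addrC => /eqP; rewrite subr_eq0 => /eqP.
Qed.

Lemma haar_map_inj u v : finite_part LU u -> finite_part LU v ->
  haar_map u = haar_map v -> u = v.
Proof.
move=> ui vi /lift_inj e.
have mB : measurable_fun D (fun x => repr u x - repr v x) by exact: measurable_funB.
have : (SU (fun x => repr u x - repr v x)%R <= 0)%E.
  rewrite -haar_seq_dist// e (_ : (fun=> _) = (fun=> 0)) ?SV0//.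
  by apply/funext => k; rewrite subrr.
move=> /(sqint_eq0 mD mB) h.
rewrite -[u]reprK -[v]reprK; apply/mfun_ae_eqP/leb_ae.
move: h => [N [mN N0 hN]]; exists N; split => // x /= h; apply: hN => /= e0; apply: h => xD.
by apply/eqP; rewrite -subr_eq0 e0.
Qed.

Lemma haar_map_closed : closed_subspace LV (haar_map @` finite_part LU).
Proof.
have fin0 : finite_part LU (0 : U).
  apply/finU; rewrite (sqint_ae (mfun_ae_reprK _ (0 : M01))).
  rewrite (_ : SU _ = 0%E) ?ltry//.
  by apply: integral0_eq => x _; rewrite expr0n.
have J0 : haar_map 0 = 0.
  by have := haar_map_lin 1 fin0 fin0;
    rewrite !scale1r addr0 => /(congr1 (fun y : V => y - haar_map 0)); rewrite subrr addrK => ->.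
split.
- move=> _ [u ui <-]; have [h _] := haar_map_norm ui.
  by apply: (le_lt_trans h); rewrite lte_mul_pinfty ?lee_fin ?(ltW K0).
- by exists 0.
- move=> a _ _ [u ui <-] [v vi <-]; exists (a *: u + v); first exact: fin_lin.
  exact: haar_map_lin.
move=> y yfin yclose.
have [z yz] : exists z, y = \pi_V (lift z).
  have [z h] := lift_onto (repr y); exists z.
  by rewrite -[y]reprK; apply/mfun_ae_eqP.
(* Two approximation errors, each doubled by [sqintD_le], add up to [4 * s k], the rate that
   [sqint_complete] asks for. *)
pose s k : R := ((4 ^- k) ^+ 2) / 4.
have s0 k : 0 < s k by rewrite /s divr_gt0// exprn_gt0// invr_gt0 exprn_gt0.
have /choice[u Hu] : forall k, exists u, finite_part LU u /\
    (SV (fun i => z i - haar_seq (repr u) i)%R <= (s k)%:E)%E.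
  (* [K * e^2 = s k] makes up for the loss in passing from the Lorentz norm to the square
     integral. *)
  move=> k; pose e := Num.sqrt (s k / K).
  have e0 : 0 < e by rewrite sqrtr_gt0 divr_gt0.
  have [_ [u ui <-] ue] := yclose e e0; exists u; split => //.
  have -> : (fun i => z i - haar_seq (repr u) i) = (fun i => -1 * haar_seq (repr u) i + z i).
    by apply/funext => i; rewrite mulN1r addrC.
  have [_ h] := lorV (fun i => -1 * haar_seq (repr u) i + z i).
  apply: (le_trans h); rewrite lift_lin -yz -/(haar_map u) scaleN1r addrC.
  apply: (@le_trans _ _ (K%:E * e%:E `^ 2)%E).
    rewrite lee_wpmul2l ?lee_fin ?(ltW K0)//; apply: le_poweR2 (ltW ue).
    exact: poweR_ge0.
  rewrite poweR_EFin -[2]/(2%:R) powR_mulrn ?(ltW e0)// sqr_sqrtr ?divr_ge0 ?(ltW K0) ?(ltW (s0 k))//.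
  by rewrite -EFinM lee_fin mulrCA divff ?mulr1// gt_eqF.
have ufin k : finite_part LU (u k) by have [] := Hu k.
have zu k : (SV (fun i => z i - haar_seq (repr (u k)) i)%R <= (s k)%:E)%E by have [] := Hu k.
have c0 : (0%:E <= (2 * (-1) ^+ 2 : R)%:E)%E by rewrite lee_fin mulr_ge0 ?sqr_ge0.
pose f k : M01 := repr (u k).
have fC k m : (k <= m)%N -> (SU (fun x => f m x - f k x)%R <= ((4 ^- k) ^+ 2)%:E)%E.
  move=> km; rewrite -(haar_seq_dist (ufin m) (ufin k)).
  pose A i := z i - haar_seq (repr (u m)) i; pose B i := z i - haar_seq (repr (u k)) i.
  rewrite (_ : (fun i => _) = (fun i => -1 * A i + B i)); last first.
    by apply/funext => i; rewrite /A /B; ring.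
  apply: (le_trans (@sqintD_le _ _ _ nu setT measurableT (-1) A B _ _)) => //.
  have sm : s m <= s k.
    rewrite /s ler_pM2r// ler_sqr ?nnegrE ?invr_ge0 ?exprn_ge0//.
    by rewrite lef_pV2 ?posrE ?exprn_gt0// ler_eXn2l// ltr1n.
  apply: (@le_trans _ _ ((2 * (-1) ^+ 2)%:E * (s k)%:E + 2%:E * (s k)%:E)%E).
    apply: leeD; first apply: (lee_wpmul2l c0); last apply: lee_wpmul2l => //.
      by apply: (le_trans (zu m)); rewrite lee_fin.
    exact: zu.
  rewrite -!EFinM -EFinD lee_fin sqrrN expr1n /s.
  by rewrite le_eqVlt; apply/orP; left; apply/eqP; field.
have D1 : (leb D <= 1)%E.
  by rewrite lebesgue_measure_itv/= lte_fin ltr01 oppr0 adde0.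
have [g mg gf] := @sqint_complete _ _ R leb D mD D1 f (fun n => mT (f n)) fC.
pose G : M01 := mkmfun mg; pose v : U := \pi_U G.
have vG : (repr v : M01) = G %[ae lebesgue01 R] by exact: mfun_ae_reprK.
have SG k : SU (fun x => repr v x - f k x)%R = SU (fun x => g x - f k x)%R.
  have /leb_ae [N [mN N0 hN]] := vG.
  apply: ae_eq_integral => //.
  - by apply/measurable_EFinP; apply: measurable_funX; exact: measurable_funB.
  - by apply/measurable_EFinP; apply: measurable_funX; apply: measurable_funB => //;
    exact: measurable_funTS.
  by exists N; split => // x /= h; apply: hN => /= e; apply: h => xD; rewrite e.
have vfin : finite_part LU v.
  apply/finU; rewrite (sqint_ae vG).
  rewrite (_ : SU G = SU (fun x => 1 * (g x - f 0%N x) + f 0%N x)%R); last first.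
    by apply: eq_integral => x _; rewrite mul1r subrK.
  apply: (le_lt_trans (@sqintD_le _ _ _ leb D mD 1 _ _ _ (mDf (f 0%N)))).
    by apply: measurable_funB => //; exact: measurable_funTS.
  have /finU f0 := ufin 0%N.
  rewrite lte_add_pinfty// lte_mul_pinfty ?lee_fin ?sqint_ge0// ?mulr_ge0 ?sqr_ge0//.
  exact: le_lt_trans (gf 0%N) (ltry _).
exists v => //; rewrite yz /haar_map; congr (\pi_V (lift _)).
have : (SV (fun i => z i - haar_seq (repr v) i)%R <= 0)%E.
  apply/lee_addgt0Pr => e e0; rewrite add0e.
  (* With [x = 4^(-k)] the error below is [2 x^2 + x^2 / 2], which is at most [e] when [x] is at
     most a quarter of both [e] and 1. *)
  have [k ke] : exists k, 4 ^- k <= Num.min e 1 / 4 :> R.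
    have [k hk] := @e2_small R (Num.min e 1 / 4) ltac:(by rewrite divr_gt0// lt_min e0 ltr01).
    exists k; apply: le_trans hk; rewrite e2N e2_nat lef_pV2 ?posrE ?exprn_gt0//.
    by apply: lerXn2r; rewrite ?nnegrE//; lra.
  pose A i := z i - haar_seq (repr (u k)) i.
  pose B i := haar_seq (repr v) i - haar_seq (repr (u k)) i.
  rewrite (_ : (fun i => _) = (fun i => -1 * B i + A i)); last first.
    by apply/funext => i; rewrite /A /B; ring.
  apply: (le_trans (@sqintD_le _ _ _ nu setT measurableT (-1) B A _ _)) => //.
  have Bk : (SV B <= ((4 ^- k) ^+ 2)%:E)%E.
    by rewrite /B (haar_seq_dist vfin (ufin k)) SG; exact: gf.
  apply: (@le_trans _ _ ((2 * (-1) ^+ 2)%:E * ((4 ^- k) ^+ 2)%:E + 2%:E * (s k)%:E)%E).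
    apply: leeD; first exact: (lee_wpmul2l c0).
    by apply: lee_wpmul2l => //; exact: zu.
  rewrite -!EFinM -EFinD lee_fin sqrrN expr1n /s.
  have t0 : (0 : R) < 4 ^- k by rewrite invr_gt0 exprn_gt0.
  have m1 : Num.min e 1 <= e by rewrite ge_min lexx.
  have m2 : Num.min e 1 <= 1 by rewrite ge_min lexx orbT.
  move: (4 ^- k) (Num.min e 1) t0 m1 m2 ke => t m t0 m1 m2 tm; nra.
move=> /SV_eq0 h; apply/funext => k; have := congr1 (fun f => f k) h.
by move=> /eqP; rewrite subr_eq0 => /eqP.
Qed.

Lemma embeds_2_2 : embeds_isomorphically LU LV.
Proof.
exists (haar_map @` finite_part LU); split; first exact: haar_map_closed.
exists haar_map; split.
- by move=> a x y; exact: haar_map_lin.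
- split.
  + by move=> u ui; exists u.
  + by move=> u v ui vi e; exact: (haar_map_inj (set_mem ui) (set_mem vi) e).
  + by move=> _ [u ui <-]; exists u.
- by exists K => u ui; have [] := haar_map_norm ui.
- by exists K => u ui; have [] := haar_map_norm ui.
Qed.

End hilbert_embedding.

Theorem theorem5p3 (R : realType) (p q : R) (hp : 1 < p) (hq : 1 <= q)
    (d : measure_display) (T : measurableType d)
    (mu : {sigma_finite_measure set T -> \bar R}) (A : nat -> set T)
    (hmu : purely_atomic mu) (hA : atoms_are mu A)
    (hfin : forall n, (mu (A n) < +oo)%E) :
  embeds_isomorphically (lorentz_norm (lebesgue01 R) p q) (lorentz_norm mu p q)
  <-> p = 2 /\ q = 2.
Proof.
have p0 : 0 < p by exact: lt_trans hp.
have q0 : 0 < q by exact: lt_le_trans hq.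
split=> [h|[-> ->]].
  have [qp q2] := embedding_exponents p0 q0 hmu hA hfin h; split=> //.
  by rewrite -q2 -[LHS]mul1r -qp divfK// gt_eqF.
have [nu [phi [lift [nuP liftE dlift lift_onto]]]] := atoms_to_nat hmu hA hfin.
exact: embeds_2_2 nuP liftE dlift lift_onto.
Qed.
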